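(* Let $n,k$ be positive integers with $2k<n$. Let $T\mapsto Q(T)$ be the bijection from $k$-triangulations of the convex $n$-gon to $k$-flagged tableaux of shape $\mu=(n-2k-1,\dots,2,1)$ described in the context. Then for every $k$-triangulation $T$, if $\rho(T)$ denotes the $k$-triangulation obtained from $T$ by rotating (replacing each vertex $i$ by $i+1$ modulo $n$), one has $$Q(\rho(T))=\rho(Q(T)),$$ where on the right-hand side $\rho$ is flagged promotion of $k$-flagged tableaux.
   Context: **$k$-triangulations.** A $k$-triangulation of a convex $n$-gon (vertices labelled $1,\dots,n$ cyclically) is a maximal collection of diagonals such that no $k+1$ of them mutually cross. **$k$-flagged tableaux.** A $k$-flagged tableau of shape $\mu$ is a semistandard tableau of shape $\mu$ (positive integer entries, weakly increasing along rows, strictly increasing down columns; rows numbered from top, longest row first) whose entries in row $i$ are $\le i+k$. **The bijection $T\mapsto Q(T)$.** Boxes are $(\text{row},\text{column})$. The staircase $(n-1,\dots,1)$ is the set of boxes $(r,c)$, $r,c\ge1$, $r+c\le n$. Identify the pair $\{i,j\}$, $1\le i<j\le n$, with the box $(n+1-j,i)$. Let $D$ be the set of boxes of the staircase whose pair is neither a side of the $n$-gon nor a diagonal of $T$. List the boxes $(r,c)$ of $D$ row by row from top to bottom, within each row from right to left, writing the column $\binom{r}{r+c-1}$ for each; this gives $\binom{a_1\cdots a_\ell}{b_1\cdots b_\ell}$. Insert $b_1,\dots,b_\ell$ successively into an initially empty tableau by column Edelman--Greene insertion: to insert $x$ into a column (starting with the first): if no entry of the column is larger than $x$, put $x$ at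 the bottom and stop. Otherwise let $y$ be the smallest entry larger than $x$; if $y=x+1$ and $x$ is already in the column, leave the column unchanged and insert $x+1$ into the next column; otherwise replace $y$ by $x$ and insert $y$ into the next column. When inserting $b_s$ creates a new box, record $a_s$ in that position of the recording tableau. $Q(T)$ is the final recording tableau; it is a $k$-flagged tableau of shape $\mu$. **Flagged promotion $\rho(Q)$** of a $k$-flagged tableau $Q$: (i) delete all instances of the letter $1$ (these are in the first row); (ii) apply jeu de taquin to the remaining entries (slide the resulting empty boxes, from right to left, outward: an empty box exchanges with the smaller of its right and lower neighbours, with the lower one in case of a tie, until it has no such neighbours); (iii) subtract $1$ from all entries; (iv) fill each empty box in row $i$ with $i+k$. The result is again a $k$-flagged tableau of the same shape. *)

(* Defs.v *)
From mathcomp Require Import all_boot.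

Set Implicit Arguments.
Unset Strict Implicit.
Unset Printing Implicit Defensive.

(* The vertex labelled i (1 <= i <= n) of the convex n-gon is the element of   *)
(* 'I_n with value i - 1; sides and diagonals are two-element sets of vertices.*)

Section Polygon.

Variable n : nat.
Implicit Types (e f : {set 'I_n}) (S T : {set {set 'I_n}}).

Definition side e : bool := [exists v : 'I_n, e == [set v; ordS v]].

Definition diagonal e : bool := (#|e| == 2) && ~~ side e.

Definition crossing e f : bool :=
  [exists a : 'I_n, exists b : 'I_n, exists c : 'I_n, exists d : 'I_n,
    [&& a < b, b < c, c < d &
        (e == [set a; c]) && (f == [set b; d])
     || (f == [set a; c]) && (e == [set b; d])]].

Definition mutually_crossing S : bool :=
  [forall e in S, forall f in S, (e != f) ==> crossing e f].

Definition has_crossing m S : bool :=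
  [exists C : {set {set 'I_n}},
    [&& C \subset S, #|C| == m & mutually_crossing C]].

Definition ktriangulation k T : bool :=
  maxset [pred S : {set {set 'I_n}} |
            (S \subset [set e | diagonal e]) && ~~ has_crossing k.+1 S] T.

Definition rotate T : {set {set 'I_n}} :=
  [set [set ordS v | v in e] | e : {set 'I_n} in T].

(* Boxes (row, column) of the staircase (n-1, ..., 1) are numbered from 1.     *)
(* box_pair sends (n+1-j, i) to the pair of the vertices labelled i and j.     *)
Definition box_pair (b : nat * nat) : {set 'I_n} :=
  [set v : 'I_n | (v.+1 == b.2) || (v.+1 == n.+1 - b.1)].

Definition staircase_boxes : seq (nat * nat) :=
  [seq (r, c) | r <- iota 1 n.-1, c <- rev (iota 1 (n - r))].

Definition complement_boxes T : seq (nat * nat) :=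
  [seq b <- staircase_boxes | ~~ side (box_pair b) && (box_pair b \notin T)].

Definition biword T : seq (nat * nat) :=
  [seq (b.1, (b.1 + b.2).-1) | b <- complement_boxes T].

End Polygon.

(* The insertion tableau is the list of its columns, each read from the top.   *)
(* eg_insert x P also returns the 0-based (row, column) of the new box. The    *)
(* columns are increasing, so the smallest entry larger than x is the first    *)
(* such entry; y moves on to the next column in both cases, since y = x + 1    *)
(* when the column is left unchanged.                                          *)
Fixpoint eg_insert (x : nat) (P : seq (seq nat)) {struct P} :
    seq (seq nat) * (nat * nat) :=
  if P is C :: P' then
    if has (ltn x) C then
      let p := find (ltn x) C in
      let y := nth 0 C p in
      let stay := (y == x.+1) && (x \in C) in
      let: (P'', (r, c)) := eg_insert y P' in
      ((if stay then C else set_nth 0 C p x) :: P'', (r, c.+1))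
    else (rcons C x :: P', (size C, 0))
  else ([:: [:: x]], (0, 0)).

(* All other tableaux are lists of rows; positions are 0-based, and the value  *)
(* 0 stands for an empty box (genuine entries are positive) or no box at all.  *)
Definition tableau := seq (seq nat).

Definition entry (t : tableau) (r c : nat) : nat := nth 0 (nth [::] t r) c.

Definition set_entry (t : tableau) (r c x : nat) : tableau :=
  set_nth [::] t r (set_nth 0 (nth [::] t r) c x).

Definition eg_step (PQ : seq (seq nat) * tableau) (ab : nat * nat) :
    seq (seq nat) * tableau :=
  let: (P, (r, c)) := eg_insert ab.2 PQ.1 in (P, set_entry PQ.2 r c ab.1).

Definition recording (w : seq (nat * nat)) : tableau :=
  (foldl eg_step ([::], [::]) w).2.

Definition Qtab (n : nat) (T : {set {set 'I_n}}) : tableau :=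
  recording (biword T).

(* One slide of the empty box at (r, c); m bounds the number of exchanges.     *)
Fixpoint slide (m r c : nat) (t : tableau) {struct m} : tableau :=
  if m is m'.+1 then
    let right := entry t r c.+1 in
    let below := entry t r.+1 c in
    if (right == 0) && (below == 0) then t
    else if (right == 0) || (0 < below <= right) then
      slide m' r.+1 c (set_entry (set_entry t r c below) r.+1 c 0)
    else
      slide m' r c.+1 (set_entry (set_entry t r c right) r c.+1 0)
  else t.

Definition delete_ones (t : tableau) : tableau :=
  [seq [seq if x == 1 then 0 else x | x <- row] | row <- t].

(* The number of boxes of t is enough fuel: no box is visited twice.           *)
(* Letters 1 only occur in the first row, so the empty boxes are sought there. *)
Definition jeu_de_taquin (t : tableau) : tableau :=
  let holes := [seq c <- iota 0 (size (nth [::] t 0)) | entry t 0 c == 0] in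
  foldl (fun u c => slide (sumn (shape t)) 0 c u) t (rev holes).

(* In the row of 0-based index r, i.e. row r + 1, empty boxes get r + 1 + k.   *)
Definition relabel (k : nat) (t : tableau) : tableau :=
  mkseq (fun r => [seq if x == 0 then r.+1 + k else x.-1 | x <- nth [::] t r])
    (size t).

Definition promotion (k : nat) (t : tableau) : tableau :=
  relabel k (jeu_de_taquin (delete_ones t)).

(* Main.v *)
(*
A word b_1 ... b_l in the letters 1, 2, ... stands for the product of the
simple transpositions (b b+1). For a k-triangulation T the letters of the
biword form a reduced word of the permutation w0 reversing k+1, ..., n-k and
fixing the other points. Indeed, the rank function of the Demazure product of
the letters counts the longest chains of mutually crossing diagonals and sides
outside the complement of T, so it is bounded by k, while maximality of T says
that the deletion of any letter violates this bound.

Rotation of T deletes the letters b of the first row and puts a letter n - b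
at the end of row n - b instead; up to commutations, which preserve all boxes,
these letters go to the end of the word, and the result is reduced for w0
because conjugation by w0 exchanges b and n - b.

Deleting the first letter of a reduced word changes the recording tableau by a
jeu de taquin slide: the elementary dual equivalences commute with both
operations, and a standard tableau is determined by the ascents of its dual
equivalents. The insertion tableau is a full staircase with known entries, so
the boxes created by the letters n - b at the end lie in row r exactly for n -
b = r + k, which is the flagged filling.
*)

Require Import Defs.
From mathcomp Require Import all_boot zify.

Set Implicit Arguments.
Unset Strict Implicit.
Unset Printing Implicit Defensive.

(** Only the columns of the new boxes are kept of the recording tableau: a standard tableau becomes
    a word of numbers, on which dual equivalences and slides act directly, and the repeated labels
    come back at the end. Two mismatches with flagged promotion have to be bridged. Deleting the
    first letter empties the corner box, whereas promotion starts from the rightmost 1; they agree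
    because the hole of the corner first runs along the row of the other 1s. Labels repeat, whereas
    slides of column words treat all boxes as distinct; equal labels appear in strictly increasing
    columns, which is the order that the tie rule of the slide respects. Every insertion lemma is
    about reduced words, since Edelman-Greene insertion of other words can spoil the columns. Ranks
    are considered only at (R, C) with R + C <= n: this says that the R by C rectangle lies in the
    staircase, and there a chain of boxes is a set of mutually crossing pairs. The reversed interval
    k+1, ..., n-k gives the least letter a = k + 1 and the size N = n - 2k used for staircase
    words. *)

Ltac slia :=
  repeat match goal with
  | H : is_true (all _ _) |- _ => clear H
  | H : is_true (sorted _ _) |- _ => clear H
  | H : is_true (in_mem _ _) |- _ => clear H
  | H : is_true (~~ in_mem _ _) |- _ => clear H
  | H : is_true (has _ _) |- _ => clear H
  | H : is_true (~~ has _ _) |- _ => clear H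
  end; lia.

(** * Words in the simple transpositions *)

Definition sw (b i : nat) : nat :=
  if i == b then b.+1 else if i == b.+1 then b else i.

Definition wact (w : seq nat) (i : nat) : nat := foldr sw i w.

(** Minimality among all words makes closure under factors and under equal-length rewriting
    immediate. The link with inversions is only made in [ascending_reduced]. *)
Definition reduced (w : seq nat) : Prop :=
  forall u, wact u =1 wact w -> size w <= size u.

Lemma wact_cat u v i : wact (u ++ v) i = wact u (wact v i).
Proof. exact: foldr_cat. Qed.

Lemma swP b i : [\/ i = b /\ sw b i = b.+1, i = b.+1 /\ sw b i = b |
  [/\ i <> b, i <> b.+1 & sw b i = i]].
Proof.
rewrite /sw; case: eqP => [->|?]; first by constructor 1.
by case: eqP => [->|?]; [constructor 2 | constructor 3].
Qed.

Lemma swl b : sw b b = b.+1.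
Proof. by rewrite /sw eqxx. Qed.

Lemma swr b : sw b b.+1 = b.
Proof. by rewrite /sw eqxx gtn_eqF. Qed.

Ltac sw_elim :=
  match goal with
  | |- context [sw ?b ?i] =>
    lazymatch i with
    | context [sw _ _] => fail
    | _ => let H := fresh "H" in
      have H := swP b i; move: (sw b i) H => ? []; [case|case|case]
    end
  end.
Ltac sw_case := repeat (sw_elim; intros; subst); lia.

Lemma swK b : involutive (sw b).
Proof. by move=> i; sw_case. Qed.

Lemma reduced_eq w w' :
  reduced w -> wact w' =1 wact w -> size w' = size w -> reduced w'.
Proof.
by move=> rw e s u eu; rewrite s; apply: rw => i; rewrite eu e.
Qed.

Lemma reduced_factor p w q : reduced (p ++ w ++ q) -> reduced w.
Proof.
move=> r u e; have: size (p ++ w ++ q) <= size (p ++ u ++ q).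
  by apply: r => i; rewrite !wact_cat e.
by rewrite !size_cat; lia.
Qed.

Lemma reduced_catl p q : reduced (p ++ q) -> reduced p.
Proof. by move=> r; apply: (@reduced_factor [::] p q). Qed.

Lemma reduced_catr p q : reduced (p ++ q) -> reduced q.
Proof. by move=> r; apply: (@reduced_factor p q [::]); rewrite cats0. Qed.

Lemma reduced_repeat p a q : ~ reduced (p ++ [:: a, a & q]).
Proof.
move=> r; have: size (p ++ [:: a, a & q]) <= size (p ++ q).
  by apply: r => i; rewrite !wact_cat /= swK.
by rewrite !size_cat /=; lia.
Qed.

Lemma wact_comm a b i : a.+1 < b -> wact [:: a; b] i = wact [:: b; a] i.
Proof. by move=> *; rewrite /=; sw_case. Qed.

Lemma wact_braid a i : wact [:: a; a.+1; a] i = wact [:: a.+1; a; a.+1] i.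
Proof. by move=> *; rewrite /=; sw_case. Qed.

Lemma wact_comm_past x C i : all (fun d => x.+1 < d) C ->
  wact (C ++ [:: x]) i = wact (x :: C) i.
Proof.
elim: C i => //= d C IH i /andP[xd xC].
by rewrite (IH i xC) /=; move: (wact_comm (wact C i) xd) => /= <-.
Qed.

Lemma wact_comm_before x C i : all (fun d => d.+1 < x) C ->
  wact (C ++ [:: x]) i = wact (x :: C) i.
Proof.
elim: C i => //= d C IH i /andP[xd xC].
by rewrite (IH i xC) /=; move: (wact_comm (wact C i) xd) => /= <-.
Qed.

(** * Column insertion *)

Definition cstep (x : nat) (C : seq nat) : seq nat * option nat :=
  if has (ltn x) C then
    let p := find (ltn x) C in
    let y := nth 0 C p in
    (if (y == x.+1) && (x \in C) then C else set_nth 0 C p x, Some y)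
  else (rcons C x, None).

Definition eg_tab x P : seq (seq nat) := (eg_insert x P).1.
Definition eg_col x P : nat := (eg_insert x P).2.2.

Lemma eg_insert_cons x C P :
  eg_insert x (C :: P) =
  if (cstep x C).2 is Some y then
    ((cstep x C).1 :: eg_tab y P, ((eg_insert y P).2.1, (eg_col y P).+1))
  else ((cstep x C).1 :: P, (size C, 0)).
Proof.
rewrite /cstep /eg_tab /eg_col /=; case: ifP => //= _.
by case: (eg_insert _ P) => [P' [r c]].
Qed.

Lemma cstep_catl x L B : has (ltn x) L -> all (ltn x) B ->
  cstep x (L ++ B) = ((cstep x L).1 ++ B, (cstep x L).2).
Proof.
move=> hL aB; rewrite /cstep has_cat hL /= find_cat hL nth_cat -has_find hL /=.
have -> : (x \in L ++ B) = (x \in L).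
  rewrite mem_cat orbC; case: (boolP (x \in B)) => // xB.
  by move/allP: aB => /(_ _ xB) /=; rewrite ltnn.
congr (_, _); case: ifP => // _.
rewrite !set_nthE !size_cat -has_find hL.
have lt1 : find (ltn x) L < size L by rewrite -has_find.
rewrite (leq_trans lt1 (leq_addr _ _)) takel_cat; last exact: ltnW.
rewrite drop_cat; case: ltnP => [_|le]; first by rewrite -catA.
have -> : (find (ltn x) L).+1 = size L by lia.
by rewrite subnn drop0 drop_size -catA.
Qed.

Lemma cstep_catr z L B : all (ltn^~ z) L ->
  cstep z (L ++ B) = (L ++ (cstep z B).1, (cstep z B).2).
Proof.
move=> aL; have nh : has (ltn z) L = false.
  by apply/hasPn => d /(allP aL) /=; lia.
have nL : (z \in L) = false.
  by apply/negP => /(allP aL) /=; rewrite ltnn.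
rewrite /cstep has_cat nh /= find_cat nh mem_cat nL /=.
case: ifP => // hB; last by rewrite rcons_cat.
rewrite nth_cat ltnNge leq_addr /= addKn; congr (_, _); case: ifP => // _.
rewrite !set_nthE size_cat ltn_add2l -has_find hB take_cat ltnNge leq_addr /=.
rewrite addKn -catA drop_cat -addnS.
by case: ltnP => [|_]; [lia | rewrite addKn].
Qed.

Lemma cstep_head x y B : x < y -> all (ltn y) B ->
  cstep x (y :: B) = (x :: B, Some y).
Proof.
move=> xy aB; rewrite /cstep /= xy /= inE.
have -> : (x == y) = false by lia.
have -> /= : (x \in B) = false.
  by apply/negP => /(allP aB) /=; lia.
by rewrite andbF.
Qed.

Lemma cstep_stay x B : cstep x [:: x, x.+1 & B] = ([:: x, x.+1 & B], Some x.+1).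
Proof. by rewrite /cstep /= ltnn ltnSn /= eqxx !inE eqxx. Qed.

Lemma sorted_split A y B : sorted ltn (A ++ y :: B) ->
  [/\ sorted ltn A, sorted ltn B, all (ltn^~ y) A & all (ltn y) B].
Proof.
rewrite (sorted_pairwise ltn_trans) pairwise_cat /=.
case/and3P => /allrelP r pA /andP[aB pB].
rewrite !(sorted_pairwise ltn_trans); split=> //.
by apply/allP => d dA; apply: r => //; rewrite mem_head.
Qed.

Lemma sorted_join A y B : sorted ltn A -> sorted ltn B ->
  all (ltn^~ y) A -> all (ltn y) B -> sorted ltn (A ++ y :: B).
Proof.
rewrite !(sorted_pairwise ltn_trans) => pA pB aA aB.
rewrite pairwise_cat /= pA aB pB !andbT.
apply/allrelP => a b aA' ; rewrite inE => /orP[/eqP->|bB].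
  exact: (allP aA).
by have := allP aA _ aA'; have := allP aB _ bB => /=; lia.
Qed.

Lemma sorted_rcons A x : sorted ltn A -> all (ltn^~ x) A -> sorted ltn (rcons A x).
Proof. by move=> sA aA; rewrite -cats1; apply: sorted_join. Qed.

(** This excludes the one situation in which insertion would put a second x into a strictly
    increasing column. *)
Definition stay_ok x (C : seq nat) := x \in C -> x.+1 \in C.

Variant col_view (x : nat) : seq nat -> Prop :=
| ColLast A : all (ltn^~ x) A -> col_view x A
| ColBump A y B : all (ltn^~ x) A -> x < y -> all (ltn y) B ->
    col_view x (A ++ y :: B)
| ColStay A B : all (ltn^~ x) A -> all (ltn x.+1) B ->
    col_view x (A ++ [:: x, x.+1 & B]).

Lemma col_viewP x C : sorted ltn C -> stay_ok x C -> col_view x C.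
Proof.
move=> sC; case: (boolP (x \in C)) => [xC /(_ xC)|xC _].
  case/splitPr: xC sC => A B /sorted_split[_ sB aA aB].
  rewrite mem_cat !inE => /or3P[/(allP aA)||xB] /=; [lia|lia|].
  case/splitPr: xB sB aB => A' B' /sorted_split[_ _ aA' aB'].
  rewrite all_cat => /andP[aA'' _].
  case: A' aA' aA'' => [|d A'] /=; last by case/andP=> *; exfalso; lia.
  by move=> _ _; apply: ColStay.
have [hC|] := boolP (has (ltn x) C); last first.
  move/hasPn => aC; apply: ColLast; apply/allP => d dC /=.
  have := aC _ dC; have : d != x by apply: contraNneq xC => <-.
  by rewrite -leqNgt /=; lia.
case/split_find: {-}_ / hC (sC) (xC) (erefl C) => y A B xy nA.
rewrite cat_rcons => /sorted_split[_ _ _ aB]; rewrite mem_cat => xA _.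
apply: ColBump => //; apply/allP => d dA /=.
move/hasPn: nA => /(_ _ dA) /=; have : d != x; last by lia.
by apply: contraNneq xA => <-; rewrite dA.
Qed.

Lemma cstep_ColLast x A : all (ltn^~ x) A -> cstep x A = (rcons A x, None).
Proof. by move=> aA; rewrite -[in LHS](cats0 A) cstep_catr //= cats1. Qed.

Lemma cstep_ColBump x A y B : all (ltn^~ x) A -> x < y -> all (ltn y) B ->
  cstep x (A ++ y :: B) = (A ++ x :: B, Some y).
Proof. by move=> aA xy aB; rewrite cstep_catr // cstep_head. Qed.

Lemma cstep_ColStay x A B : all (ltn^~ x) A ->
  cstep x (A ++ [:: x, x.+1 & B]) = (A ++ [:: x, x.+1 & B], Some x.+1).
Proof. by move=> aA; rewrite cstep_catr // cstep_stay. Qed.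

(** If x is in C and x+1 is not, the new x commutes past all larger entries and meets its copy, and
    the pair cancels. *)
Lemma reduced_stay_ok C x : sorted ltn C -> reduced (C ++ [:: x]) -> stay_ok x C.
Proof.
move=> sC r xC; apply: contraT => xC'.
case/splitPr: xC sC r xC' => A B /sorted_split[_ _ _ aB] r xB; exfalso.
have aB' : all (fun d => x.+1 < d) B.
  apply/allP => d dB; move/allP: aB => /(_ _ dB) /=.
  have : d != x.+1; last by lia.
  by apply: contraNneq xB => <-; rewrite mem_cat inE dB !orbT.
apply: (@reduced_repeat A x B); apply: (reduced_eq r) => [i|]; last first.
  by rewrite !size_cat /=; lia.
rewrite -catA !wact_cat /=; congr (wact A (sw x _)).
by have := wact_comm_past i aB'; rewrite wact_cat.
Qed.

Definition oseq (o : option nat) : seq nat := if o is Some y then [:: y] else [::].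

(** Commutations suffice, except when the column stays unchanged: there x, x+1, x turns into x+1, x,
    x+1 by the braid relation. The bumped letter comes out on the left of the column. *)
Lemma cstep_wact x C i : sorted ltn C -> stay_ok x C ->
  wact (C ++ [:: x]) i = wact (oseq (cstep x C).2 ++ (cstep x C).1) i.
Proof.
move=> sC ok; move: (col_viewP sC ok) => {sC ok} v; case: C / v => [A aA|A y B aA xy aB|A B aA aB].
- by rewrite cstep_ColLast //= cats1.
- have aA' : all (fun d => d.+1 < y) A by apply/allP => d /(allP aA) /=; lia.
  have aB' : all (fun d => x.+1 < d) B by apply/allP => d /(allP aB) /=; lia.
  rewrite cstep_ColBump //= -catA wact_cat /= wact_comm_past //.
  by rewrite -[sw y _]/(wact [:: y] _) -wact_cat wact_comm_before //= wact_cat.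
- have aA' : all (fun d => d.+1 < x.+1) A by apply/allP => d /(allP aA) /=; lia.
  rewrite cstep_ColStay //= -catA wact_cat /= wact_comm_past //.
  have := wact_braid x (wact B i); rewrite /= => ->.
  rewrite -[sw x.+1 (sw x _)]/(wact [:: x.+1] _) -wact_cat.
  by rewrite wact_comm_before //= wact_cat.
Qed.

Lemma cstep_size x C :
  size (cstep x C).1 + size (oseq (cstep x C).2) = (size C).+1.
Proof.
rewrite /cstep; case: ifP => /= hC; last by rewrite size_rcons addn0.
rewrite addn1; case: ifP => _ //; rewrite size_set_nth.
by move: hC; rewrite has_find; lia.
Qed.

Lemma cstep_sorted x C : sorted ltn C -> stay_ok x C -> sorted ltn (cstep x C).1.
Proof.
move=> sC ok; move: (col_viewP sC ok) => {ok} v; case: C / v sC => [A aA|A y B aA xy aB|A B aA aB].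
- by rewrite cstep_ColLast //= => sA; apply: sorted_rcons.
- rewrite cstep_ColBump //= => /sorted_split[sA sB _ _]; apply: sorted_join => //.
  by apply/allP => d /(allP aB) /=; lia.
- by rewrite cstep_ColStay.
Qed.

Fixpoint crun (C : seq nat) (w : seq nat) : seq nat * seq (option nat) :=
  if w is x :: w' then
    let s := crun (cstep x C).1 w' in (s.1, (cstep x C).2 :: s.2)
  else (C, [::]).

Notation outs C w := (pmap id (crun C w).2).

Lemma outs_cons C x w :
  outs C (x :: w) = oseq (cstep x C).2 ++ outs (cstep x C).1 w.
Proof. by rewrite /=; case: (cstep x C).2. Qed.

Lemma crun_spec C w : sorted ltn C -> reduced (C ++ w) ->
  [/\ sorted ltn (crun C w).1,
      wact (C ++ w) =1 wact (outs C w ++ (crun C w).1) &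
      size (C ++ w) = size (outs C w ++ (crun C w).1)].
Proof.
elim: w C => [|x w IH] C sC r; first by rewrite /= cats0.
have ok : stay_ok x C.
  by apply: reduced_stay_ok sC _; move: r; rewrite -cat_rcons -cats1 => /reduced_catl.
have r' : reduced ((cstep x C).1 ++ w).
  apply: (@reduced_catr (oseq (cstep x C).2)); apply: (reduced_eq r) => [i|].
    by rewrite catA wact_cat -cstep_wact // -wact_cat -catA.
  by rewrite !size_cat /=; have := cstep_size x C; lia.
have [s' e' z'] := IH _ (cstep_sorted sC ok) r'.
rewrite outs_cons -catA -[(crun C _).1]/((crun (cstep x C).1 w).1); split=> // [i|].
  by rewrite [RHS]wact_cat -e' -wact_cat catA [RHS]wact_cat -cstep_wact // -wact_cat -catA.
by move: z'; rewrite !size_cat /=; have := cstep_size x C; lia.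
Qed.

(* [pword P w] is the insertion tableau and [cword P w] lists the columns of   *)
(* the new boxes, which determine the recording tableau.                       *)
Fixpoint pword P w := if w is x :: w' then pword (eg_tab x P) w' else P.
Fixpoint cword P w := if w is x :: w' then eg_col x P :: cword (eg_tab x P) w' else [::].

Fixpoint weave (os : seq (option nat)) (cs : seq nat) : seq nat :=
  if os is o :: os' then
    if o is Some _ then (head 0 cs).+1 :: weave os' (behead cs)
    else 0 :: weave os' cs
  else [::].

Lemma pword_cons C P w : pword (C :: P) w = (crun C w).1 :: pword P (outs C w).
Proof.
elim: w C P => //= x w IH C P; rewrite /eg_tab eg_insert_cons.
by case: (cstep x C) => C' [y|] /=; rewrite IH.
Qed.

Lemma cword_cons C P w : cword (C :: P) w = weave (crun C w).2 (cword P (outs C w)).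
Proof.
elim: w C P => //= x w IH C P; rewrite /eg_col /eg_tab eg_insert_cons.
by case: (cstep x C) => C' [y|] /=; rewrite IH.
Qed.

Lemma pword_cat P u v : pword P (u ++ v) = pword (pword P u) v.
Proof. by elim: u P => //= x u IH P; rewrite IH. Qed.

Lemma cword_cat P u v : cword P (u ++ v) = cword P u ++ cword (pword P u) v.
Proof. by elim: u P => //= x u IH P; rewrite IH. Qed.

Lemma size_cword P w : size (cword P w) = size w.
Proof. by elim: w P => //= x w IH P; rewrite IH. Qed.

(* Beyond the last column, insertion behaves as in an empty column, which      *)
(* absorbs the first letter.                                                   *)
Lemma eg_ind (Q : seq (seq nat) -> seq nat -> Prop) :
  (forall P, Q P [::]) ->
  (forall x w, Q [:: [::]] (x :: w) -> Q [::] (x :: w)) ->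
  (forall C P w, Q P (outs C w) -> Q (C :: P) w) ->
  forall P w, Q P w.
Proof.
move=> Q0 Qnil Qcons; elim=> [|C P IH] w; last exact: Qcons.
have [m] := ubnP (size w); elim: m w => // m IHm [|x w] //= le.
apply/Qnil/Qcons/IHm; rewrite outs_cons /= size_pmap.
have : size (crun [:: x] w).2 = size w; last first.
  by have := count_size (fun o => isSome o) (crun [:: x] w).2; lia.
by elim: w {le} [:: x] => //= y w IHw C; rewrite IHw.
Qed.

(** Later columns come first because a bumped letter leaves its column on the left; so inserting the
    letters of w preserves the permutation of [reading P ++ w]. *)
Definition reading (P : seq (seq nat)) : seq nat := flatten (rev P).

Lemma reading_cons C P : reading (C :: P) = reading P ++ C.
Proof. by rewrite /reading rev_cons flatten_rcons. Qed.

Definition valid P w := all (sorted ltn) P /\ reduced (reading P ++ w).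

Lemma valid_cons C P w : valid (C :: P) w ->
  [/\ sorted ltn C, reduced (C ++ w) & valid P (outs C w)].
Proof.
case=> /andP[sC aP]; rewrite reading_cons -catA => r.
have rC := reduced_catr r; split=> //; split=> //.
have [_ e z] := crun_spec sC rC.
apply: (@reduced_catl _ (crun C w).1); apply: (reduced_eq r) => [i|].
  by rewrite -catA wact_cat -e -wact_cat.
by rewrite -catA !(size_cat (reading P)) z.
Qed.

Lemma valid_catl P u v : valid P (u ++ v) -> valid P u.
Proof. by case=> aP r; split=> //; move: r; rewrite catA => /reduced_catl. Qed.

Lemma cstep_some x C y : sorted ltn C -> stay_ok x C -> (cstep x C).2 = Some y ->
  [/\ x < y, y \in C, x \in (cstep x C).1,
    (forall d, d \in C -> (d <= x) || (y <= d)) &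
    (forall d, d \in (cstep x C).1 ->
       (d == x) || (d \in C) && ((d != y) || (y == x.+1) && (x \in C)))].
Proof.
move=> sC ok; move: (col_viewP sC ok) => {sC ok} v; case: C / v => [A aA|A z B aA xy aB|A B aA aB].
- by rewrite cstep_ColLast.
- rewrite cstep_ColBump //= => -[<-]; split=> [//|||d|d].
  + by rewrite mem_cat mem_head orbT.
  + by rewrite mem_cat mem_head orbT.
  + rewrite mem_cat inE => /or3P[/(allP aA)|/eqP|/(allP aB)] /=; lia.
  + rewrite !mem_cat !inE => /or3P[dA|->//|dB]; rewrite ?dA ?dB ?orbT /=.
      by have := allP aA _ dA => /=; case: eqP => //=; case: eqP => //=; lia.
    by have := allP aB _ dB => /=; case: (d =P x) => //=; case: (d =P z) => //=; lia.
- rewrite cstep_ColStay //= => -[<-]; split=> [//|||d|d].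
  + by rewrite mem_cat !inE eqxx !orbT.
  + by rewrite mem_cat mem_head orbT.
  + rewrite mem_cat !inE => /or4P[/(allP aA)|/eqP|/eqP|/(allP aB)] /=; lia.
  + by move=> ->; rewrite eqxx mem_cat mem_head !orbT.
Qed.

Lemma cstep_none x C : (cstep x C).2 = None ->
  all (leq^~ x) C /\ (cstep x C).1 = rcons C x.
Proof.
rewrite /cstep; case: ifP => // /negbT/hasPn h _; split=> //.
by apply/allP => d /h /=; lia.
Qed.

Lemma cstep_ex x C m : m \in C -> x < m -> exists y, (cstep x C).2 = Some y.
Proof.
move=> mC xm; rewrite /cstep; have -> : has (ltn x) C by apply/hasP; exists m.
by eexists.
Qed.

Lemma reduced_pair C a b : sorted ltn C -> reduced (C ++ [:: a; b]) ->
  [/\ stay_ok a C, stay_ok b (cstep a C).1 & sorted ltn (cstep a C).1].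
Proof.
move=> sC r; have ok : stay_ok a C.
  apply: reduced_stay_ok sC _; apply: (@reduced_catl _ [:: b]).
  by rewrite -catA.
have s1 := cstep_sorted sC ok; split=> //; apply: reduced_stay_ok (s1) _.
apply: (@reduced_catr (oseq (cstep a C).2)); apply: (reduced_eq r) => [i|].
  by rewrite catA [LHS]wact_cat -cstep_wact // -wact_cat -catA.
by rewrite !size_cat /=; have := cstep_size a C; lia.
Qed.

(** Together with [cstep_pair_desc] this is the bumping lemma for one column: two successive letters
    that both leave it keep their relative order, and a smaller second letter always leaves. *)
Lemma cstep_pair_asc C a b : sorted ltn C -> reduced (C ++ [:: a; b]) -> a < b ->
  (cstep b (cstep a C).1).2 = None \/
  exists a' b', [/\ a' < b', (cstep a C).2 = Some a' &
    (cstep b (cstep a C).1).2 = Some b'].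
Proof.
move=> sC r ab; have [oka okb s1] := reduced_pair sC r.
case E2: (cstep b _).2 => [b'|]; [right|by left].
have [bb' b'in _ _ _] := cstep_some s1 okb E2.
case E1: (cstep a C).2 => [a'|].
  have [aa' a'in _ h1 h2] := cstep_some sC oka E1.
  exists a', b'; split=> //; have /orP[/eqP|/andP[/h1]] := h2 _ b'in; first lia.
  by case: eqP; lia.
have [al Ec] := cstep_none E1; move: b'in; rewrite Ec mem_rcons inE.
by case/orP => [/eqP|/(allP al) /=]; lia.
Qed.

Lemma cstep_pair_desc C a b : sorted ltn C -> reduced (C ++ [:: a; b]) -> b < a ->
  exists2 b', (cstep b (cstep a C).1).2 = Some b' &
    b < b' <= a /\ (forall a', (cstep a C).2 = Some a' -> b' < a').
Proof.
move=> sC r ab; have [oka okb s1] := reduced_pair sC r.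
have ain : a \in (cstep a C).1.
  case E1: (cstep a C).2 => [a'|]; first by have [] := cstep_some sC oka E1.
  by have [_ ->] := cstep_none E1; rewrite mem_rcons mem_head.
have [b' E2] := cstep_ex ain ab; exists b' => //.
have [bb' _ _ /(_ _ ain) h _] := cstep_some s1 okb E2.
split=> [|a' E1]; first lia.
by have [] := cstep_some sC oka E1; lia.
Qed.

Lemma cword_ascent P a b : valid P [:: a; b] ->
  (eg_col a P < eg_col b (eg_tab a P)) = (b < a).
Proof.
pose Q P w := forall a b, w = [:: a; b] -> valid P w ->
  (nth 0 (cword P w) 0 < nth 0 (cword P w) 1) = (b < a).
suff H : forall P w, Q P w by exact: (H P _ a b erefl).
apply: eg_ind => [//|x w H c d e v|{a b}C {}P w IH a b]; first exact: H e v.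
move=> ew v; rewrite {w}ew in IH v *; have [sC r v'] := valid_cons v; rewrite cword_cons.
have [ab|ba|eab] := ltngtP a b; last 1 first.
- by move: r; rewrite eab => r; have := @reduced_repeat C b [::]; case.
- have [E|[a' [b' [ab' E1 E2]]]] := cstep_pair_asc sC r ab.
    by rewrite /= E; case: (cstep a C).2.
  move: IH v'; rewrite /= E1 E2 /= => /(_ a' b' erefl) IH v'.
  by rewrite ltnS [LHS](IH v'); lia.
- have [b' E2 [_ h]] := cstep_pair_desc sC r ba; move: IH v' h; rewrite /= E2 /=.
  case: (cstep a C).2 => [a'|] //= /(_ a' b' erefl) IH v' /(_ _ erefl) h.
  by rewrite ltnS [LHS](IH v').
Qed.

(** * Coxeter-Knuth moves *)

Variant ck : seq nat -> seq nat -> Prop :=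
| CkXZY x y z : x < y -> y < z -> ck [:: x; z; y] [:: z; x; y]
| CkYXZ x y z : x < y -> y < z -> ck [:: y; x; z] [:: y; z; x]
| CkBraid a : ck [:: a; a.+1; a] [:: a.+1; a; a.+1].

Lemma ck_wact t t' : ck t t' -> wact t =1 wact t'.
Proof.
case=> [x y z xy yz|x y z xy yz|a] i; last exact: wact_braid.
  by rewrite -[LHS]/(wact [:: x; z] _) wact_comm //; lia.
by congr (sw y _); rewrite -[LHS]/(wact [:: x; z] _) wact_comm //; lia.
Qed.

Lemma ck_size t t' : ck t t' -> size t = size t'.
Proof. by case. Qed.

(* What a Coxeter-Knuth move does to the letters that leave a column; None     *)
(* stands for a letter absorbed by the column.                                 *)
Variant ckout : seq (option nat) -> seq (option nat) -> Prop :=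
| CkoutAll t t' : ck t t' -> ckout (map Some t) (map Some t')
| CkoutZ x y : x < y -> ckout [:: Some x; None; Some y] [:: None; Some x; Some y]
| CkoutX y z : z < y -> ckout [:: Some y; None; Some z] [:: Some y; Some z; None]
| CkoutXY z : ckout [:: None; None; Some z] [:: None; Some z; None].

Lemma cstep_mem x C d : d \in (cstep x C).1 -> (d == x) || (d \in C).
Proof.
rewrite /cstep; case: ifP => /= [hC|_]; last by rewrite mem_rcons inE.
case: ifP => _; first by move->; rewrite orbT.
move: hC; rewrite has_find => lt.
rewrite set_nthE lt mem_cat inE => /or3P[/mem_take->|->|/mem_drop->] //.
  by rewrite orbT.
by rewrite orbT.
Qed.

Lemma sorted_cut z C : sorted ltn C ->
  exists L B, [/\ C = L ++ B, all (ltn^~ z) L & all (leq z) B].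
Proof.
elim: C => [|d C IH] sC; first by exists [::], [::].
have [L [B [eC aL aB]]] := IH (path_sorted sC).
have [dz|zd] := ltnP d z; first by exists (d :: L), B; rewrite eC /= dz.
exists [::], (d :: C); split=> //; apply/allP => e; rewrite inE => /orP[/eqP->//|eC'].
move: sC; rewrite /= path_sortedE; last exact: ltn_trans.
by case/andP=> /allP/(_ _ eC') /=; lia.
Qed.

(** Cut the column at z. Because of m, the letter x acts on the entries below z only, and z acts on
    the others only. *)
Lemma cstep_comm x z C m : sorted ltn C -> x < m -> m < z -> m \in C ->
  [/\ (cstep z (cstep x C).1).1 = (cstep x (cstep z C).1).1,
      (cstep z (cstep x C).1).2 = (cstep z C).2 &
      (cstep x (cstep z C).1).2 = (cstep x C).2].
Proof.
move=> sC xm mz mC; have [L [B [eC aL aB]]] := sorted_cut z sC.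
have mL : m \in L.
  by move: mC; rewrite eC mem_cat => /orP[//|/(allP aB)]; lia.
have hL : has (ltn x) L by apply/hasP; exists m.
have aB' : all (ltn x) B by apply/allP => d /(allP aB) /=; lia.
rewrite eC cstep_catl // cstep_catr //= cstep_catr ?cstep_catl //=.
  by apply/allP => d /cstep_mem/orP[/eqP->|/(allP aB')] /=; lia.
by apply/allP => d /cstep_mem/orP[/eqP->|/(allP aL)] /=; lia.
Qed.

Lemma reduced_triple C a b c : sorted ltn C -> reduced (C ++ [:: a; b; c]) ->
  reduced ((cstep a C).1 ++ [:: b; c]).
Proof.
move=> sC r; have ok : stay_ok a C.
  apply: reduced_stay_ok sC _; apply: (@reduced_catl _ [:: b; c]).
  by rewrite -catA.
apply: (@reduced_catr (oseq (cstep a C).2)); apply: (reduced_eq r) => [i|].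
  by rewrite catA [LHS]wact_cat -cstep_wact // -wact_cat -catA.
by rewrite !size_cat /=; have := cstep_size a C; lia.
Qed.

Lemma reduced_prefix2 C a b c : reduced (C ++ [:: a; b; c]) -> reduced (C ++ [:: a; b]).
Proof. by move=> r; apply: (@reduced_catl _ [:: c]); rewrite -catA. Qed.

Lemma sorted_succ_head x B : sorted ltn B -> all (ltn x) B -> x.+1 \in B ->
  exists B', B = x.+1 :: B'.
Proof.
case: B => //= b B sB /andP[xb aB]; rewrite inE => /orP[/eqP<-|xB]; first by exists B.
move: sB; rewrite path_sortedE; last exact: ltn_trans.
by case/andP=> /allP/(_ _ xB) /=; lia.
Qed.

(** An entry strictly between x and z makes their insertions commute. Otherwise, if z is in C, the
    outputs form a braid move. Otherwise it depends on whether none, one or at least two entries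
    exceed z; in the last case the outputs form a move of the other kind, in the reverse
    direction. *)
Lemma ck_column_xzy C x y z : x < y -> y < z -> sorted ltn C ->
  reduced (C ++ [:: x; z; y]) -> reduced (C ++ [:: z; x; y]) ->
  (crun C [:: x; z; y]).1 = (crun C [:: z; x; y]).1 /\
  (ckout (crun C [:: x; z; y]).2 (crun C [:: z; x; y]).2 \/
   ckout (crun C [:: z; x; y]).2 (crun C [:: x; z; y]).2).
Proof.
move=> xy yz sC r r'.
have [okx _ sx] := reduced_pair sC (reduced_prefix2 r).
have [okz _ sz] := reduced_pair sC (reduced_prefix2 r').
have [/hasP[m mC /andP[xm mz]]|nm] := boolP (has (fun m => x < m < z) C).
  have [e1 e2 e3] := cstep_comm sC xm mz mC.
  have [y' Ey [/andP[yy' y'z] hy']] := cstep_pair_desc sx (reduced_triple sC r) yz.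
  have [x' Ex] := cstep_ex mC xm.
  have := cstep_pair_asc sz (reduced_triple sC r') xy.
  rewrite e3 Ex -e1 Ey => -[//|[a' [b' [ab [ea] [eb]]]]].
  move: ab; rewrite -{}ea -{a' b'}eb => ab.
  rewrite /= -e1 e2 e3 Ex Ey; split=> //; left.
  case Ez: (cstep z C).2 => [z'|]; last exact: CkoutZ.
  by apply: (CkoutAll (CkXZY ab _)); apply: hy'; rewrite e2.
have xC : x \notin C.
  by apply/negP => /okx xC; case/hasP: nm; exists x.+1 => //=; slia.
have hA A B : C = A ++ B -> all (ltn^~ z) A -> all (ltn^~ x) A.
  move=> eC aA; apply/allP => d dA; have := allP aA _ dA.
  move/hasPn: nm => /(_ d); rewrite eC mem_cat dA => /(_ erefl) /=.
  by have : d != x; [apply: contraNneq xC => <-; rewrite eC mem_cat dA | slia].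
case: (boolP (z \in C)) => zC.
  have zC' := okz zC; case/splitPr: zC sC zC' hA => A B sC zC' hA.
  have [_ sB aA aB] := sorted_split sC.
  have [B' eB] : exists B', B = z.+1 :: B'.
    apply: sorted_succ_head => //; move: zC'; rewrite mem_cat inE.
    by case/or3P => [/(allP aA)||//] /=; slia.
  have aA' := hA A _ erefl aA.
  have aAz : all (ltn^~ z) (A ++ [:: x]) by rewrite all_cat aA /=; slia.
  have aAy : all (ltn^~ y) (A ++ [:: x]).
    by rewrite all_cat /= xy !andbT; apply/allP => d /(allP aA') /=; slia.
  move: aB sB; rewrite {}eB => /= /andP[_ aB']; rewrite path_sortedE; last exact: ltn_trans.
  case/andP => aB sB.
  have xz : x < z by slia.
  have aBz : all (ltn z) B' by apply/allP => d /(allP aB) /=; slia.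
  have aBzz : all (ltn z) (z.+1 :: B') by rewrite /= ltnSn.
  rewrite cstep_ColStay //= cstep_ColBump //=.
  rewrite (_ : A ++ [:: x, z.+1 & B'] = (A ++ [:: x]) ++ z.+1 :: B'); last first.
    by rewrite -catA.
  rewrite !cstep_ColBump //=; last slia.
  by split=> //; left; apply: (CkoutAll (CkBraid z)).
have [A [B [eC aA aB]]] := sorted_cut z sC.
have aB' : all (ltn z) B.
  apply/allP => d dB; have := allP aB _ dB => /=.
  have : d != z; last slia.
  by apply: contraNneq zC => <-; rewrite eC mem_cat dB orbT.
have aAx := hA _ _ eC aA; have xz := ltn_trans xy yz.
have aAxy : all (ltn^~ y) (A ++ [:: x]).
  by rewrite all_cat /= xy !andbT; apply/allP => d /(allP aAx) /=; slia.
have aAxz : all (ltn^~ z) (A ++ [:: x]) by rewrite all_cat /= !andbT aA.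
move: sC; rewrite {}eC => sC {hA nm xC zC okx okz r r' sx sz aB}.
have catx e B' : A ++ [:: x, e & B'] = (A ++ [:: x]) ++ e :: B' by rewrite -catA.
case: B aB' sC => [|d B] /=.
  rewrite cats0 => _ _; rewrite (cstep_ColLast aAx) (cstep_ColLast aA) /= -!cats1.
  rewrite (cstep_ColLast aAxz) /= -cats1 (cstep_ColBump aAxy yz) //=.
  rewrite (cstep_ColBump aAx xz) //= (cstep_ColLast aAxy) /= -cats1.
  by split=> //; left; apply: CkoutXY.
case/andP => zd aB /sorted_split[_ sB _ aBd].
have xd := ltn_trans xz zd.
rewrite (cstep_ColBump aAx xd) // (cstep_ColBump aA zd) //=.
have aBz : all (ltn z) (d :: B) by rewrite /= zd.
rewrite (cstep_ColBump aAx xz) //=.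
case: B aB sB aBd {aBz} => [|e B] /=.
  move=> _ _ _; rewrite (cstep_ColLast aAxz) /= -cats1 (cstep_ColBump aAxy yz) //=.
  rewrite (cstep_ColLast aAxy) /= -cats1.
  by split=> //; left; apply: CkoutX.
case/andP => ze aB; rewrite path_sortedE; last exact: ltn_trans.
case/andP => aBe sB /andP[de aBd].
have ye := ltn_trans yz ze.
rewrite !catx.
rewrite (cstep_ColBump aAxz ze) //= (cstep_ColBump aAxy yz) //=.
rewrite (cstep_ColBump aAxy ye) //=.
by split=> //; right; apply: (CkoutAll (CkYXZ zd de)).
Qed.

(** Once y has been inserted, y itself is the entry between x and z that makes the two other
    insertions commute. *)
Lemma ck_column_yxz C x y z : x < y -> y < z -> sorted ltn C ->
  reduced (C ++ [:: y; x; z]) -> reduced (C ++ [:: y; z; x]) ->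
  (crun C [:: y; x; z]).1 = (crun C [:: y; z; x]).1 /\
  (ckout (crun C [:: y; x; z]).2 (crun C [:: y; z; x]).2 \/
   ckout (crun C [:: y; z; x]).2 (crun C [:: y; x; z]).2).
Proof.
move=> xy yz sC r r'.
have [oky _ sy] := reduced_pair sC (reduced_prefix2 r).
have yin : y \in (cstep y C).1.
  case E1: (cstep y C).2 => [y'|]; first by have [] := cstep_some sC oky E1.
  by have [_ ->] := cstep_none E1; rewrite mem_rcons mem_head.
have [e1 e2 e3] := cstep_comm sy xy yz yin.
have [x' Ex [_ hx']] := cstep_pair_desc sC (reduced_prefix2 r) xy.
have := cstep_pair_asc sC (reduced_prefix2 r') yz.
rewrite /= e1 e2 e3 Ex => h; split=> //.
case: h => [Ez|[y' [z' [yz' Ey Ez]]]].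
  rewrite Ez; case Ey: (cstep y C).2 => [y'|]; last by right; apply: CkoutXY.
  by right; apply: CkoutX; apply: hx'.
by rewrite Ey Ez; left; apply: (CkoutAll (CkYXZ (hx' _ Ey) yz')).
Qed.

(** If C contains a or a+1, reducedness forces all entries from there up to a+2, and the outputs are
    the braid move on a+1. Otherwise the number of larger entries (none, one, more) decides as in
    [ck_column_xzy]. *)
Lemma ck_column_braid C a : sorted ltn C ->
  reduced (C ++ [:: a; a.+1; a]) -> reduced (C ++ [:: a.+1; a; a.+1]) ->
  (crun C [:: a; a.+1; a]).1 = (crun C [:: a.+1; a; a.+1]).1 /\
  (ckout (crun C [:: a; a.+1; a]).2 (crun C [:: a.+1; a; a.+1]).2 \/
   ckout (crun C [:: a.+1; a; a.+1]).2 (crun C [:: a; a.+1; a]).2).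
Proof.
move=> sC r r'.
have [oka _ _] := reduced_pair sC (reduced_prefix2 r).
have [okb _ _] := reduced_pair sC (reduced_prefix2 r').
have [A [B [eC aA aB]]] := sorted_cut a sC.
have sAB : sorted ltn A /\ sorted ltn B.
  by move: sC; rewrite eC (sorted_pairwise ltn_trans) pairwise_cat !(sorted_pairwise ltn_trans) =>
    /and3P[].
case: sAB => sA sB.
have inB d : a <= d -> (d \in C) = (d \in B).
  move=> ad; rewrite eC mem_cat orbC; case: (boolP (d \in B)) => //= _.
  by apply/negP => /(allP aA) /=; slia.
have aAb : all (ltn^~ a.+1) A by apply/allP => d /(allP aA) /=; slia.
have aAab : all (ltn^~ a.+1) (A ++ [:: a]) by rewrite all_cat aAb /= ltnSn.
have catx x B' : A ++ x :: B' = (A ++ [:: x]) ++ B' by rewrite -catA.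
have next b B' : B = b :: B' -> all (ltn b) B' /\ sorted ltn B'.
  move=> eB; move: sB; rewrite eB /= path_sortedE; last exact: ltn_trans.
  by case/andP.
have below b B' : B = b :: B' -> a <= b.
  by move=> eB; move: aB; rewrite eB => /andP[].
have second b B' : B = b :: B' -> b \in [:: a; a.+1] ->
    a.+1 \in C -> exists B2, B' = [seq d <- [:: a.+1; a.+2] | b < d] ++ B2.
  move=> eB bb /[dup] /okb; rewrite !inB ?leqW // eB !inE => hb ha.
  have [aB' sB'] := next _ _ eB.
  move: bb; rewrite !inE => /orP[/eqP|/eqP] ebb; rewrite {}ebb in eB aB' hb ha *.
    have ha' : a.+1 \in B' by move: ha; rewrite (_ : a.+1 == a = false) //; apply/eqP; slia.
    have [B2 e2] := sorted_succ_head sB' aB' ha'.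
    have [aB2 sB2] : all (ltn a.+1) B2 /\ sorted ltn B2.
      by move: sB'; rewrite e2 /= path_sortedE; [case/andP | exact: ltn_trans].
    have ha2 : a.+2 \in B2.
      move: hb; rewrite e2 !inE.
      by have -> : a.+2 == a = false; [apply/eqP; slia | rewrite /= (_ : a.+2 == a.+1 = false) //;
        apply/eqP; slia].
    have [B3 e3] := sorted_succ_head sB2 aB2 ha2.
    by exists B3; rewrite e2 e3 /= !ltnS leqnn leqnSn.
  have hb' : a.+2 \in B' by move: hb; rewrite (_ : a.+2 == a.+1 = false) //; apply/eqP; slia.
  have [B2 e2] := sorted_succ_head sB' aB' hb'.
  by exists B2; rewrite e2 /= ltnn ltnS leqnn.
case: (boolP (a \in B)) => aB'.
  have [B1 e1] : exists B1, B = a :: B1.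
    case: B aB' aB next {eC inB below second sB} => // b B aB' /= /andP[ab aB] next; exists B.
    move: aB'; rewrite inE => /orP[/eqP->//|/= aB'].
    by have [/allP/(_ _ aB') /=] := next _ _ erefl; slia.
  have ab : a.+1 \in C by apply: oka; rewrite inB.
  have [B2] := second _ _ e1 (mem_head _ _) ab.
  rewrite /= !ltnS leqnn leqnSn => e2.
  rewrite eC e1 e2 /= !cstep_ColStay //=; rewrite catx !cstep_ColStay //=.
  rewrite -catx !cstep_ColStay //= catx !cstep_ColStay //=.
  by split=> //; left; apply: (CkoutAll (CkBraid a.+1)).
have aBa : all (ltn a) B.
  apply/allP => d dB; have := allP aB _ dB => /=.
  by have : d != a; [apply: contraNneq aB' => <- | slia].
have ab := ltnSn a.
case: (boolP (a.+1 \in B)) => bB.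
  have [B1 e1] := sorted_succ_head sB aBa bB.
  have bC : a.+1 \in C by rewrite inB.
  have [|B2] := second _ _ e1 _ bC; first by rewrite !inE eqxx orbT.
  have [aB1 sB1] := next _ _ e1.
  rewrite /= ltnn ltnS leqnn => e2; have := aB1; rewrite e2 /= => /andP[_ aB2].
  have aB3 : all (ltn a.+2) B2.
    by move: sB1; rewrite e2 /= path_sortedE; [case/andP | exact: ltn_trans].
  rewrite eC e1 e2 /= cstep_ColStay //= cstep_ColBump //=; last by rewrite ltnSn.
  rewrite catx (cstep_ColBump aAab (ltnSn _)) //= -catx cstep_ColStay //=.
  by split=> //; left; apply: (CkoutAll (CkBraid a.+1)).
have aBb : all (ltn a.+1) B.
  apply/allP => d dB; have := allP aBa _ dB => /=.
  by have : d != a.+1; [apply: contraNneq bB => <- | slia].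
rewrite {}eC {inB second below oka okb r r' sC aB' bB}.
case: B aB sB aBa next aBb => [|d B] aB sB aBa next aBb.
  rewrite cats0 /= (cstep_ColLast aA) (cstep_ColLast aAb) /= -!cats1.
  rewrite (cstep_ColLast aAab) (cstep_ColBump aA ab) //= -!cats1 -catA.
  rewrite (cstep_ColStay _ aA) (cstep_ColLast aAab) /= -cats1 -catA.
  by split=> //; left; apply: CkoutXY.
have [aBd sB'] := next _ _ erefl.
have /andP[/= ad aB'] := aBa; have /andP[/= bd aBb'] := aBb.
rewrite /= (cstep_ColBump aA ad) // (cstep_ColBump aAb bd) //=.
rewrite (cstep_ColBump aA ab) //= catx.
case: B aB sB aBa next aBb aBd sB' aB' aBb' => [|e B] aB sB aBa next aBb aBd sB' aB' aBb'.
  rewrite cats0 (cstep_ColLast aAab) /= -cats1 -catA (cstep_ColStay _ aA) /=.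
  by split=> //; left; apply: CkoutX.
have /andP[/= de aBd'] := aBd; have /andP[/= be aBe'] := aBb'.
have aBe : all (ltn e) B.
  by move: sB'; rewrite /= path_sortedE; [case/andP | exact: ltn_trans].
rewrite (cstep_ColBump aAab be) //= -catA (cstep_ColStay _ aA) /=.
by split=> //; right; apply: (CkoutAll (CkYXZ bd de)).
Qed.

Lemma ck_column C t t' : ck t t' -> sorted ltn C ->
  reduced (C ++ t) ->
  (crun C t).1 = (crun C t').1 /\
  (ckout (crun C t).2 (crun C t').2 \/ ckout (crun C t').2 (crun C t).2).
Proof.
move=> c sC r; have r' : reduced (C ++ t').
  apply: (reduced_eq r) => [i|]; first by rewrite !wact_cat (ck_wact c).
  by rewrite !size_cat (ck_size c).
case: c r r' => *; [exact: ck_column_xzy|exact: ck_column_yxz|exact: ck_column_braid].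
Qed.

(* Elementary dual equivalence on three consecutive entries. *)
Definition flip3 (a b c : nat) : seq nat :=
  if (a < c <= b) || (b < c <= a) then [:: b; a; c]
  else if (c <= a < b) || (b <= a < c) then [:: a; c; b]
  else [:: a; b; c].

Definition flip (t : seq nat) : seq nat :=
  if t is [:: a, b, c & q] then flip3 a b c ++ q else t.

Lemma flip3_succ a b c : flip3 a.+1 b.+1 c.+1 = map succn (flip3 a b c).
Proof. by rewrite /flip3 !ltnS; case: ifP => // _; case: ifP. Qed.

Lemma valid_ck P t t' : ck t t' -> valid P t -> valid P t'.
Proof.
move=> c [aP r]; split=> //; apply: (reduced_eq r) => [i|].
  by rewrite !wact_cat (ck_wact c).
by rewrite !size_cat (ck_size c).
Qed.

Lemma flipK t : flip (flip t) = t.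
Proof.
case: t => [|a [|b [|c q]]] //=; rewrite {1}/flip3.
case: ifP => h1 /=.
  by rewrite /flip3; case: ifP => //=; lia.
case: ifP => h2 /=; last by rewrite /flip3 h1 h2.
rewrite /flip3; case: ifP => h3 /=; first lia.
by case: ifP => //=; lia.
Qed.

Lemma pmap_some (t : seq nat) : pmap id (map Some t) = t.
Proof. by elim: t => //= x t ->. Qed.

Lemma weave_some t cs : size cs = size t -> weave (map Some t) cs = map succn cs.
Proof. by elim: t cs => [|x t IH] [|c cs] //= [/IH ->]. Qed.

(** When the column absorbs a letter, at most two letters reach the next columns. The relative
    position of their boxes is known from [cword_ascent], and it decides which two of the three
    boxes [flip] exchanges. *)
Lemma weave_ckout P os os' : ckout os os' -> valid P (pmap id os) ->
  (forall t t', ck t t' -> os = map Some t -> os' = map Some t' ->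
    cword P t' = flip (cword P t)) ->
  weave os' (cword P (pmap id os')) = flip (weave os (cword P (pmap id os))).
Proof.
case=> [t t' c|x y xy|x y yx|x] v IH; last by [].
- rewrite !pmap_some !weave_some ?size_cword // (IH _ _ c) //.
  by case: (cword P t) => [|n1 [|n2 [|n3 cs]]] //=; rewrite flip3_succ map_cat.
- by have /= := cword_ascent v; rewrite /flip3; case: ifP => //; lia.
- have /= := cword_ascent v; rewrite /flip3; case: ifP => //; first lia.
  by case: ifP => //; lia.
Qed.

Lemma cword_ck P t t' : ck t t' -> valid P t ->
  pword P t = pword P t' /\ cword P t' = flip (cword P t).
Proof.
(* Both directions are needed at once, since the direction of the move may change from one column to
   the next. *)
pose Q P t := forall t', ck t t' \/ ck t' t -> valid P t -> valid P t' ->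
  pword P t = pword P t' /\ cword P t' = flip (cword P t).
move=> c v; suff H : forall P t, Q P t.
  by apply: H => //; [left | exact: valid_ck v].
apply: eg_ind => {P t t' c v} [P t'|x w H t' c v v'|C P t IH t' c v v'].
- by case=> c; inversion c.
- have [x' [w' et]] : exists x' w', t' = x' :: w'.
    by case: c => c; inversion c; do 2!eexists.
  by rewrite et in c v' *; exact: (H _ c v v').
rewrite !pword_cons !cword_cons.
have [sC r vo] := valid_cons v; have [_ r' vo'] := valid_cons v'.
have [-> co] : (crun C t).1 = (crun C t').1 /\
    (ckout (crun C t).2 (crun C t').2 \/ ckout (crun C t').2 (crun C t).2).
  case: c => c; first exact: ck_column.
  by have [-> [h|h]] := ck_column c sC r'; split; auto.
move: vo vo' IH co; rewrite /Q.
move: (crun C t).2 (crun C t').2 => os os' vo vo' IH [] co; split.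
- case: co IH vo vo' => [u u' cu|||] //; rewrite !pmap_some => IH vo vo'.
  by case: (IH u') => //; [left | move=> ->].
- apply: (weave_ckout co vo) => u u' cu eu eu'; rewrite eu eu' !pmap_some in IH vo vo'.
  by case: (IH u') => //; left.
- case: co IH vo vo' => [u u' cu|||] //; rewrite !pmap_some => IH vo vo'.
  by case: (IH u) => //; [right | move=> ->].
- rewrite (weave_ckout co vo') ?flipK // => u u' cu eu eu'.
  rewrite eu eu' !pmap_some in IH vo vo' *.
  by case: (IH u) => //; [right | move=> _ ->; rewrite flipK].
Qed.

(** * Slides on column words *)

(* A standard tableau is encoded by the columns of its boxes, listed in the    *)
(* order of their entries; the words that arise are those with [yext [::] c].  *)
Definition dominant (p : seq nat) := forall j, count_mem j.+1 p <= count_mem j p.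

Fixpoint yext (p c : seq nat) : Prop :=
  dominant p /\ if c is x :: c' then yext (rcons p x) c' else True.

Lemma yext_dominant p c : yext p c -> dominant p.
Proof. by case: c => [|x c] []. Qed.

Lemma dominant_perm p p' : perm_eq p p' -> dominant p -> dominant p'.
Proof. by move=> /permP e h j; have := h j; rewrite !e. Qed.

Lemma yext_perm p p' c : perm_eq p p' -> yext p c -> yext p' c.
Proof.
elim: c p p' => [|x c IH] p p' e /= [d h]; split=> //; try exact: dominant_perm d.
by apply: IH h; rewrite -!cats1 perm_cat2r.
Qed.

Lemma yext_cat p u v : yext p (u ++ v) <-> yext p u /\ yext (p ++ u) v.
Proof.
elim: u p => [|x u IH] p /=.
  by rewrite cats0; split=> [h|[]//]; split=> //; split=> //; exact: yext_dominant h.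
rewrite -cat_rcons; split=> [[d /IH[h1 h2]]//|[[d h1] h2]].
by split=> //; apply/IH.
Qed.

Lemma perm_flip3 a b c : perm_eq (flip3 a b c) [:: a; b; c].
Proof.
rewrite /flip3; case: ifP => _; first exact: (permEl (perm_catCA [:: b] [:: a] [:: c])).
by case: ifP => _ //; rewrite perm_cons; apply: (permEl (perm_catC [:: c] [:: b])).
Qed.

Lemma count_rcons (p : seq nat) x j : count_mem j (rcons p x) = count_mem j p + (x == j).
Proof. by rewrite -cats1 count_cat /= addn0. Qed.

Lemma yext_flip p t : yext p t -> yext p (flip t).
Proof.
case: t => [|a [|b [|c q]]] // y; rewrite /flip.
have [/= [d [d1 [d2 [d3 _]]]] yq] := proj1 (yext_cat p [:: a; b; c] q) y.
apply/yext_cat; split; last first.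
  by apply: yext_perm yq; rewrite perm_cat2l perm_sym perm_flip3.
rewrite /flip3; case: ifP => h1 /=; last (case: ifP => h2 /=; last by []).
  by refine (conj d (conj _ (conj _ (conj _ I)))) => j;
    move: (d j) (d1 j) (d2 j) (d3 j); rewrite !count_rcons; lia.
by refine (conj d (conj _ (conj _ (conj _ I)))) => j;
  move: (d j) (d1 j) (d2 j) (d3 j); rewrite !count_rcons; lia.
Qed.

(* [c] lists the columns of the boxes of a standard tableau after its first    *)
(* one; [jdt [::] 0 c] lists them after a slide into the first box. [u] lists  *)
(* the columns of the boxes treated so far and [h] is the column of the hole.  *)
Definition jmove (u : seq nat) (h x : nat) : bool :=
  (x == h.+1) && (count_mem h u == count_mem h.+1 u).

Definition jout u h x := if jmove u h x then h else x.
Definition jnext u h x := if jmove u h x then h.+1 else h.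

Fixpoint jdt (u : seq nat) (h : nat) (c : seq nat) : seq nat :=
  if c is x :: c' then
    jout u h x :: jdt (rcons u (jout u h x)) (jnext u h x) c'
  else [::].

(** The hole is in row [count_mem h u]. A box x = h+1 moves left exactly when it lands in that row,
    next to the hole. A box below the hole moves up within its column, which changes neither x nor
    h. *)
Lemma jmoveP u h x :
  reflect (x = h.+1 /\ count_mem h u = count_mem h.+1 u) (jmove u h x).
Proof. by apply: (iffP andP) => [[/eqP-> /eqP->]|[-> ->]]. Qed.

Lemma jmove_perm u u' h x : perm_eq u u' -> jmove u h x = jmove u' h x.
Proof. by move=> e; rewrite /jmove !(permP e). Qed.

Lemma jdt_perm u u' h c : perm_eq u u' -> jdt u h c = jdt u' h c.
Proof.
elim: c u u' h => //= x c IH u u' h e; rewrite /jout /jnext (jmove_perm _ _ e).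
by congr cons; apply: IH; rewrite -!cats1 perm_cat2r.
Qed.

Lemma jstep u h x c : dominant u -> yext (rcons u h) (x :: c) ->
  dominant (rcons u (jout u h x)) /\
  yext (rcons (rcons u (jout u h x)) (jnext u h x)) c.
Proof.
move=> du [dh yx]; rewrite /jout /jnext.
case: (jmoveP u h x) => [[ex _]|hm]; first by rewrite -ex.
split; last first.
  apply: yext_perm yx; rewrite -!cats1 -!catA perm_cat2l.
  exact: (permEl (perm_catC [:: h] [:: x])).
move=> j; move: (du j) (dh j) (yext_dominant yx j) hm; rewrite !count_rcons.
by case: (x =P j.+1) => [->|]; case: (h =P j) => [->|]; slia.
Qed.

Lemma jasc u h x y : dominant u -> yext (rcons u h) [:: x; y] ->
  (jout u h x < jout (rcons u (jout u h x)) (jnext u h x) y) = (x < y).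
Proof.
move=> du /= [dh [dx [dy _]]]; rewrite /jout /jnext.
case: (jmoveP u h x) => [[ex e]|hx].
  case: jmoveP => [[-> _]|_]; first by rewrite ex !ltnS.
  have := dy h; rewrite !count_rcons {}ex.
  by case: (y =P h.+1); lia.
case: jmoveP => [[-> e]|_] //.
case: (x =P h) => [ex|]; last by lia.
by move: e (du h); rewrite !count_rcons ex !eqxx; lia.
Qed.

(* The two letters interact only when the first one of [h], [h.+1] decides     *)
(* whether the hole moves.                                                     *)
Lemma jswap u h x y : dominant u ->
  yext (rcons u h) [:: x; y] -> yext (rcons u h) [:: y; x] -> x <> y ->
  ~ (count_mem h u = count_mem h.+1 u /\ (x = h /\ y = h.+1 \/ x = h.+1 /\ y = h)) ->
  let v := rcons u (jout u h x) in let w := rcons u (jout u h y) in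
  [/\ jout v (jnext u h x) y = jout u h y, jout w (jnext u h y) x = jout u h x &
      jnext v (jnext u h x) y = jnext w (jnext u h y) x].
Proof.
move=> du [_ [dx _]] [_ [dy _]] xy no /=; rewrite /jout /jnext.
have dx1 := dx h.+1; have dy1 := dy h.+1; have du0 := du h.
rewrite !count_rcons in dx1 dy1.
case: (jmoveP u h x) => [[ex e]|hx]; case: (jmoveP u h y) => [[ey e']|hy].
- by lia.
- have -> : jmove (rcons u h) h.+1 y = false.
    by apply/jmoveP; rewrite !count_rcons; lia.
  suff -> : jmove (rcons u y) h x = true by [].
  by apply/jmoveP; rewrite !count_rcons; lia.
- have -> : jmove (rcons u h) h.+1 x = false.
    by apply/jmoveP; rewrite !count_rcons; lia.
  suff -> : jmove (rcons u x) h y = true by [].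
  by apply/jmoveP; rewrite !count_rcons; lia.
- have -> : jmove (rcons u x) h y = false.
    by apply/jmoveP; rewrite !count_rcons; lia.
  suff -> : jmove (rcons u y) h x = false by [].
  by apply/jmoveP; rewrite !count_rcons; lia.
Qed.

Lemma flip3_ascents a b c a' b' c' :
  (a' < b') = (a < b) -> (b' < c') = (b < c) ->
  (a < c <= b) || (b < c <= a) -> (a' < c') = (a < c) -> flip3 a' b' c' = [:: b'; a'; c'].
Proof. by move=> e1 e2 e3 e4; rewrite /flip3; case: ifP => //; lia. Qed.

Lemma flip3_ascents_rev a b c a' b' c' :
  (a' < b') = (a < b) -> (b' < c') = (b < c) ->
  (c <= a < b) || (b <= a < c) -> (a' < c') = (a < c) -> flip3 a' b' c' = [:: a'; c'; b'].
Proof.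
by move=> e1 e2 e3 e4; rewrite /flip3; case: ifP => //; [|case: ifP => //]; lia.
Qed.

Lemma yext_take2 p x y q : yext p [:: x, y & q] -> yext p [:: x; y].
Proof. by case=> d [d1 /yext_dominant d2]; split=> //; split. Qed.

(** An elementary dual equivalence commutes with a slide. Its two exchanged letters pass the hole
    independently by [jswap], whose exception is impossible when they are the last two and is
    computed by hand when they are the first two. *)
Lemma jdt_flip u h t : dominant u -> yext (rcons u h) t ->
  jdt u h (flip t) = flip (jdt u h t).
Proof.
move=> du; case: t => [|a [|b [|c q]]] // y.
have yf := yext_flip y; rewrite /= /flip3 in yf; rewrite /= {1}/flip3.
have [d1 y1] := jstep du y; have [d2 y2] := jstep d1 y1.
have A1 := jasc du (yext_take2 y); have A2 := jasc d1 (yext_take2 y1).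
have assoc (v : seq nat) x z : rcons (rcons v x) z = v ++ [:: x; z] by rewrite -!cats1 -catA.
case: ifP yf => F1 yf; last first.
  case: ifP yf => F2 yf; last first.
    rewrite /flip3 [X in if X then _ else _](_ : _ = false); last by lia.
    by rewrite [X in if X then _ else _](_ : _ = false) //; lia.
  have [z1 zz1] := jstep du yf; have B2 := jasc du (yext_take2 yf).
  have bc : b <> c by lia.
  have [|eb ec e] := jswap d1 (yext_take2 y1) (yext_take2 zz1) bc.
    move: y yf => /= [_ [D1 [D2 /yext_dominant D3]]] [_ [_ [E2 /yext_dominant E3]]].
    rewrite /jout /jnext; case: jmoveP => [[ea e]|_] [e1 e2].
      move: (D1 h) (D2 h) (D3 h) (E2 h) (E3 h) e1; rewrite !count_rcons.
      by case: e2 => [] [? ?]; subst; lia.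
    by move: (du h) e1; rewrite !count_rcons; case: e2 => [] [? ?]; subst; lia.
  rewrite /= ec -e eb in A2 *.
  rewrite (flip3_ascents_rev A1 A2 F2 B2) /=; congr [:: _, _, _ & _].
  apply: jdt_perm; rewrite -!cats1 -!catA !perm_cat2l.
  exact: (permEl (perm_catC [:: _] [:: _])).
have [z1 zz1] := jstep du yf; have [z2 zz2] := jstep z1 zz1.
have B2 := jasc z1 (yext_take2 zz1).
have ab : a <> b by lia.
(* In the exceptional case c must be h+1, and the slide turns an exchange of the first two letters
   into one of the last two. *)
have [[eh sp]|nsp] : (count_mem h u = count_mem h.+1 u /\
    (a = h /\ b = h.+1 \/ a = h.+1 /\ b = h)) \/
    ~ (count_mem h u = count_mem h.+1 u /\
    (a = h /\ b = h.+1 \/ a = h.+1 /\ b = h)) by lia.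
  have ec : c = h.+1 by lia.
  have m1 v g : jmove v g g = false by rewrite /jmove; lia.
  have m2 v g : jmove v g.+1 g = false by rewrite /jmove; lia.
  have m3 : jmove u h h.+1 by apply/jmoveP.
  have m4 : jmove (rcons u h) h h.+1 = false.
    by apply/jmoveP; rewrite !count_rcons; lia.
  have m5 : jmove (rcons (rcons u h) h.+1) h h.+1 = true.
    by apply/jmoveP; rewrite !count_rcons; lia.
  rewrite {}ec; case: sp => [] [-> ->].
    rewrite /= /jout /jnext !(m1, m2, m3, m4, m5).
    have -> : flip3 h h.+1 h = [:: h; h; h.+1].
      by rewrite /flip3; case: ifP => //; [|case: ifP => //]; lia.
    congr [:: _, _, _ & _]; apply: jdt_perm; rewrite -!cats1 -!catA perm_cat2l /=.
    by rewrite perm_cons; apply: (permEl (perm_catC [:: _] [:: _])).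
  rewrite /= /jout /jnext !(m1, m2, m3, m4, m5).
  have -> : flip3 h h h.+1 = [:: h; h.+1; h].
    by rewrite /flip3; case: ifP => //; [|case: ifP => //]; lia.
  congr [:: _, _, _ & _]; apply: jdt_perm; rewrite -!cats1 -!catA perm_cat2l /=.
  by rewrite perm_cons; apply: (permEl (perm_catC [:: _] [:: _])).
have [|eb ea e] := jswap du (yext_take2 y) (yext_take2 yf) ab.
  by case=> e1 e2; apply: nsp; rewrite e1; split=> //; lia.
rewrite ea -e in B2; rewrite /= ea -e eb in A1 A2 *.
have pab : perm_eq (rcons (rcons u (jout u h b)) (jout u h a))
     (rcons (rcons u (jout u h a)) (jout u h b)).
  rewrite -!cats1 -!catA perm_cat2l.
  exact: (permEl (perm_catC [:: _] [:: _])).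
have ec g : jout (rcons (rcons u (jout u h b)) (jout u h a)) g c =
    jout (rcons (rcons u (jout u h a)) (jout u h b)) g c.
  by rewrite /jout (jmove_perm _ _ pab).
have en g : jnext (rcons (rcons u (jout u h b)) (jout u h a)) g c =
    jnext (rcons (rcons u (jout u h a)) (jout u h b)) g c.
  by rewrite /jnext (jmove_perm _ _ pab).
rewrite ec en in B2 *.
rewrite (flip3_ascents A1 A2 F1 B2) /=; congr [:: _, _, _ & _].
by apply: jdt_perm; rewrite -!cats1 perm_cat2r !cats1.
Qed.

Lemma valid_pword P u v : valid P (u ++ v) -> valid (pword P u) v.
Proof.
suff H : forall P u, valid P u -> [/\ all (sorted ltn) (pword P u),
    wact (reading P ++ u) =1 wact (reading (pword P u)) &
    size (reading P ++ u) = size (reading (pword P u))].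
  move=> val; have [s e z] := H _ _ (valid_catl val); split=> //.
  case: val => _ r; apply: (reduced_eq r) => [i|].
    by rewrite catA wact_cat -e -wact_cat.
  by rewrite catA size_cat -z -size_cat.
apply: eg_ind => {P u v} [P [aP r]|x w H|C P w IH] => [|v|v] //=.
- by rewrite !cats0.
- exact: H v.
have [sC r vo] := valid_cons v; have [s e z] := IH vo.
have [s' e' z'] := crun_spec sC r.
rewrite pword_cons !reading_cons /= s s'; split=> // [i|].
  by rewrite -catA wact_cat e' -wact_cat catA wact_cat e -wact_cat.
by rewrite -catA size_cat z' -size_cat catA size_cat z -size_cat.
Qed.

(** * Rows of the insertion tableau *)

Definition rowlt (A B : seq nat) : Prop :=
  size B <= size A /\ forall r, r < size B -> nth 0 A r < nth 0 B r.

Definition rowstrict P := forall t, rowlt (nth [::] P t) (nth [::] P t.+1).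

Lemma rowstrict_cons C P : rowstrict (C :: P) <-> rowlt C (nth [::] P 0) /\ rowstrict P.
Proof.
split=> [h|[h0 h] [|t]]; [|exact: h0|exact: h].
by split=> [|t]; [apply: (h 0) | apply: (h t.+1)].
Qed.

(** Here r0 is the row of y in A. The final alternative separates bumping, where a smaller entry
    replaces y, from the unchanged column, where y stays under y-1. *)
Lemma cstep_row x y A : sorted ltn A -> stay_ok x A -> (cstep x A).2 = Some y ->
  exists r0, [/\ nth 0 A r0 = y, forall r, nth 0 (cstep x A).1 r <= nth 0 A r,
    size (cstep x A).1 = size A, forall r, r < r0 -> nth 0 A r < y &
    r0 < size A /\ (nth 0 (cstep x A).1 r0 < y \/ 0 < r0 /\ y <= (nth 0 A r0.-1).+1)].
Proof.
move=> sA okx; move: (col_viewP sA okx) => v; case: A / v {sA okx} => [A1 aA|A1 z A2 aA xz aA2|A1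
  A2 aA aA2].
- by rewrite cstep_ColLast.
- rewrite cstep_ColBump //= => -[<-]; exists (size A1); split=> [|r||r rA|].
  + by rewrite nth_cat ltnn subnn.
  + by rewrite !nth_cat; case: ltnP => // h; case: (r - _) => //=; apply: ltnW.
  + by rewrite !size_cat.
  + by rewrite nth_cat rA; have := allP aA _ (mem_nth 0 rA) => /=; slia.
  + by split; [rewrite size_cat /= -addSnnS leq_addr|left; rewrite nth_cat ltnn subnn].
- rewrite cstep_ColStay //= => -[<-]; exists (size A1).+1; split=> [|//|//|r rA|].
  + by rewrite nth_cat ltnNge leqnSn /= subSn // subnn.
  + rewrite nth_cat; case: (ltnP r (size A1)) => h; first by have := allP aA _ (mem_nth 0 h) =>
    /=; slia.
    by have -> : r - size A1 = 0 by slia.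
  + split; first by rewrite size_cat /=; slia.
    by right; rewrite /= nth_cat ltnn subnn.
Qed.

(** The letter y enters B no lower than its row r0 in A, because an entry of B in that row exceeds
    y. If A is unchanged, y cannot enter in row r0 itself: the entry of B above would lie strictly
    between y-1 and y. *)
Lemma rowlt_cstep x y A B : sorted ltn A -> sorted ltn B -> rowlt A B ->
  stay_ok x A -> (cstep x A).2 = Some y -> stay_ok y B ->
  rowlt (cstep x A).1 (cstep y B).1.
Proof.
move=> sA sB AB okx Ey oky.
have [r0 [Ar0 le eA below [r0A F]]] := cstep_row sA okx Ey.
move: (col_viewP sB oky) => v; case: B / v {sB oky} AB => [B aB|B1 z B2 aB yz aB2|B1 B2 aB aB2]
  [szB lt].
- have Br0 : size B <= r0.
    rewrite leqNgt; apply/negP => h; have := lt _ h; rewrite Ar0.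
    by have := allP aB _ (mem_nth 0 h) => /=; slia.
  rewrite (cstep_ColLast aB) /= /rowlt size_rcons eA; split=> [|r]; first by slia.
  rewrite ltnS nth_rcons leq_eqVlt => /orP[/eqP->|h]; last first.
    by rewrite h; apply: leq_ltn_trans (le _) (lt _ h).
  rewrite ltnn eqxx.
  move: Br0; rewrite leq_eqVlt => /orP[/eqP e|h]; last first.
    by apply: leq_ltn_trans (le _) (below _ h).
  case: F => [|[r0p h]]; first by rewrite e.
  have h1 : r0.-1 < size B by slia.
  have := lt _ h1; have := allP aB _ (mem_nth 0 h1) => /=; slia.
- have Br0 : size B1 <= r0.
    rewrite leqNgt; apply/negP => h; have := lt r0; rewrite Ar0 nth_cat h size_cat => /(_ _).
    have := allP aB _ (mem_nth 0 h) => /= h1 h2.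
    by have := h2 (leq_trans h (leq_addr _ _)); slia.
  rewrite (cstep_ColBump aB yz aB2) /= /rowlt eA; split=> [|r]; first by move: szB;
    rewrite !size_cat.
  move=> hr; case: (r =P size B1) => [->|nr]; last first.
    apply: leq_ltn_trans (le _) _; have := lt r; rewrite !size_cat /= in hr * => /(_ hr).
    by rewrite !nth_cat; case: (ltnP r (size B1)) => // h; case E: (r - _) => //; slia.
  rewrite nth_cat ltnn subnn /=.
  move: Br0; rewrite leq_eqVlt => /orP[/eqP e|h]; last first.
    by apply: leq_ltn_trans (le _) (below _ h).
  case: F => [|[r0p h]]; first by rewrite e.
  have h1 : r0.-1 < size B1 by slia.
  have := lt r0.-1; rewrite nth_cat h1 size_cat => /(_ (leq_trans h1 (leq_addr _ _))).
  have := allP aB _ (mem_nth 0 h1) => /=; slia.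
- by rewrite (cstep_ColStay _ aB) /= /rowlt eA; split=> // r /lt; apply: leq_ltn_trans.
Qed.

Lemma valid_step C P x : valid (C :: P) [:: x] -> stay_ok x C /\
  (forall y, (cstep x C).2 = Some y -> valid P [:: y]).
Proof.
move=> v; have [sC r v'] := valid_cons v; split; first exact: reduced_stay_ok r.
by move=> y Ey; move: v'; rewrite /= Ey.
Qed.

Lemma rowstrict_eg_tab P x : valid P [:: x] -> rowstrict P -> rowstrict (eg_tab x P).
Proof.
elim: P x => [|C P IH] x v; first by move=> _ [|t]; split.
move=> /rowstrict_cons[CP rP]; have [okx vy] := valid_step v.
have [/andP[sC sP] _] := v.
rewrite /eg_tab eg_insert_cons; case Ey: (cstep x C).2 => [y|] /=; apply/rowstrict_cons.
- split; last exact: IH (vy _ Ey) rP.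
  case: P sP {IH v rP} CP vy => [|D P] sP CP vy /=.
    exact: (@rowlt_cstep x y C [::] sC erefl CP okx Ey (fun h => h)).
  have [oky vz] := valid_step (vy _ Ey); move: sP => /andP[sD _].
  have := rowlt_cstep sC sD CP okx Ey oky.
  by rewrite /eg_tab eg_insert_cons; case: (cstep y D).2.
- split=> //; have [_ ->] := cstep_none Ey; case: CP => le lt.
  split=> [|r h]; first by rewrite size_rcons leqW.
  by rewrite nth_rcons (leq_trans h le); apply: lt.
Qed.

Lemma rowstrict_pword P w : valid P w -> rowstrict P -> rowstrict (pword P w).
Proof.
elim: w P => //= x w IH P v rP.
have v1 : valid P [:: x] by apply: (@valid_catl P [:: x] w).
by apply: IH; [exact: (@valid_pword P [:: x] w) | exact: rowstrict_eg_tab].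
Qed.

Lemma size_eg_tab P x t :
  size (nth [::] (eg_tab x P) t) = size (nth [::] P t) + (eg_col x P == t).
Proof.
elim: P x t => [|C P IH] x [|t] //=; rewrite /eg_tab /eg_col ?eg_insert_cons //=.
- by case: t.
- have := cstep_size x C; case: (cstep x C).2 => [y|] /=; lia.
- by case: (cstep x C).2 => [y|] /=; rewrite ?eqSS ?IH ?addn0.
Qed.

Lemma size_pword P w t :
  size (nth [::] (pword P w) t) = size (nth [::] P t) + count_mem t (cword P w).
Proof. by elim: w P => [|x w IH] P /=; rewrite ?addn0 // IH size_eg_tab addnA. Qed.

Lemma yext_cword p P w : (forall t, count_mem t p = size (nth [::] P t)) ->
  rowstrict P -> valid P w -> yext p (cword P w).
Proof.
have dom q R : (forall t, count_mem t q = size (nth [::] R t)) -> rowstrict R -> dominant q.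
  by move=> h rR j; rewrite !h; have [] := rR j.
elim: w p P => [|x w IH] p P h rP v /=; split=> //; try exact: dom h rP.
have v1 : valid P [:: x] by apply: (@valid_catl P [:: x] w).
apply: IH; [|exact: rowstrict_eg_tab|exact: (@valid_pword P [:: x] w)].
by move=> t; rewrite count_rcons size_eg_tab h.
Qed.

(** * Removal of the first letter *)

Fixpoint flipat i c :=
  if i is i'.+1 then if c is x :: c' then x :: flipat i' c' else [::] else flip c.

Lemma flipat_cat i p q : i.+2 < size p -> flipat i (p ++ q) = flipat i p ++ q.
Proof.
elim: i p => [[|a [|b [|d p]]]|i IH [|x p]] //=; first by rewrite catA.
by rewrite ltnS => /IH ->.
Qed.

Lemma perm_flip t : perm_eq (flip t) t.
Proof. by case: t => [|a [|b [|c q]]] //=; rewrite (perm_cat2r q _ [:: a; b; c]) perm_flip3. Qed.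

Lemma perm_flipat i c : perm_eq (flipat i c) c.
Proof.
elim: i c => [|i IH [|x c]] //=; first exact: perm_flip.
by rewrite perm_cons.
Qed.

Lemma yext_flipat p i c : yext p c -> yext p (flipat i c).
Proof.
elim: i c p => [c p|i IH [|x c] p] //=; first exact: yext_flip.
by case=> d /IH.
Qed.

Lemma jdt_flipat i u h t : dominant u -> yext (rcons u h) t ->
  jdt u h (flipat i t) = flipat i (jdt u h t).
Proof.
elim: i u h t => [|i IH] u h [|x t] //= du; first exact: (@jdt_flip u h (x :: t)).
by move=> y; have [d1 y1] := jstep du y; rewrite IH.
Qed.

Lemma jdt_yext u h c : dominant u -> yext (rcons u h) c -> yext u (jdt u h c).
Proof.
elim: c u h => [|x c IH] u h du y; first by split.
by have [d1 y1] := jstep du y; split=> //; apply: IH.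
Qed.

Lemma size_jdt u h c : size (jdt u h c) = size c.
Proof. by elim: c u h => //= x c IH u h; rewrite IH. Qed.

Definition ascents (c : seq nat) : seq bool :=
  if c is x :: c' then pairmap (fun a b => a < b) x c' else [::].

Lemma ascents_jdt u h c : dominant u -> yext (rcons u h) c ->
  ascents (jdt u h c) = ascents c.
Proof.
elim: c u h => [|x [|y c] IH] u h du v //.
have [d1 y1] := jstep du v.
by have /= -> := IH _ _ d1 y1; rewrite jasc //; apply: yext_take2 v.
Qed.

Inductive reach (c : seq nat) : seq nat -> Prop :=
| ReachRefl : reach c c
| ReachStep c' i : reach c c' -> i.+2 < size c' -> reach c (flipat i c').

Lemma reach_trans c1 c2 c3 : reach c1 c2 -> reach c2 c3 -> reach c1 c3.
Proof. by move=> r; elim=> // c' i _ IH lt; apply: ReachStep. Qed.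

Lemma reach_cat c c' s : reach c c' -> reach (c ++ s) (c' ++ s).
Proof.
elim=> [|c1 i _ IH lt]; first exact: ReachRefl.
rewrite -flipat_cat //; apply: ReachStep => //.
by rewrite size_cat ltn_addr.
Qed.

Lemma reach_perm c c' : reach c c' -> perm_eq c' c.
Proof.
by elim=> // c1 i _ IH _; apply: perm_trans IH; apply: perm_flipat.
Qed.

Lemma reach_yext p c c' : reach c c' -> yext p c -> yext p c'.
Proof. by elim=> // c1 i _ IH _ /IH; apply: yext_flipat. Qed.

Lemma yext_cat_dominant p u v : yext p (u ++ v) -> dominant (p ++ u).
Proof. by case/yext_cat => _ /yext_dominant. Qed.

(** Any removable box can be made to carry the last entry: by induction e is brought to the end of
    the prefix and a suitable f just before it, and then the last three letters are flipped. *)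
Lemma reach_corner c e : yext [::] c -> count_mem e.+1 c < count_mem e c ->
  exists c', reach c (rcons c' e).
Proof.
have [m] := ubnP (size c); elim: m c e => // m IH c e.
case/lastP: c => [|c x] //; rewrite size_rcons ltnS => le y.
rewrite !count_rcons => lt.
have [->|xe] := x =P e; first by exists c; apply: ReachRefl.
have yc : yext [::] c by move: y; rewrite -cats1 => /yext_cat[].
have [|c1 r1] := IH c e le yc; first by lia.
have p1 := reach_perm r1.
have y1 := reach_yext r1 yc.
have y1' : yext [::] c1 by move: y1; rewrite -cats1 => /yext_cat[].
have s1 : (size c1).+1 = size c by rewrite -(perm_size p1) size_rcons.
have dx : dominant (rcons c x) by move: y; rewrite -{1}[rcons c x]cats0 => /yext_cat_dominant.
have dc : dominant c by move: yc; rewrite -{1}[c]cats0 => /yext_cat_dominant.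
have cnt j : count_mem j c = count_mem j c1 + (e == j).
  by rewrite -count_rcons; apply/esym/permP.
(* The choice min(e, x) <= f < max(e, x) makes the flip of f, e, x exchange e and x; dominance of
   the longer words shows that f is removable. *)
pose f := (maxn e x).-1.
have [||c2 r2] := IH c1 f _ y1'; first by lia.
  have := dx f; have := dc f; move: lt; rewrite !count_rcons !cnt /f.
  have [xlt|xgt|//] := ltngtP x e.
    have -> : e.-1.+1 = e by lia.
    by lia.
  have -> : x.-1.+1 = x by lia.
  case: (x =P e.+1) => [->|] /=; last by lia.
  by lia.
have r : reach (rcons c x) (c2 ++ [:: f; e; x]).
  rewrite -cats1; apply: reach_trans (reach_cat [:: x] r1) _.
  rewrite cat_rcons; apply: reach_trans (reach_cat _ r2) _.
  by rewrite cat_rcons; apply: ReachRefl.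
exists (c2 ++ [:: f; x]); rewrite -[X in reach _ X]cats1 -(catA c2).
have -> : c2 ++ [:: f; x] ++ [:: e] = flipat (size c2) (c2 ++ [:: f; e; x]).
  elim: c2 {r r2} => [|z c2 /= <-] //=; rewrite /flip3 /f.
  by case: ifP => [|_]; [lia|case: ifP => //; lia].
by apply: ReachStep r _; rewrite size_cat /=; lia.
Qed.

(* Induction on the size: were the last letters different, flips of the prefix *)
(* could bring a corner that separates them just before the end, and the last  *)
(* ascents would differ.                                                       *)
Lemma flip_bisim (S : seq nat -> seq nat -> Prop) :
  (forall c c', S c c' -> size c = size c') ->
  (forall c c', S c c' -> yext [::] c /\ yext [::] c') ->
  (forall c c', S c c' -> ascents c = ascents c') ->
  (forall c c' i, S c c' -> i.+2 < size c -> S (flipat i c) (flipat i c')) ->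
  forall c c', S c c' -> c = c'.
Proof.
move=> Sz Sy Sa Sf c c' s; move: (s); have [m] := ubnP (size c).
elim: m c c' S Sz Sy Sa Sf s => // m IH c c' S Sz Sy Sa Sf _ le s.
have sz := Sz _ _ s; case: (lastP c) le s sz => [|{}c x] le s.
  by move=> /= sz; apply/esym/nilP; rewrite /nilp -sz.
case: (lastP c') s => [|{}c' x'] s; rewrite size_rcons //.
rewrite size_rcons => -[sz].
(* Dropping the last letters gives a relation with the same closure properties, to which the
   induction over all relations applies; hence the prefixes agree. *)
pose S' u u' := exists y y', S (rcons u y) (rcons u' y').
have asc_rcons (u : seq nat) y : ascents (rcons u y) =
    if u is z :: u' then rcons (ascents u) (last z u' < y) else [::].
  case: u => //= z u; elim: u z => //= w u IHu z.
  by rewrite IHu.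
have S1 u u' : S' u u' -> size u = size u'.
  by case=> y [y' /Sz]; rewrite !size_rcons => -[].
have S2 u u' : S' u u' -> yext [::] u /\ yext [::] u'.
  by case=> y [y' /Sy]; rewrite -!cats1 !yext_cat => -[[? _] [? _]].
have S3 u u' : S' u u' -> ascents u = ascents u'.
  move=> s'; have := S1 _ _ s'; case: s' => y [y' /Sa]; rewrite !asc_rcons.
  by case: u u' => [|z u] [|z' u'] // /rcons_inj[].
have S4 u u' i : S' u u' -> i.+2 < size u -> S' (flipat i u) (flipat i u').
  move=> s' lt; have e := S1 _ _ s'; case: s' => y [y' s'].
  exists y, y'; rewrite -!cats1 -!flipat_cat -?e // !cats1; apply: Sf => //.
  by rewrite size_rcons ltnW.
have eS u u' : S' u u' -> size u < m -> u = u'.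
  by move=> s' lt; apply: (IH u u' S').
have ec : c = c' by apply: eS; [exists x, x' | move: le; rewrite size_rcons].
subst c'; congr rcons.
have same u u' y y' : S (rcons u y) (rcons u y') -> reach u u' -> S (rcons u' y) (rcons u' y').
  move=> s' r; elim: r => // u1 i r IHr lt.
  rewrite -!cats1 -!flipat_cat // !cats1; apply: Sf => //.
  by rewrite size_rcons ltnW.
have [y1 y2] := Sy _ _ s.
have yc : yext [::] c by move: y1; rewrite -cats1 => /yext_cat[].
(* If the last letters are z < z', a removable f with z <= f < z' placed before them is followed by
   an ascent in one word only. *)
have corner z z' : yext [::] (rcons c z') -> z < z' -> exists2 f, z <= f < z' & count_mem f.+1 c <
  count_mem f c.
  move=> y zz'; exists z'.-1; first by lia.
  have := yext_cat_dominant (u := rcons c z') (v := [::]); rewrite cats0 => /(_ _ y z'.-1).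
  have -> : z'.-1.+1 = z' by lia.
  by rewrite /= !count_rcons eqxx addn1; case: eqP => [e|_]; [lia | rewrite addn0].
have last_ascent c1 f z z' : S (rcons (rcons c1 f) z) (rcons (rcons c1 f) z') ->
    (f < z) = (f < z').
  move=> /Sa; rewrite !asc_rcons; case: c1 => [|w c1] /=; first by case.
  by move/rcons_inj => -[]; rewrite last_rcons.
have [xx|xx|//] := ltngtP x x'.
  have [f fx /(reach_corner yc)[c1 r]] := corner _ _ y2 xx.
  by have := last_ascent _ _ _ _ (same _ _ _ _ s r); lia.
have [f fx /(reach_corner yc)[c1 r]] := corner _ _ y1 xx.
by have := last_ascent _ _ _ _ (same _ _ _ _ s r); lia.
Qed.

Definition descents (w : seq nat) : seq bool :=
  if w is x :: w' then pairmap (fun a b => b < a) x w' else [::].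

Lemma ascents_cword P w : valid P w -> ascents (cword P w) = descents w.
Proof.
elim: w P => [|a [|b w] IH] P v //.
have v1 : valid (eg_tab a P) (b :: w) by apply: (@valid_pword P [:: a]).
have /= -> := IH _ v1; rewrite cword_ascent //.
exact: (@valid_catl P [:: a; b] w).
Qed.

Lemma ck_exists a b c : reduced [:: a; b; c] -> (b < a) != (c < b) ->
  exists t, ck [:: a; b; c] t \/ ck t [:: a; b; c].
Proof.
move=> r; have n1 : a <> b by move=> e; have := @reduced_repeat [::] a [:: c]; rewrite /= {2}e;
  apply.
have n2 : b <> c by move=> e; have := @reduced_repeat [:: a] b [::]; rewrite /= {2}e; apply.
have n3 : a = c -> a.+1 < b \/ b.+1 < a -> False.
  move=> e h; have := @reduced_repeat [::] a [:: b]; apply; apply: (reduced_eq r) => // i.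
  rewrite -e /=; congr (sw a _); case: h => h; first exact: wact_comm.
  exact/esym/wact_comm.
have [ab|ba|//] := ltngtP a b; have [bc|cb|//] := ltngtP b c => //= _.
  have [ac|ca|ac] := ltngtP a c.
  - by exists [:: b; a; c]; left; apply: CkXZY.
  - by exists [:: a; c; b]; right; apply: CkYXZ.
  - have eb : b = a.+1 by have := n3 ac; lia.
    by exists [:: b; a; b]; left; rewrite eb -ac; apply: CkBraid.
have [ac|ca|ac] := ltngtP a c.
- by exists [:: a; c; b]; left; apply: CkYXZ.
- by exists [:: b; a; c]; right; apply: CkXZY.
- have ea : a = b.+1 by have := n3 ac; lia.
  by exists [:: b; a; b]; right; rewrite -ac ea; apply: CkBraid.
Qed.

Lemma valid_eq P w w' : valid P w -> wact w' =1 wact w -> size w' = size w -> valid P w'.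
Proof.
case=> aP r e z; split=> //; apply: (reduced_eq r) => [i|].
  by rewrite !wact_cat e.
by rewrite !size_cat z.
Qed.

Lemma flip3_id a b c : (a < b) = (b < c) -> flip3 a b c = [:: a; b; c].
Proof. by move=> e; rewrite /flip3; case: ifP => //; [|case: ifP => //]; lia. Qed.

(** The same w' serves for every P, so that one rewriting flips the boxes created from the empty
    tableau and from the tableau of one letter x alike. Three monotone letters need no move, since
    [flip] then does nothing. *)
Lemma flip_word i w : reduced w -> exists w',
  [/\ wact w' =1 wact w, size w' = size w & forall P, valid P w ->
     pword P w' = pword P w /\ cword P w' = flipat i (cword P w)].
Proof.
elim: i w => [|i IH] w r; last first.
  case: w r => [|x w] r; first by exists [::].
  have [w' [e z h]] := IH w (@reduced_catr [:: x] w r); exists (x :: w').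
  split=> [j||P v] /=; [by rewrite e|by rewrite z|].
  by have [-> ->] := h _ (@valid_pword P [:: x] w v).
case: w r => [|a [|b [|c q]]] r; try by [exists [::] | exists [:: a] | exists [:: a; b]].
have r3 : reduced [:: a; b; c] := @reduced_catl [:: a; b; c] q r.
have [ne|eq] := boolP ((b < a) != (c < b)); last first.
  exists [:: a, b, c & q]; split=> // P v; split=> //=.
  have v3 : valid P [:: a; b; c] := @valid_catl P [:: a; b; c] q v.
  have := ascents_cword v3; rewrite /= => -[e1 e2].
  by rewrite flip3_id //; move/negbNE/eqP: eq; rewrite e1 e2.
have [t h] := ck_exists r3 ne.
have ht : wact t =1 wact [:: a; b; c] /\ size t = 3.
  by case: h => h; have := ck_size h; have := ck_wact h => /= e <-; split=> // i.
exists (t ++ q); case: ht => ht zt; split=> [j||P v].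
- by rewrite wact_cat ht.
- by rewrite size_cat zt.
have v3 : valid P [:: a; b; c] := @valid_catl P [:: a; b; c] q v.
have vt : valid P t by apply: valid_eq v3 _ _ => //; exact: zt.
have [e1 e2] : pword P t = pword P [:: a; b; c] /\ cword P t = flip (cword P [:: a; b; c]).
  case: h => h; first by have [-> ->] := cword_ck h v3.
  by have [-> ->] := cword_ck h vt; rewrite flipK.
rewrite -[[:: a, b, c & q]]/([:: a; b; c] ++ q) !pword_cat !cword_cat e1 e2.
by split=> //=; rewrite -catA.
Qed.

(* Both sides carry the same ascents and are compatible with the elementary    *)
(* dual equivalences.                                                          *)
Theorem cword_behead x w : reduced (x :: w) ->
  cword [::] w = jdt [::] 0 (cword [:: [:: x]] w).
Proof.
pose S c c' := exists w, [/\ valid [:: [:: x]] w, c = cword [::] w &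
  c' = jdt [::] 0 (cword [:: [:: x]] w)].
move=> r; suff H : forall c c', S c c' -> c = c' by apply: H; exists w.
have v0 u : valid [:: [:: x]] u -> valid [::] u.
  by case=> _ /(@reduced_catr [:: x]).
have dom0 : dominant [::] by move=> j.
have y0 u : valid [:: [:: x]] u -> yext [:: 0] (cword [:: [:: x]] u).
  move=> v; apply: yext_cword => //.
  - by case=> [|[|t]].
  - by case=> [|[|t]].
apply: flip_bisim => [c c'|c c'|c c'|c c' i] [u [v -> ->]].
- by rewrite size_jdt !size_cword.
- split; last by apply: jdt_yext => //; apply: y0.
  by apply: yext_cword => //; [case|apply: v0].
- by rewrite ascents_jdt //; [rewrite !ascents_cword //; apply: v0|apply: y0].
- have ru : reduced u by case: (v0 _ v).
  have [u' [e z h]] := flip_word i ru => _; exists u'; split.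
  + exact: valid_eq v e z.
  + by have [_ ->] := h _ (v0 _ v).
  + by rewrite -jdt_flipat //; [have [_ ->] := h _ v | apply: y0].
Qed.

(** * Words filling a staircase *)

Lemma cstep_out_mem x C y : (cstep x C).2 = Some y -> y \in C /\ x < y.
Proof.
rewrite /cstep; case: ifP => // hC [<-]; split; last exact: (nth_find 0 hC).
by apply: mem_nth; rewrite -has_find.
Qed.

Lemma all_eg_tab (p : pred nat) x P : all (all p) P -> p x -> all (all p) (eg_tab x P).
Proof.
elim: P x => [|C P IH] x /=; first by rewrite /eg_tab /= => _ ->.
case/andP=> pC pP px; rewrite /eg_tab eg_insert_cons.
have pC' : all p (cstep x C).1.
  by apply/allP => d /cstep_mem/orP[/eqP->|/(allP pC)].
case E: (cstep x C).2 => [y|] /=; rewrite pC' //=; apply: IH => //.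
by have [/(allP pC)] := cstep_out_mem E.
Qed.

Lemma all_pword (p : pred nat) w P : all (all p) P -> all p w -> all (all p) (pword P w).
Proof.
elim: w P => //= x w IH P pP /andP[px pw]; apply: IH => //; exact: all_eg_tab.
Qed.

Lemma sorted_ltn_uniq C : sorted ltn C -> uniq C.
Proof. exact: (sorted_uniq ltn_trans ltnn). Qed.

Lemma sorted_iota C a : sorted ltn C -> {subset C <= iota a (size C)} -> C = iota a (size C).
Proof.
move=> sC sub; apply: (irr_sorted_eq ltn_trans ltnn sC (iota_ltn_sorted _ _)).
by have [] := uniq_min_size (sorted_ltn_uniq sC) sub; rewrite ?size_iota.
Qed.

Lemma nth_all (p : pred (seq nat)) P t : p [::] -> all p P -> p (nth [::] P t).
Proof.
move=> p0 /allP pP; case: (ltnP t (size P)) => h; first exact: pP (mem_nth _ h).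
by rewrite nth_default.
Qed.

Lemma sum_sub_bin2 N M : N <= M -> \sum_(t < M) (N.-1 - t) = 'C(N, 2).
Proof.
move=> /subnK <-; rewrite addnC big_split_ord /= [X in _ + X]big1 ?addn0; last first.
  by move=> i _; lia.
elim: N => [|N IH]; first by rewrite big_ord0.
rewrite big_ord_recl /= subn0 binS bin1 addnC -IH; congr (_ + _).
by apply: eq_bigr => i _; rewrite /bump /=; lia.
Qed.

Lemma size_reading_pword P u : valid P u ->
  size (reading (pword P u)) = size (reading P ++ u).
Proof.
move: P u; apply: eg_ind => [P _|x w H|C P w IH] => [|v|v].
- by rewrite cats0.
- exact: H v.
- have [sC rC vo] := valid_cons v; rewrite pword_cons !reading_cons size_cat IH //.
  have [_ _ z] := crun_spec sC rC.
  by move: z; rewrite !size_cat; lia.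
Qed.

(* The entry in row r and column t is at least [a + r + t]; a tableau of       *)
(* 'C(N, 2) boxes with entries in [a, a + N.-1[ therefore fills the staircase. *)
Lemma staircase_pword a N w : reduced w -> all (fun b => a <= b < a + N.-1) w ->
  size w = 'C(N, 2) ->
  forall t, nth [::] (pword [::] w) t = iota (a + t) (N.-1 - t).
Proof.
move=> r aw sw; set P := pword _ _.
have v : valid [::] w by [].
have rP : rowstrict P by apply: rowstrict_pword => // -[|t]; split.
have [sP zP] : all (sorted ltn) P /\ size (reading P) = size w.
  have [] : valid P [::] by apply: valid_pword; rewrite cats0.
  by rewrite size_reading_pword.
have sC t : sorted ltn (nth [::] P t) by apply: nth_all.
have lo t : all (leq (a + t)) (nth [::] P t).
  elim: t => [|t IHt].
    rewrite addn0; apply: nth_all => //.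
    by apply: all_pword => //; apply: sub_all aw => b /andP[].
  apply/(all_nthP 0) => i hi; have [le lt] := rP t.
  have := all_nthP 0 IHt i (leq_trans hi le); have := lt _ hi; lia.
have hi t : all (fun b => b < a + N.-1) (nth [::] P t).
  apply: (@nth_all (all _)) => //; apply: all_pword => //.
  by apply: sub_all aw => b /andP[].
have sub t : {subset nth [::] P t <= iota (a + t) (N.-1 - t)}.
  by move=> d dC; rewrite mem_iota; have := allP (lo t) _ dC; have := allP (hi t) _ dC => /=; slia.
have le t : size (nth [::] P t) <= N.-1 - t.
  by have := uniq_leq_size (sorted_ltn_uniq (sC t)) (sub t); rewrite size_iota.
suff eqs t : size (nth [::] P t) = N.-1 - t.
  by move=> t; rewrite -{1}(eqs t); apply: sorted_iota => //; rewrite eqs.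
(* Over at least N columns the upper bounds N-1-t add up to 'C(N, 2), the number of boxes, so every
   bound is attained. *)
pose M := maxn N (maxn t.+1 (size P)).
have tM : t < M by rewrite /M; lia.
have := leqif_sum (fun (i : 'I_M) (_ : true) => leqif_eq (le i)).
rewrite sum_sub_bin2; last by rewrite /M; lia.
have -> : \sum_(i < M) size (nth [::] P i) = 'C(N, 2).
  rewrite -sw -zP /reading size_flatten /shape map_rev sumnE (perm_big _ (permEl (perm_rev _))) /=.
  rewrite big_map (big_nth [::]) big_mkord.
  have PM : size P <= M by rewrite /M; lia.
  rewrite (big_ord_widen _ (fun i => size (nth [::] P i)) PM) [RHS]big_mkcond /=.
  by apply: eq_bigr => i _; case: ltnP => // h; rewrite nth_default.
by case=> _; rewrite eqxx => /esym/forallP/(_ (Ordinal tM))/eqP.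
Qed.

Lemma cstep_frozen e y C : sorted ltn C -> stay_ok y C -> e < y ->
  [seq d <- (cstep y C).1 | d <= e] = [seq d <- C | d <= e].
Proof.
move=> sC ok ey; move: (col_viewP sC ok) => v; case: C / v {sC ok} => [A aA|A z B aA yz aB|A B aA
  aB].
- by rewrite (cstep_ColLast aA) /= filter_rcons leqNgt ey.
- rewrite (cstep_ColBump aA yz aB) /= !filter_cat /=.
  by rewrite ![_ <= e]leqNgt ey (ltn_trans ey yz).
- by rewrite (cstep_ColStay _ aA).
Qed.

Lemma crun_frozen e C w : sorted ltn C -> reduced (C ++ w) -> all (ltn e) w ->
  [seq d <- (crun C w).1 | d <= e] = [seq d <- C | d <= e] /\
  all (ltn e.+1) (outs C w).
Proof.
elim: w C => [|x w IH] C sC r //=; case/andP=> ex ew.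
have ok : stay_ok x C.
  by apply: reduced_stay_ok sC _; move: r; rewrite -cat_rcons -cats1 => /reduced_catl.
have r' : reduced ((cstep x C).1 ++ w).
  apply: (@reduced_catr (oseq (cstep x C).2)); apply: (reduced_eq r) => [i|].
    by rewrite catA wact_cat -cstep_wact // -wact_cat -catA.
  by rewrite !size_cat /=; have := cstep_size x C; lia.
have [-> ao] := IH _ (cstep_sorted sC ok) r' ew.
rewrite cstep_frozen //; split=> //.
case E: (cstep x C).2 => [y|] //=; rewrite ao andbT.
by have [_] := cstep_out_mem E; lia.
Qed.

(** A bumped letter exceeds the letter that bumps it, so the threshold below which entries are
    untouched rises by one in each column. *)
Lemma pword_frozen P w e : valid P w -> all (ltn e) w -> forall t,
  [seq d <- nth [::] (pword P w) t | d <= e + t] = [seq d <- nth [::] P t | d <= e + t].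
Proof.
move: P w e; suff H : forall P w, forall e, valid P w -> all (ltn e) w -> forall t,
  [seq d <- nth [::] (pword P w) t | d <= e + t] = [seq d <- nth [::] P t | d <= e + t].
  by move=> P w e; apply: H.
apply: eg_ind => [//|x w H e v aw t|C P w IH e v aw t].
  by rewrite (H e v aw t); case: t => [|[|t]].
have [sC r vo] := valid_cons v; rewrite pword_cons.
have [e1 ao] := crun_frozen sC r aw.
by case: t => [|t]; [rewrite /= addn0 | rewrite /= addnS -addSn IH].
Qed.

(* [P] has reached its final entries below the antidiagonal of [x].            *)
Definition settled (a L x : nat) P := forall t,
  [seq d <- nth [::] P t | d <= x + t] = [seq d <- iota (a + t) (L - t) | d <= x + t].

Lemma filter_iota a L x : a <= x < a + L ->
  [seq d <- iota a L | d <= x] = iota a (x - a).+1.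
Proof.
move=> h; have -> : L = (x - a).+1 + (L - (x - a).+1) by lia.
rewrite iotaD filter_cat [X in _ ++ X](_ : _ = [::]) ?cats0.
  by apply/all_filterP/allP => d; rewrite mem_iota; lia.
by apply/eqP; rewrite -(negbK (_ == _)) -has_filter; apply/hasPn => d; rewrite mem_iota; lia.
Qed.

Lemma sorted_filter_le x D : sorted ltn D ->
  exists D', D = [seq d <- D | d <= x] ++ D'.
Proof.
move=> sD; have [A [B [e aA aB]]] := sorted_cut x.+1 sD; exists B.
suff -> : [seq d <- D | d <= x] = A by [].
rewrite e filter_cat [X in _ ++ X](_ : _ = [::]) ?cats0.
  by apply/all_filterP/allP => d dA; have := allP aA _ dA => /=; slia.
by apply/eqP; rewrite -(negbK (_ == _)) -has_filter; apply/hasPn => d /(allP aB) /=; slia.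
Qed.

(* A letter that is followed by larger letters only runs along the row in      *)
(* which it starts, since the entries below it are already in place.           *)
Lemma settled_bump a L x C P y : valid (C :: P) [:: x] -> rowstrict (C :: P) ->
  settled a L x (eg_tab x (C :: P)) -> a <= x < a + L -> all (ltn^~ (a + L)) C ->
  (cstep x C).2 = Some y -> y = x.+1.
Proof.
move=> v /rowstrict_cons[[leD lt] rP] F xL aC Ey.
have [okx vy] := valid_step v; have [/andP[sC sP] _] := v.
have [yC xy] := cstep_out_mem Ey; have yL : y < a + L := allP aC _ yC.
apply/eqP; rewrite eqn_leq xy andbT leqNgt; apply/negP => xy1.
have F0 := F 0; rewrite /eg_tab eg_insert_cons Ey /= !addn0 subn0 filter_iota // in F0.
have F1 := F 1; rewrite /eg_tab eg_insert_cons Ey /= filter_iota in F1; last by slia.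
have sD : sorted ltn (nth [::] P 0) by case: (P) sP => [|D P'] //= /andP[].
have eD : [seq d <- nth [::] (eg_tab y P) 0 | d <= x + 1] = [seq d <- nth [::] P 0 | d <= x + 1].
  case: (P) sP (vy _ Ey) => [|D P'] sP' vP.
    by rewrite /eg_tab /= leqNgt addn1 xy1.
  have [oky _] := valid_step vP; case/andP: sP' => sD' _.
  rewrite /eg_tab eg_insert_cons; case E: (cstep y D).2 => [z|] /=;
    by apply: cstep_frozen => //; slia.
have [D' eD'] := sorted_filter_le (x + 1) sD.
rewrite -eD F1 in eD'.
move: (col_viewP sC okx) Ey F0 aC => v'.
case: C / v' {F okx vy sC v yC F1 eD} leD lt => [A aA|A z B aA xz aB|A B aA aB] leD lt.
- by rewrite (cstep_ColLast aA).
- rewrite (cstep_ColBump aA xz aB) /= => -[ezy]; subst z => F0 _.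
  have sA : size A = x - a.
    have := congr1 size F0; rewrite filter_cat /= leqnn size_cat /= size_iota.
    rewrite (all_filterP _); last by apply: sub_all aA => d; apply: ltnW.
    have -> : [seq d <- B | d <= x] = [::].
      by apply/eqP; rewrite -(negbK (_ == _)) -has_filter; apply/hasPn => d /(allP aB) /=; slia.
    by rewrite /=; slia.
  have := lt (size A); rewrite nth_cat ltnn subnn /= eD' nth_cat size_cat size_iota.
  rewrite (_ : size A < _ = true) ?nth_iota; [|slia|slia].
  by rewrite sA; case: ifP => h /(_ isT); slia.
- by rewrite (cstep_ColStay _ aA) /= => -[e]; exfalso; slia.
Qed.

(** By [settled_bump] the letter enters the next column as x+1, where the least final entry is a+1;
    the difference x - a never changes. *)
Lemma settled_row a L x P : valid P [:: x] -> rowstrict P ->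
  settled a L x (eg_tab x P) -> a <= x < a + L -> all (all (ltn^~ (a + L))) P ->
  size (nth [::] P (eg_col x P)) = x - a.
Proof.
elim: P a L x => [|C P IH] a L x v rP F xL aP.
  have := congr1 size (F 0); rewrite /eg_tab /= !addn0 leqnn subn0 filter_iota // size_iota.
  by move=> [<-].
have [okx vy] := valid_step v; case/andP: aP => aC aP.
rewrite /eg_col eg_insert_cons; case Ey: (cstep x C).2 => [y|] /=; last first.
  have [al eC] := cstep_none Ey.
  have := congr1 size (F 0); rewrite /eg_tab eg_insert_cons Ey /= !addn0 subn0 filter_iota //.
  rewrite size_iota eC filter_rcons leqnn size_rcons (all_filterP al); slia.
have ey := settled_bump v rP F xL aC Ey; subst y.
have /rowstrict_cons[_ rP'] := rP.
have [/(allP aC) yL _] := cstep_out_mem Ey.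
have -> : x - a = x.+1 - a.+1 by slia.
apply: (IH _ L.-1) => //; first exact: vy.
- move=> t; have := F t.+1; rewrite /eg_tab eg_insert_cons Ey /= => e.
  by rewrite addSnnS e addSnnS; congr [seq _ <- iota _ _ | _]; slia.
- by move: yL => /=; slia.
- by apply: sub_all aP => D; apply: sub_all => d /=; slia.
Qed.

(** In each column x bumps x+1, and this entry lies strictly between x and z, so [cstep_comm]
    applies. *)
Lemma settled_swap a L x z P : valid P [:: x; z] -> valid P [:: z; x] ->
  rowstrict P -> settled a L x (eg_tab x P) -> a <= x < a + L -> x.+1 < z < a + L ->
  all (all (ltn^~ (a + L))) P ->
  pword P [:: z; x] = pword P [:: x; z] /\
  cword P [:: z; x] = rev (cword P [:: x; z]).
Proof.
elim: P a L x z => [|C P IH] a L x z v v' rP F xL zL aP.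
  have := congr1 size (F 0); rewrite /eg_tab /= !addn0 leqnn subn0 filter_iota // size_iota =>
    -[xa].
  have := congr1 size (F 1); rewrite /= filter_iota ?size_iota //; slia.
have v1 : valid (C :: P) [:: x] := @valid_catl _ [:: x] [:: z] v.
have [okx vy] := valid_step v1; case/andP: aP => aC aP.
have [sC r vo] := valid_cons v; have [_ r' vo'] := valid_cons v'.
have /rowstrict_cons[[leD _] rP'] := rP.
(* The letter x cannot be absorbed: C would have only x - a entries, while x - a + 1 entries of the
   next column are already final. *)
case Ey: (cstep x C).2 => [y|]; last first.
  have [al eC] := cstep_none Ey.
  have := congr1 size (F 0); rewrite /eg_tab eg_insert_cons Ey /= !addn0 subn0 filter_iota //.
  rewrite size_iota eC filter_rcons leqnn size_rcons (all_filterP al) => sxC.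
  have := congr1 size (F 1); rewrite /eg_tab eg_insert_cons Ey /= filter_iota; last by slia.
  rewrite size_iota size_filter; have := count_size (fun d => d <= x + 1) (nth [::] P 0).
  by slia.
have ey := settled_bump v1 rP F xL aC Ey; subst y.
have [yC _] := cstep_out_mem Ey; have yL : x.+1 < a + L := allP aC _ yC.
have [e1 e2 e3] := cstep_comm sC (ltnSn x) (proj1 (andP zL)) yC.
rewrite !pword_cons !cword_cons /= in vo vo' *.
rewrite -e1 e2 e3 Ey /= in vo vo' *.
case Ez: (cstep z C).2 => [z'|] //=; rewrite Ez /= in vo vo'.
have [/(allP aC) z'L zz'] := cstep_out_mem Ez.
have [||||ep ec] := IH a.+1 L.-1 x.+1 z' vo vo' rP'.
- move=> t; have := F t.+1; rewrite /eg_tab eg_insert_cons Ey /= => e.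
  by rewrite addSnnS e addSnnS; congr [seq _ <- iota _ _ | _]; slia.
- by slia.
- by move: z'L => /=; slia.
- by apply: sub_all aP => D; apply: sub_all => d /=; slia.
by move: ep ec => /= -> [-> ->].
Qed.

Definition colseq (c : nat) (l : seq (nat * nat)) : seq nat :=
  [seq x.2 | x <- l & x.1 == c].

(* The list of (column, label) pairs of the boxes of a recording tableau. *)
Definition labelled P (s : seq (nat * nat)) : seq (nat * nat) :=
  zip (cword P (unzip2 s)) (unzip1 s).

Lemma colseq_cat c l l' : colseq c (l ++ l') = colseq c l ++ colseq c l'.
Proof. by rewrite /colseq filter_cat map_cat. Qed.

Lemma size_colseq c l : size (colseq c l) = count_mem c (unzip1 l).
Proof. by rewrite size_map size_filter count_map. Qed.

Lemma labelled_cat P s s' :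
  labelled P (s ++ s') = labelled P s ++ labelled (pword P (unzip2 s)) s'.
Proof.
rewrite /labelled /unzip2 /unzip1 !map_cat cword_cat zip_cat //.
by rewrite size_cword !size_map.
Qed.

Lemma unzip1_labelled P s : unzip1 (labelled P s) = cword P (unzip2 s).
Proof. by rewrite unzip1_zip // size_cword !size_map. Qed.

Section Staircase.

Variables a N : nat.

(** By its length, such a word is a reduced word of the permutation reversing the N points a, ...,
    a+N-1. *)
Definition staircase_word (w : seq nat) : Prop :=
  [/\ reduced w, all (fun b => a <= b < a + N.-1) w & size w = 'C(N, 2)].

Lemma staircase_word_eq w w' : staircase_word w -> wact w' =1 wact w ->
  perm_eq w' w -> staircase_word w'.
Proof.
case=> r aw z e pe; split; last by rewrite (perm_size pe).
- by apply: (reduced_eq r) => //; apply: perm_size.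
- by rewrite (perm_all _ pe).
Qed.

Lemma staircase_valid p q : staircase_word (p ++ q) -> valid (pword [::] p) q.
Proof. by case=> r _ _; apply: valid_pword. Qed.

Lemma staircase_rowstrict p q : staircase_word (p ++ q) -> rowstrict (pword [::] p).
Proof.
case=> r _ _; apply: rowstrict_pword; first by split=> //; apply: reduced_catl r.
by move=> [|t]; split.
Qed.

Lemma staircase_below p q : staircase_word (p ++ q) ->
  all (all (ltn^~ (a + N.-1))) (pword [::] p).
Proof.
case=> _; rewrite all_cat => /andP[ap _] _; apply: all_pword => //.
by apply: sub_all ap => b /andP[].
Qed.

Lemma staircase_settled p x q : staircase_word (p ++ x :: q) -> all (ltn x) q ->
  settled a N.-1 x (eg_tab x (pword [::] p)).
Proof.
move=> st xq t; have [r aw z] := st.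
have v : valid (eg_tab x (pword [::] p)) q.
  exact: (@valid_pword (pword [::] p) [:: x] q (staircase_valid st)).
by rewrite -(pword_frozen v xq) -(staircase_pword r aw z) pword_cat.
Qed.

(** The two letters create boxes in different columns, so exchanging them together with their labels
    changes no column. *)
Lemma boxes_swap p x z q la lz c :
  staircase_word (unzip2 p ++ [:: x, z & unzip2 q]) ->
  all (ltn x) (z :: unzip2 q) -> x.+1 < z ->
  colseq c (labelled [::] (p ++ [:: (la, x), (lz, z) & q])) =
  colseq c (labelled [::] (p ++ [:: (lz, z), (la, x) & q])).
Proof.
move=> st xq xz; set P := pword [::] (unzip2 p).
have st' : staircase_word (unzip2 p ++ [:: z, x & unzip2 q]).
  apply: (staircase_word_eq st) => [i|].
    by rewrite !wact_cat; congr (wact _ _); have /= -> := wact_comm (wact (unzip2 q) i) xz.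
  by rewrite perm_cat2l; apply: (permEl (perm_catCA [:: z] [:: x] _)).
have v : valid P [:: x; z] := @valid_catl _ [:: x; z] _ (staircase_valid st).
have v' : valid P [:: z; x] := @valid_catl _ [:: z; x] _ (staircase_valid st').
have [_ + _] := st; rewrite all_cat => /and4P[_ xr zr _].
have xz' : x.+1 < z < a + N.-1 by case/andP: zr => _ ->; rewrite xz.
have [e1 e2] := settled_swap v v' (staircase_rowstrict st)
  (staircase_settled st xq) xr xz' (staircase_below st).
have asc := cword_ascent v'.
rewrite -[[:: (la, x), _ & q]]/([:: (la, x); (lz, z)] ++ q).
rewrite -[[:: (lz, z), _ & q]]/([:: (lz, z); (la, x)] ++ q).
rewrite !labelled_cat !colseq_cat -/P /= in e1 e2 *.
rewrite -/P -e1; congr (_ ++ (_ ++ _)).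
move: e2 asc; rewrite /labelled /= => -[ez ex] asc.
rewrite -ez ex /colseq /= in asc *.
have /negbTE ne : eg_col z P != eg_col x P.
  by apply: contraTneq (ltnW xz) => e; rewrite e ltnn in asc; rewrite -asc.
by case: eqP => [<-|_]; case: eqP => [e|_] //=; rewrite ?e ?eqxx // in ne.
Qed.

Lemma wact_past x zs q i : all (ltn x.+1) zs -> wact (zs ++ x :: q) i = wact (x :: zs ++ q) i.
Proof.
move=> zx; rewrite -cat_rcons -cats1 -cat_cons [LHS]wact_cat [RHS]wact_cat.
exact: wact_comm_past.
Qed.

Lemma boxes_move p x zs q la c :
  staircase_word (unzip2 p ++ x :: unzip2 zs ++ unzip2 q) ->
  all (ltn x.+1) (unzip2 zs) -> all (ltn x) (unzip2 q) ->
  colseq c (labelled [::] (p ++ (la, x) :: zs ++ q)) =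
  colseq c (labelled [::] (p ++ zs ++ (la, x) :: q)).
Proof.
elim: zs p => [//|[lz z] zs IH] p /= st /andP[xz xzs] xq.
have zq : all (ltn x) (z :: unzip2 (zs ++ q)).
  rewrite /= (ltnW xz) /unzip2 map_cat all_cat xq andbT.
  by apply: sub_all xzs => b; apply: ltnW.
have st' : staircase_word (unzip2 p ++ [:: x, z & unzip2 (zs ++ q)]).
  by rewrite /unzip2 map_cat.
rewrite (boxes_swap _ _ _ st' zq xz).
rewrite -cat_rcons IH ?cat_rcons //.
rewrite /unzip2 map_rcons cat_rcons; apply: (staircase_word_eq st) => [i|].
  by rewrite !wact_cat; congr (wact _ _); have /= -> := wact_comm (wact (unzip2 zs ++ unzip2 q) i)
    xz.
by rewrite perm_cat2l; apply: (permEl (perm_catCA [:: z] [:: x] _)).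
Qed.

(* Each letter r of [e r] commutes past the later letters of the [A r'], and   *)
(* the swaps do not move any box.                                              *)
Lemma boxes_gather (A e : nat -> seq (nat * nat)) m r0 p c :
  (forall r, r0 <= r -> all (ltn r) (unzip2 (A r))) ->
  (forall r, e r = [::] \/ exists l, e r = [:: (l, r)]) ->
  staircase_word (unzip2 (p ++ flatten [seq A r | r <- iota r0 m] ++
    flatten [seq e r | r <- iota r0 m])) ->
  staircase_word (unzip2 (p ++ flatten [seq A r ++ e r | r <- iota r0 m])) /\
  colseq c (labelled [::] (p ++ flatten [seq A r ++ e r | r <- iota r0 m])) =
  colseq c (labelled [::] (p ++ flatten [seq A r | r <- iota r0 m] ++
    flatten [seq e r | r <- iota r0 m])).
Proof.
move=> hA he; elim: m r0 p hA => [|m IH] r0 p hA st; first by split.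
rewrite /= in st *; set B := flatten [seq A r | r <- iota r0.+1 m] in st *.
set E := flatten [seq e r | r <- iota r0.+1 m] in st *.
have hB : all (ltn r0.+1) (unzip2 B).
  rewrite all_map /B; apply/allP => x /flatten_mapP[r]; rewrite mem_iota => hr.
  by move=> xA; have := hA r; rewrite all_map => /(_ _)/allP/(_ _ xA) /=; slia.
have hE : all (ltn r0) (unzip2 E).
  rewrite all_map /E; apply/allP => x /flatten_mapP[r]; rewrite mem_iota => hr.
  by case: (he r) => [->|[l ->]] //; rewrite inE => /eqP-> /=; slia.
have st' : staircase_word (unzip2 (((p ++ A r0) ++ e r0) ++ B ++ E)).
  case: (he r0) st => [->|[l ->]]; rewrite ?cats0 -!catA //.
  rewrite /unzip2 !map_cat => st; apply: (staircase_word_eq st) => [i|].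
    rewrite [LHS]wact_cat [RHS]wact_cat [X in wact _ X]wact_cat [X in _ = wact _ X]wact_cat.
    by congr (wact _ (wact _ _)); rewrite [RHS]wact_past.
  by rewrite !perm_cat2l /= perm_sym; apply: (permEl (perm_catCA _ [:: r0] _)).
have [|st2 e2] := IH r0.+1 _ _ st'; first by move=> r /ltnW; apply: hA.
rewrite -!catA in st2 e2 st' *; split=> //; rewrite e2.
case: (he r0) st' => [->|[l ->]] st' //=.
rewrite catA boxes_move -?catA //.
by rewrite -map_cat -/(unzip2 _); move: st'; rewrite /unzip2 !map_cat /= -!catA.
Qed.

(** Each letter of w is followed by larger ones only, so by [settled_row] it equals a plus the
    0-based row of its box. *)
Lemma boxes_last p w : staircase_word (p ++ w) -> sorted ltn w -> forall c i,
  i < count_mem c (cword (pword [::] p) w) ->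
  nth 0 (colseq c (zip (cword (pword [::] p) w) w)) i = size (nth [::] (pword [::] p) c) + i + a.
Proof.
elim: w p => [//|x w IH] p st sw c i /=; set P := pword [::] p.
have [xw sw'] : all (ltn x) w /\ sorted ltn w.
  by move: sw; rewrite /= path_sortedE; [case/andP|exact: ltn_trans].
have v1 : valid P [:: x] := @valid_catl _ [:: x] _ (staircase_valid st).
have [_ + _] := st; rewrite all_cat => /and3P[_ xr _].
have row := settled_row v1 (staircase_rowstrict st) (staircase_settled st xw) xr (staircase_below
  st).
have IHw := IH (rcons p x); rewrite cat_rcons -cats1 pword_cat in IHw.
have {}IHw := IHw st sw' c; rewrite /= -/P in IHw.
rewrite /colseq /=; case: eqP => [e|ne] /=; last first.
  by rewrite add0n => /IHw ->; rewrite size_eg_tab; case: eqP => // _; rewrite addn0.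
case: i => [|i]; first by rewrite -e row /=; case/andP: xr; slia.
by rewrite add1n ltnS => /IHw /= ->; rewrite size_eg_tab e eqxx; slia.
Qed.

End Staircase.

(** * Slides and recording tableaux *)

Definition upd (E : nat -> nat -> nat) r c x : nat -> nat -> nat :=
  fun r' c' => if (r' == r) && (c' == c) then x else E r' c'.

Lemma entry_set_entry t r c x : entry (set_entry t r c x) =2 upd (entry t) r c x.
Proof.
move=> r' c'; rewrite /entry /set_entry /upd nth_set_nth /=.
by case: eqP => [->|] //=; rewrite nth_set_nth /=.
Qed.

(** A slide on unbounded entry functions. It also returns the final place of the hole, which decides
    how one more box behaves. *)
Fixpoint fslide m r c (E : nat -> nat -> nat) : (nat -> nat -> nat) * (nat * nat) :=
  if m is m'.+1 then
    let right := E r c.+1 in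
    let below := E r.+1 c in
    if (right == 0) && (below == 0) then (E, (r, c))
    else if (right == 0) || (0 < below <= right) then
      fslide m' r.+1 c (upd (upd E r c below) r.+1 c 0)
    else
      fslide m' r c.+1 (upd (upd E r c right) r c.+1 0)
  else (E, (r, c)).

Lemma upd_ext E E' r c x : E =2 E' -> upd E r c x =2 upd E' r c x.
Proof. by move=> e r' c'; rewrite /upd e. Qed.

Lemma fslide_ext m r c E E' : E =2 E' ->
  (fslide m r c E).1 =2 (fslide m r c E').1 /\ (fslide m r c E).2 = (fslide m r c E').2.
Proof.
elim: m r c E E' => [|m IH] r c E E' e //=; rewrite !e.
by case: ifP => // _; case: ifP => _; apply: IH; do 2!apply: upd_ext.
Qed.

Lemma slide_entry m r c t : entry (slide m r c t) =2 (fslide m r c (entry t)).1.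
Proof.
elim: m r c t => [|m IH] r c t r' c' //=.
case: ifP => // _; case: ifP => _; rewrite IH;
  by apply: (proj1 (fslide_ext _ _ _ _)) => i j; rewrite entry_set_entry; apply: upd_ext;
    exact: entry_set_entry.
Qed.

Definition same_shape (t t' : tableau) : Prop :=
  size t = size t' /\ forall r, size (nth [::] t r) = size (nth [::] t' r).

Lemma tableau_eq t t' : same_shape t t' ->
  (forall r c, c < size (nth [::] t r) -> entry t r c = entry t' r c) -> t = t'.
Proof.
case=> z zr e; apply: (eq_from_nth (x0 := [::]) z) => r _.
by apply: (eq_from_nth (x0 := 0)) => // c; apply: e.
Qed.

Lemma set_entry_shape t r c x : c < size (nth [::] t r) ->
  same_shape (set_entry t r c x) t.
Proof.
move=> h; have rt : r < size t.
  by rewrite ltnNge; apply: contraTN h => h; rewrite nth_default.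
split=> [|r']; rewrite /set_entry ?size_set_nth; first by lia.
by rewrite nth_set_nth /=; case: eqP => // ->; rewrite size_set_nth; lia.
Qed.

Lemma same_shape_trans t1 t2 t3 : same_shape t1 t2 -> same_shape t2 t3 -> same_shape t1 t3.
Proof. by move=> [z h] [z' h']; split=> [|r]; rewrite ?z ?h. Qed.

Lemma entry_in t r c : entry t r c != 0 -> c < size (nth [::] t r).
Proof. by apply: contraNltn => h; rewrite /entry nth_default. Qed.

Lemma slide_shape m r c t : c < size (nth [::] t r) -> same_shape (slide m r c t) t.
Proof.
elim: m r c t => [|m IH] r c t h //=; case: ifP => // h0.
have s1 x := set_entry_shape x h.
case: ifP => h1.
  have h2 x : c < size (nth [::] (set_entry t r c x) r.+1).
    by rewrite (s1 x).2; apply: entry_in; lia.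
  have s2 x y := same_shape_trans (set_entry_shape y (h2 x)) (s1 x).
  by apply: same_shape_trans (IH _ _ _ _) (s2 _ _); rewrite (s2 _ _).2 -(s1 0).2.
have h2 x : c.+1 < size (nth [::] (set_entry t r c x) r).
  by rewrite (s1 x).2; apply: entry_in; lia.
have s2 x y := same_shape_trans (set_entry_shape y (h2 x)) (s1 x).
by apply: same_shape_trans (IH _ _ _ _) (s2 _ _); rewrite (s2 _ _).2 -(s1 0).2.
Qed.

(* No slide can reach the last box before its end. *)
Lemma fslide_add m r c E br bc a K :
  0 < a -> K <= r + c + m -> br + bc < K ->
  (forall i j, E i j != 0 -> i + j < K) ->
  (forall i j, br <= i -> bc <= j -> E i j = 0) -> ~~ ((br <= r) && (bc <= c)) ->
  (forall i j, E i j <= a) -> (forall i j, bc <= j -> E i j < a) ->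
  let S := fslide m r c E in
  let S' := fslide m r c (upd E br bc a) in
  S.1 br bc = 0 /\
  if ((br, bc) == (S.2.1.+1, S.2.2)) || ((br, bc) == (S.2.1, S.2.2.+1))
  then S'.1 =2 upd S.1 S.2.1 S.2.2 a /\ S'.2 = (br, bc)
  else S'.1 =2 upd S.1 br bc a /\ S'.2 = S.2.
Proof.
move=> a0; elim: m r c E => [|m IH] r c E hK hB sup quad nq le lt.
  split; first exact: quad.
  by rewrite /= !xpair_eqE; case: ifP => // h; exfalso; lia.
have qb := quad br bc (leqnn _) (leqnn _).
have stop n (F : nat -> nat -> nat) i j : F i j.+1 = 0 -> F i.+1 j = 0 -> fslide n i j F = (F, (i,
  j)).
  by case: n => //= n -> ->.
have updE (F : nat -> nat -> nat) i j x i' j' : upd F i j x i' j' =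
    if (i' == i) && (j' == j) then x else F i' j' by [].
move=> S; case: (boolP ((E r c.+1 == 0) && (E r.+1 c == 0))) => [/andP[/eqP Er /eqP Eb]|nz].
  have eS : S = (E, (r, c)) by rewrite /S stop.
  rewrite eS /=; split; first exact: qb.
  rewrite !xpair_eqE; case: (boolP ((br == r.+1) && (bc == c))) => [/andP[/eqP e1 /eqP e2]|nb] /=.
    have -> : upd E br bc a r c.+1 = 0 by rewrite e1 e2 updE Er; case: ifP; lia.
    have -> : upd E br bc a r.+1 c = a by rewrite e1 e2 updE !eqxx.
    rewrite eqxx /= ifN; last by lia.
    rewrite stop /=.
    - split=> [i j|]; last by rewrite e1 e2.
      rewrite e1 e2 !updE; do 3?case: ifP => ?; try lia.
      by rewrite -qb; congr E; lia.
    - by rewrite e1 e2 !updE; do 3?case: ifP => ?; try lia; apply: quad; lia.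
    - by rewrite e1 e2 !updE; do 3?case: ifP => ?; try lia; apply: quad; lia.
  case: (boolP ((br == r) && (bc == c.+1))) => [/andP[/eqP e1 /eqP e2]|nr] /=.
    have -> : upd E br bc a r.+1 c = 0 by rewrite e1 e2 updE Eb; case: ifP; lia.
    have -> : upd E br bc a r c.+1 = a by rewrite e1 e2 updE !eqxx.
    rewrite eqxx andbT ltnn /= orbF ifN; last by lia.
    rewrite ifN; last by lia.
    rewrite stop /=.
    - split=> [i j|]; last by rewrite e1 e2.
      rewrite e1 e2 !updE; do 3?case: ifP => ?; try lia.
      by rewrite -qb; congr E; lia.
    - by rewrite e1 e2 !updE; do 3?case: ifP => ?; try lia; apply: quad; lia.
    - by rewrite e1 e2 !updE; do 3?case: ifP => ?; try lia; apply: quad; lia.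
  have -> : upd E br bc a r.+1 c = 0 by rewrite updE Eb; case: ifP => // h; exfalso; lia.
  have -> : upd E br bc a r c.+1 = 0 by rewrite updE Er; case: ifP => // h; exfalso; lia.
  by [].
(* When both slides begin with the same exchange, the hypotheses survive it and the induction
   applies. *)
have go i j : E i j != 0 -> i + j = (r + c).+1 -> c <= j ->
    let E1 := upd (upd E r c (E i j)) i j 0 in
    let E1' := upd (upd (upd E br bc a) r c (E i j)) i j 0 in
    let S := fslide m i j E1 in let S' := fslide m i j E1' in
    S.1 br bc = 0 /\
    if ((br, bc) == (S.2.1.+1, S.2.2)) || ((br, bc) == (S.2.1, S.2.2.+1))
    then S'.1 =2 upd S.1 S.2.1 S.2.2 a /\ S'.2 = (br, bc)
    else S'.1 =2 upd S.1 br bc a /\ S'.2 = S.2.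
  move=> nE eij cj E1 E1' S1 S1'.
  have nij : ~~ ((br <= i) && (bc <= j)).
    by apply: contraNN nE => /andP[h1 h2]; rewrite quad.
  have e1 : E1' =2 upd E1 br bc a.
    move=> i' j'; rewrite /E1' /E1 !updE.
    by do 3?case: ifP => ?; try lia.
  have [ee1 ee2] := fslide_ext m i j e1.
  have [|||||h1 h2] := IH i j E1 _ hB _ _ nij.
  - by lia.
  - move=> i' j'; rewrite /E1 !updE; case: ifP => [//|_].
    by case: ifP => [h _|_]; [have := sup _ _ nE; lia | apply: sup].
  - move=> i' j' hi hj; rewrite /E1 !updE; case: ifP => [//|_].
    by case: ifP => [h|_]; [lia | apply: quad].
  - by move=> i' j'; rewrite /E1 !updE; case: ifP => [//|_]; case: ifP.
  - move=> i' j' hj; rewrite /E1 !updE; case: ifP => [//|_].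
    by case: ifP => [h|_]; apply: lt; lia.
  split; first exact: h1.
  by move: h2; rewrite -/S1; case: ifP => _ [h2 h3];
    (split; [move=> i' j'; rewrite ee1 h2 | rewrite ee2 h3]).
rewrite /S; move: go; set E2 := upd E br bc a => go.
rewrite [fslide _ _ _ E]/= [fslide _ _ _ E2]/= (negbTE nz).
case: (boolP ((br == r.+1) && (bc == c))) => [/andP[/eqP e1 /eqP e2]|nb].
  have Eb : E r.+1 c = 0 by rewrite -e1 -e2.
  have Er : E r c.+1 != 0 by move: nz; rewrite Eb andbT.
  have -> : E2 r c.+1 = E r c.+1 by rewrite /E2 updE ifN //; lia.
  have -> : E2 r.+1 c = a by rewrite /E2 e1 e2 updE !eqxx.
  have lta : E r c.+1 < a by apply: lt; lia.
  rewrite Eb (negbTE Er) /= a0 leqNgt lta /=.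
  by apply: go => //; lia.
case: (boolP ((br == r) && (bc == c.+1))) => [/andP[/eqP e1 /eqP e2]|nr].
  have Er : E r c.+1 = 0 by rewrite -e1 -e2.
  have Eb : E r.+1 c != 0 by move: nz; rewrite Er.
  have -> : E2 r.+1 c = E r.+1 c by rewrite /E2 updE ifN //; lia.
  have -> : E2 r c.+1 = a by rewrite /E2 e1 e2 updE !eqxx.
  rewrite Er eqxx /= (negbTE Eb) andbF lt0n Eb le orbT.
  by apply: go => //; lia.
have -> : E2 r.+1 c = E r.+1 c by rewrite /E2 updE ifN //; lia.
have -> : E2 r c.+1 = E r c.+1 by rewrite /E2 updE ifN //; lia.
rewrite (negbTE nz); case: ifP => h.
  by apply: go => //; lia.
by apply: go => //; lia.
Qed.

Definition box_entry (l : seq (nat * nat)) : nat -> nat -> nat :=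
  fun r c => nth 0 (colseq c l) r.

Lemma box_entry_rcons l c a : box_entry (rcons l (c, a)) =2 upd (box_entry l) (count_mem c (unzip1
  l)) c a.
Proof.
move=> i j; rewrite /box_entry /upd -cats1 colseq_cat.
have -> : colseq j [:: (c, a)] = if c == j then [:: a] else [::].
  by rewrite /colseq /=; case: eqP.
case: (c =P j) => [->|ne]; last first.
  by rewrite cats0 [X in _ && X](_ : _ = false) ?andbF //; apply/eqP => e; apply: ne.
rewrite eqxx andbT nth_cat -size_colseq; case: ltnP => h; first by rewrite ltn_eqF.
case: (i =P _) => [->|ne]; first by rewrite subnn.
by rewrite nth_default /= ?nth_default //; lia.
Qed.

Fixpoint jhole (u : seq nat) (h : nat) (c : seq nat) : nat :=
  if c is x :: c' then jhole (rcons u (jout u h x)) (jnext u h x) c' else h.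

Lemma jdt_rcons u h c x :
  jdt u h (rcons c x) = rcons (jdt u h c) (jout (u ++ jdt u h c) (jhole u h c) x).
Proof.
elim: c u h => [|y c IH] u h /=; first by rewrite cats0.
by rewrite IH cat_rcons.
Qed.

Lemma jhole_rcons u h c x :
  jhole u h (rcons c x) = jnext (u ++ jdt u h c) (jhole u h c) x.
Proof.
elim: c u h => [|y c IH] u h /=; first by rewrite cats0.
by rewrite IH cat_rcons.
Qed.

Lemma jdt_final u h c : dominant u -> yext (rcons u h) c ->
  dominant (u ++ jdt u h c) /\
  perm_eq (rcons (u ++ jdt u h c) (jhole u h c)) (u ++ h :: c).
Proof.
elim: c u h => [|x c IH] u h du y /=; first by rewrite cats0 -cats1.
have [d1 y1] := jstep du y; have [d2 p2] := IH _ _ d1 y1.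
rewrite -cat_rcons; split=> //; apply: perm_trans p2 _.
rewrite cat_rcons perm_cat2l /jout /jnext; case: ifP => [/andP[/eqP-> _]|_] //.
exact: (permEl (perm_catCA [:: x] [:: h] c)).
Qed.

(** Equal labels count from left to right: in a tie the slide takes the lower neighbour, which lies
    further left than the right one. *)
Definition box_lt (p q : nat * nat) := (p.2 < q.2) || (p.2 == q.2) && (p.1 < q.1).

Lemma box_entry_all (p : nat -> pred nat) l i j : (forall c, p c 0) ->
  all (fun q => p q.1 q.2) l -> p j (box_entry l i j).
Proof.
move=> p0 al; rewrite /box_entry; set s := colseq j l.
case: (ltnP i (size s)) => h; last by rewrite nth_default.
have := mem_nth 0 h; rewrite /s => /mapP[q]; rewrite mem_filter => /andP[/eqP<- ql] ->.
exact: (allP al).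
Qed.

Lemma dominant_leq u i j : dominant u -> i <= j -> count_mem j u <= count_mem i u.
Proof.
move=> d /subnK <-; elim: (j - i) => // m IH.
by rewrite addSn; apply: leq_trans (d _) IH.
Qed.

Lemma yext_total p c : yext p c -> dominant (p ++ c).
Proof. by rewrite -{1}[c]cats0 => /yext_cat_dominant. Qed.

(** The boxes of v are appended in the order of their labels: by [fslide_add] the newest one takes
    part only in the last exchange of the slide, as [jmove] prescribes. The boxes of l0 are the
    holes still waiting for their own slide. *)
Lemma slide_jdt m K l0 h0 v :
  let u0 := unzip1 l0 in let E := box_entry (l0 ++ (h0, 0) :: v) in
  dominant u0 -> yext (rcons u0 h0) (unzip1 v) ->
  K <= count_mem h0 u0 + h0 + m ->
  (forall j, 0 < count_mem j (u0 ++ h0 :: unzip1 v) ->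
     count_mem j (u0 ++ h0 :: unzip1 v) + j <= K) ->
  all (fun q => q.2 == 0) l0 -> all (fun q => 0 < q.2) v -> pairwise box_lt v ->
  let S := fslide m (count_mem h0 u0) h0 E in
  S.1 =2 box_entry (l0 ++ zip (jdt u0 h0 (unzip1 v)) (unzip2 v)) /\
  S.2 = (count_mem (jhole u0 h0 (unzip1 v)) (u0 ++ jdt u0 h0 (unzip1 v)),
         jhole u0 h0 (unzip1 v)).
Proof.
move=> u0 E du; rewrite {}/E; elim/last_ind: v => [|v [x a] IH].
  move=> /= y hK hB z0 _ _; rewrite cats0.
  have hE i j : box_entry (l0 ++ [:: (h0, 0)]) i j = 0.
    apply/eqP; apply: (@box_entry_all (fun _ b => b == 0)) => //.
    by rewrite all_cat z0.
  rewrite (_ : fslide _ _ _ _ = (box_entry (l0 ++ [:: (h0, 0)]), (count_mem h0 u0, h0))).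
    split=> [i j|/=]; last by rewrite cats0.
    rewrite /= hE; apply/esym/eqP.
    by apply: (@box_entry_all (fun _ b => b == 0)).
  by case: m {hK} => //= m; rewrite !hE.
rewrite /unzip1 /unzip2 !map_rcons -/(unzip1 v) -/(unzip2 v) => y hK hB z0 pv ov.
set c := unzip1 v in IH y hB *.
move: ov pv; rewrite pairwise_rcons all_rcons => /andP[al ov] /andP[/= a0 pv].
have dfull : dominant (u0 ++ h0 :: rcons c x) by rewrite -cat_rcons; apply: yext_total.
have [yc _] : yext (rcons u0 h0) c /\ yext (rcons u0 h0 ++ c) [:: x].
  by apply/yext_cat; rewrite cats1.
have dpre : dominant (u0 ++ h0 :: c) by rewrite -cat_rcons; apply: yext_total.
have cnt j : count_mem j (u0 ++ h0 :: rcons c x) = count_mem j (u0 ++ h0 :: c) + (x == j).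
  by rewrite -count_rcons rcons_cat.
have hB' j : 0 < count_mem j (u0 ++ h0 :: c) -> count_mem j (u0 ++ h0 :: c) + j <= K.
  by move=> h; have := hB j; rewrite cnt; lia.
have {IH} [IH1 IH2] := IH yc hK hB' z0 pv ov.
set E := box_entry (l0 ++ (h0, 0) :: v) in IH1 IH2.
set br := count_mem x (u0 ++ h0 :: c).
have sz j : size (colseq j (l0 ++ (h0, 0) :: v)) = count_mem j (u0 ++ h0 :: c).
  by rewrite size_colseq /unzip1 map_cat.
have E' : box_entry (l0 ++ (h0, 0) :: rcons v (x, a)) =2 upd E br x a.
  move=> i j; rewrite -rcons_cons -rcons_cat box_entry_rcons.
  by rewrite (_ : count_mem x _ = br) // /unzip1 map_cat.
have [e1 e2] := fslide_ext m (count_mem h0 u0) h0 E'.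
have hBx := hB x; rewrite cnt eqxx addn1 in hBx.
have bK : br + x < K by apply: hBx.
have sup i j : E i j != 0 -> i + j < K.
  move=> h; have : i < count_mem j (u0 ++ h0 :: c).
    by rewrite -sz ltnNge; apply: contraNN h => h; rewrite /E /box_entry nth_default.
  by move=> h1; have := hB' j (leq_ltn_trans (leq0n _) h1); lia.
have quad i j : br <= i -> x <= j -> E i j = 0.
  move=> h1 h2; rewrite /E /box_entry nth_default // sz.
  by apply: leq_trans (dominant_leq dpre h2) h1.
have nq : ~~ ((br <= count_mem h0 u0) && (x <= h0)).
  apply/negP => /andP[h1 h2].
  have lth : count_mem h0 u0 < count_mem h0 (u0 ++ h0 :: c).
    by rewrite count_cat -addn1 leq_add2l /= eqxx.
  by have := leq_trans lth (leq_trans (dominant_leq dpre h2) h1); rewrite ltnn.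
have le i j : E i j <= a.
  apply: (@box_entry_all (fun _ b => b <= a)) => //; rewrite all_cat /=.
  apply/andP; split; first by apply: sub_all z0 => q /eqP->.
  by apply: sub_all al => q; rewrite /box_lt /=; lia.
have lt i j : x <= j -> E i j < a.
  apply/implyP; apply: (@box_entry_all (fun j b => (x <= j) ==> (b < a))).
    by move=> c'; rewrite a0 implybT.
  rewrite all_cat /= a0 implybT /=; apply/andP; split.
    by apply: sub_all z0 => q /eqP->; rewrite a0 implybT.
  by apply: sub_all al => q; rewrite /box_lt /= => h; apply/implyP; lia.
have := fslide_add a0 hK bK sup quad nq le lt.
cbv zeta; rewrite IH2 /= {IH2} => -[_ add].
have [du' pu] := jdt_final du yc.
set u := u0 ++ jdt u0 h0 c in du' pu add *; set h := jhole u0 h0 c in pu add *.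
have ebr : br = count_mem x u + (h == x).
  by rewrite /br -(permP pu) count_rcons.
have res y1 : zip (rcons (jdt u0 h0 c) y1) (rcons (unzip2 v) a) =
    rcons (zip (jdt u0 h0 c) (unzip2 v)) (y1, a).
  by rewrite zip_rcons // size_jdt /c /unzip1 /unzip2 !size_map.
rewrite jdt_rcons jhole_rcons -/u -/h res -rcons_cat.
have cols : unzip1 (l0 ++ zip (jdt u0 h0 c) (unzip2 v)) = u.
  by rewrite /unzip1 map_cat -/(unzip1 l0) -/(unzip1 (zip _ _)) unzip1_zip // size_jdt /c /unzip1
    /unzip2 !size_map.
have conv R c' : box_entry (l0 ++ zip (jdt u0 h0 c) (unzip2 v)) =2 (fslide m (count_mem h0 u0) h0
  E).1 ->
    upd (fslide m (count_mem h0 u0) h0 E).1 R c' a =2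
    upd (box_entry (l0 ++ zip (jdt u0 h0 c) (unzip2 v))) R c' a.
  by move=> ee; apply: upd_ext => i j; rewrite ee.
have {}conv R c' := conv R c' (fun i j => esym (IH1 i j)).
rewrite /jout /jnext; move: add; rewrite !xpair_eqE.
case: (jmoveP u h x) => [[ex eh]|nm].
  rewrite (_ : (br == _) && (x == h) = false) /=; last by lia.
  have hh : (h == h.+1) = false by lia.
  have brh : br = count_mem h u by rewrite ebr ex eh hh addn0.
  rewrite (_ : (br == _) && (x == h.+1) = true) => [[f1 f2]|]; last by rewrite brh ex !eqxx.
  split=> [i j|]; first by rewrite e1 f1 conv box_entry_rcons cols.
  by rewrite e2 f2 -cats1 catA cats1 count_rcons brh ex -eh hh addn0.
have -> : ((br == (count_mem h u).+1) && (x == h)) || ((br == count_mem h u) && (x == h.+1)) = (x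
  == h).
  case: (x =P h) => [exh|nxh]; first by rewrite ebr exh eqxx; lia.
  rewrite andbF /=; apply/negbTE/negP => /andP[/eqP b1 /eqP b2]; apply: nm.
  by split=> //; rewrite -b1 ebr b2; lia.
case: (x =P h) => [exh|nxh] [f1 f2].
  split=> [i j|]; first by rewrite e1 f1 conv box_entry_rcons cols exh.
  by rewrite e2 f2 -cats1 catA cats1 count_rcons ebr exh eqxx.
split=> [i j|].
  by rewrite e1 f1 conv box_entry_rcons cols ebr (_ : (h == x) = false) ?addn0 //; lia.
by rewrite e2 f2 -cats1 catA cats1 count_rcons (_ : (x == h) = false) ?addn0 //; lia.
Qed.

Lemma eg_insert_row x P : (eg_insert x P).2.1 = size (nth [::] P (eg_col x P)).
Proof.
elim: P x => [|C P IH] x //; rewrite /eg_col eg_insert_cons.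
by case: (cstep x C).2 => [y|] //=; rewrite IH.
Qed.

Definition recorded (P : seq (seq nat)) (t : tableau) l : Prop :=
  [/\ entry t =2 box_entry l, forall c, size (colseq c l) = size (nth [::] P c),
    forall r c, (c < size (nth [::] t r)) = (r < size (nth [::] P c)) &
    size t = size (nth [::] P 0)].

Lemma rowstrict_size P i j : rowstrict P -> i <= j ->
  size (nth [::] P j) <= size (nth [::] P i).
Proof.
move=> rP /subnK <-; elim: (j - i) => // m IH.
by rewrite addSn; apply: leq_trans (rP _).1 IH.
Qed.

Lemma recorded_fold s P t l : rowstrict P -> valid P (unzip2 s) -> recorded P t l ->
  recorded (pword P (unzip2 s)) (foldl eg_step (P, t) s).2 (l ++ labelled P s).
Proof.
elim: s P t l => [|[a b] s IH] P t l rP v [e z sh st] /=; first by rewrite cats0.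
have v1 : valid P [:: b] := @valid_catl P [:: b] _ v.
have eg : eg_step (P, t) (a, b) =
    (eg_tab b P, set_entry t (size (nth [::] P (eg_col b P))) (eg_col b P) a).
  by rewrite /eg_step /= -eg_insert_row /eg_tab /eg_col; case: eg_insert => P' [r c].
have rP' := rowstrict_eg_tab v1 rP.
rewrite eg /labelled /= -cat_rcons -/(labelled _ _).
apply: IH => //; first exact: (@valid_pword P [:: b]).
have hz c : count_mem c (unzip1 l) = size (nth [::] P c) by rewrite -size_colseq z.
split=> [r c|c|r c|].
- by rewrite entry_set_entry box_entry_rcons hz; apply: upd_ext.
- by rewrite size_colseq /unzip1 map_rcons count_rcons -/(unzip1 l) hz size_eg_tab.
- rewrite /set_entry nth_set_nth /= size_eg_tab.
  case: (r =P _) => [->|nr]; last first.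
    by rewrite sh; case: (eg_col b P =P c) => [ec|_]; [rewrite -ec; lia | rewrite addn0].
  rewrite size_set_nth leq_max ltnS sh.
  case: (eg_col b P =P c) => [ec|nc]; first by rewrite -ec leqnn addn1 ltnSn.
  rewrite addn0; case: (leqP c (eg_col b P)) => //= h; apply/esym.
  have hc : c < eg_col b P by rewrite ltn_neqAle h andbT; apply/eqP => ee; apply: nc.
  have := rowstrict_size rP' h; rewrite !size_eg_tab eqxx.
  by case: eqP => // _; rewrite addn0 addn1.
- rewrite /set_entry size_set_nth st size_eg_tab.
  case: (eg_col b P =P 0) => [->|ne]; first by lia.
  have := rowstrict_size rP' (leq0n (eg_col b P)); rewrite !size_eg_tab eqxx.
  by case: eqP => // _; lia.
Qed.

Lemma recording_recorded s : reduced (unzip2 s) ->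
  recorded (pword [::] (unzip2 s)) (recording s) (labelled [::] s).
Proof.
move=> r; apply: (@recorded_fold s [::] [::] [::]) => //.
split=> [i j|c|i j|] //; rewrite ?nth_nil //.
by rewrite /entry !nth_nil /box_entry nth_nil.
Qed.

(** The hole runs through the other boxes of the first row, so the slide from the corner becomes one
    that starts at the last of the 1s. *)
Lemma jdt_iota i m d : jdt (iota 0 i) i (iota i.+1 m ++ d) =
  iota i m ++ jdt (iota 0 (i + m)) (i + m) d.
Proof.
elim: m i => [|m IH] i /=; first by rewrite addn0.
have mv : jmove (iota 0 i) i i.+1.
  by apply/jmoveP; split=> //; apply/eqP; rewrite eq_sym; apply/eqP;
    rewrite !(count_memPn _) // mem_iota; lia.
rewrite /jout /jnext mv (_ : rcons (iota 0 i) i = iota 0 i.+1) ?IH ?addSnnS //.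
by rewrite -cats1 -addn1 iotaD.
Qed.

Lemma cword_row (s : seq nat) x : path ltn x s ->
  eg_insert x [seq [:: y] | y <- s] = ([seq [:: y] | y <- x :: s], (0, size s)).
Proof.
elim: s x => [|y s IH] x //= /andP[xy ys].
by rewrite xy /= inE (ltn_eqF xy) andbF IH.
Qed.

Lemma cword_decreasing s u : sorted gtn (rev s ++ u) ->
  cword [seq [:: y] | y <- s] u = iota (size s) (size u).
Proof.
elim: u s => [|x u IH] s //= so.
have xs : path ltn x s.
  move: so; rewrite -cat_rcons -rev_cons => /cat_sorted2[so _].
  by move: so; rewrite rev_sorted.
rewrite /eg_col /eg_tab cword_row //= (IH (x :: s)) //=.
by rewrite rev_cons cat_rcons.
Qed.

(** The tableau between two slides of promotion: the letters of u stand for the holes that remain in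
    the first row. *)
Definition slide_stage u V := zip (iota 0 (size u)) (nseq (size u) 0) ++ labelled (pword [::] u) V.

Definition biword_lt (p q : nat * nat) := (p.1 < q.1) || (p.1 == q.1) && (q.2 < p.2).

Lemma box_lt_trans : transitive box_lt.
Proof. by move=> [a b] [c d] [e f]; rewrite /box_lt /=; lia. Qed.

Lemma pairwise_labelled P V : valid P (unzip2 V) -> sorted biword_lt V ->
  pairwise box_lt (labelled P V).
Proof.
move=> v sV; rewrite -(sorted_pairwise box_lt_trans).
elim: V P v sV => [|[a b] [|[a' b'] V] IH] P v //= /andP[h sV].
have v1 : valid P [:: b; b'] := @valid_catl P [:: b; b'] _ v.
have := IH (eg_tab b P) (@valid_pword P [:: b] _ v) sV => /= ->; rewrite andbT.
by move: h; rewrite /box_lt /biword_lt /= cword_ascent // eq_sym.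
Qed.

Lemma reduced_yext w : reduced w -> yext [::] (cword [::] w).
Proof. by move=> r; apply: yext_cword => //; case. Qed.

(** The slide from the rightmost hole amounts to deleting the first letter of u: [cword_behead] and
    [jdt_iota] describe the columns after the deletion, and [slide_jdt] the slide itself. *)
Lemma slides_stage F K V u (t : tableau) :
  reduced (u ++ unzip2 V) -> sorted gtn u -> sorted biword_lt V ->
  all (fun q => 0 < q.1) V -> K <= F ->
  (forall j, 0 < count_mem j (cword [::] (u ++ unzip2 V)) ->
     count_mem j (cword [::] (u ++ unzip2 V)) + j <= K) ->
  (forall j, j < size u -> j < size (nth [::] t 0)) ->
  entry t =2 box_entry (slide_stage u V) ->
  let t' := foldl (fun t c => slide F 0 c t) t (rev (iota 0 (size u))) in
  entry t' =2 box_entry (labelled [::] V) /\ same_shape t' t.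
Proof.
elim: u t => [|x u IH] t r su sV pV KF hK ht et t'; first by split.
rewrite /t' {t'} -[size (x :: u)]/(size u).+1 -addn1 iotaD rev_cat /= add0n.
set m := size u; have vV : valid (pword [::] (x :: u)) (unzip2 V).
  by apply: valid_pword; split.
have yfull := reduced_yext r.
have ecw : cword [::] (x :: u ++ unzip2 V) =
    iota 0 m.+1 ++ cword (pword [::] (x :: u)) (unzip2 V).
  by rewrite -cat_cons cword_cat (cword_decreasing (s := [::])).
rewrite -[_ ++ _]/(x :: u ++ unzip2 V) ecw in hK yfull.
set d := cword (pword [::] (x :: u)) (unzip2 V) in ecw hK yfull.
have r' : reduced (u ++ unzip2 V) := @reduced_catr [:: x] _ r.
have su' : sorted gtn u := path_sorted su.
have ecw' : cword [::] (u ++ unzip2 V) = iota 0 m ++ jdt (iota 0 m) m d.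
  rewrite (cword_behead r) (_ : cword _ _ = iota 1 m ++ d) ?(@jdt_iota 0 m d) //.
  by case: ecw => h; exact: h.
have dd : cword (pword [::] u) (unzip2 V) = jdt (iota 0 m) m d.
  move: ecw'; rewrite cword_cat (cword_decreasing (s := [::])) //=.
  by move/eqP; rewrite eqseq_cat // => /andP[_ /eqP].
have iS : iota 0 m.+1 = rcons (iota 0 m) m by rewrite -addn1 iotaD cats1.
rewrite iS in yfull hK.
have [_ ydm] : yext [::] (rcons (iota 0 m) m) /\ yext (rcons (iota 0 m) m) d.
  by move: yfull => /yext_cat.
have du : dominant (iota 0 m).
  by move: yfull; rewrite -cats1 -catA => /yext_cat_dominant.
set l0 := zip (iota 0 m) (nseq m 0); set v := labelled (pword [::] (x :: u)) V.
have u1 : unzip1 l0 = iota 0 m by rewrite /l0 unzip1_zip // size_iota size_nseq.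
have v1 : unzip1 v = d by rewrite unzip1_labelled.
have cm : count_mem m (iota 0 m) = 0 by apply/count_memPn; rewrite mem_iota; lia.
have es : slide_stage (x :: u) V = l0 ++ (m, 0) :: v.
  rewrite /slide_stage -[size (x :: u)]/m.+1 iS -addn1 nseqD -cats1 zip_cat;
    last by rewrite size_iota size_nseq.
  by rewrite -catA.
have hm : m < size (nth [::] t 0) by apply: ht.
have := @slide_jdt F K l0 m v; cbv zeta; rewrite u1 v1 cm -es => /(_ du ydm).
case=> [|||||f1 _].
- by lia.
- by move=> j; rewrite -cat_rcons; apply: hK.
- rewrite -(all_map snd (fun y => y == 0)) -/(unzip2 l0) unzip2_zip ?size_iota ?size_nseq //.
  by rewrite all_nseq orbT.
- rewrite -(all_map snd (fun y => 0 < y)) -/(unzip2 v) unzip2_zip ?size_cword ?size_map //.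
  by rewrite all_map.
- exact: pairwise_labelled.
have e1 : entry (slide F 0 m t) =2 box_entry (slide_stage u V).
  move=> i j; rewrite slide_entry (proj1 (fslide_ext _ _ _ et)) f1.
  by rewrite /slide_stage -/l0 /labelled dd /v unzip2_zip // size_cword !size_map.
have sh := slide_shape F hm.
have [||h1 h2] := IH (slide F 0 m t) r' su' sV pV KF _ _ e1.
- have [_ p] := jdt_final du ydm.
  move=> j; rewrite ecw' => h; have := hK j; rewrite cat_rcons -(permP p) count_rcons.
  by move: h; move: (count_mem j _) => z; lia.
- by move=> j jm; rewrite sh.2; apply: ht; apply: ltnW.
by split=> //; apply: same_shape_trans h2 sh.
Qed.

Lemma entry_delete_ones t r c :
  entry (delete_ones t) r c = if entry t r c == 1 then 0 else entry t r c.
Proof.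
rewrite /entry /delete_ones; case: (ltnP r (size t)) => h; last first.
  by rewrite !(nth_default [::]) ?size_map // !nth_nil.
rewrite (nth_map [::]) //; case: (ltnP c (size (nth [::] t r))) => h'.
  by rewrite (nth_map 0).
by rewrite !(nth_default 0) ?size_map.
Qed.

Lemma delete_ones_shape t : same_shape (delete_ones t) t.
Proof.
split=> [|r]; first by rewrite size_map.
case: (ltnP r (size t)) => h; first by rewrite (nth_map [::]) // size_map.
by rewrite !nth_default ?size_map.
Qed.

Lemma entry_relabel k t r c : c < size (nth [::] t r) ->
  entry (relabel k t) r c = if entry t r c == 0 then r.+1 + k else (entry t r c).-1.
Proof.
move=> h; have rt : r < size t.
  by rewrite ltnNge; apply: contraTN h => h; rewrite nth_default.
by rewrite /entry /relabel nth_mkseq // (nth_map 0).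
Qed.

Lemma relabel_shape k t : same_shape (relabel k t) t.
Proof.
split=> [|r]; first by rewrite size_mkseq.
case: (ltnP r (size t)) => h; first by rewrite nth_mkseq // size_map.
by rewrite !nth_default ?size_mkseq.
Qed.

Lemma colseq_zip_iota m x c :
  colseq c (zip (iota 0 m) (nseq m x)) = if c < m then [:: x] else [::].
Proof.
elim: m => [|m IH] //; rewrite -addn1 iotaD nseqD zip_cat ?size_iota ?size_nseq //.
rewrite colseq_cat IH /colseq /= add0n addn1 ltnS.
by case: (ltngtP c m) => // [h|->]; rewrite ?eqxx // ?gtn_eqF ?ltn_eqF.
Qed.

Lemma promotion_entries a N k u V :
  let s := [seq (1, b) | b <- u] ++ V in let t := recording s in
  staircase_word a N (unzip2 s) -> sorted gtn u -> sorted biword_lt V ->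
  all (fun q => 1 < q.1) V ->
  same_shape (promotion k t) t /\
  forall r c, r + c < N.-1 -> entry (promotion k t) r c =
    if r < count_mem c (cword [::] (unzip2 V)) then (box_entry (labelled [::] V) r c).-1
    else r.+1 + k.
Proof.
move=> s t st su sV lV; have [red rng sz] := st.
have [et zt sht szt] := recording_recorded red.
have us : unzip2 s = u ++ unzip2 V.
  by rewrite /s /unzip2 map_cat -map_comp map_id.
have stP := staircase_pword red rng sz.
have rowt r c : (c < size (nth [::] t r)) = (r + c < N.-1).
  by rewrite sht stP size_iota; lia.
have Vn P c x : x <= 1 -> x \notin colseq c (labelled P V).
  move=> x1; apply/mapP => -[q]; rewrite mem_filter => /andP[_ qV] e.
  have : q.2 \in unzip2 (labelled P V) by apply: map_f.
  rewrite unzip2_zip ?size_cword ?size_map // => /mapP[p pV e'].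
  by have := allP lV _ pV; rewrite -e' -e ltnNge x1.
have V1 := fun c => Vn (pword [::] u) c 1 isT.
set m := size u.
have ls : labelled [::] s = zip (iota 0 m) (nseq m 1) ++ labelled (pword [::] u) V.
  rewrite labelled_cat; congr (_ ++ _); last by rewrite /unzip2 -map_comp map_id.
  rewrite /labelled /unzip2 /unzip1 -!map_comp map_id (cword_decreasing (s := [::])) //.
  by congr zip; rewrite -/m /m; elim: (u) => //= ? ? ->.
have ed : entry (delete_ones t) =2 box_entry (slide_stage u V).
  move=> r c; rewrite entry_delete_ones et /box_entry ls /slide_stage !colseq_cat !colseq_zip_iota
    -/m.
  have N1 i : (nth 0 (colseq c (labelled (pword [::] u) V)) i == 1) = false.
    apply/negP => /eqP e; case: (ltnP i (size (colseq c (labelled (pword [::] u) V)))) => h.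
      by have := V1 c; rewrite -e mem_nth.
    by move: e; rewrite nth_default.
  by case: (ltnP c m) => cm; case: r => [|r] //=; rewrite N1.
have yfull := reduced_yext red; rewrite us cword_cat (cword_decreasing (s := [::])) //= -/m in
  yfull.
have heights c : count_mem c (cword [::] (unzip2 s)) = N.-1 - c.
  by have := size_pword [::] (unzip2 s) c; rewrite stP size_iota nth_nil.
have mN : m <= N.-1.
  rewrite leqNgt; apply/negP => h; have := heights N.-1; rewrite subnn us cword_cat count_cat.
  rewrite (cword_decreasing (s := [::])) //= -/m => /eqP; rewrite addn_eq0 => /andP[+ _].
  by move/eqP/count_memPn; rewrite mem_iota; lia.
have row0 : size (nth [::] (delete_ones t) 0) = N.-1.
  rewrite (delete_ones_shape t).2; apply/eqP; rewrite eqn_leq.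
  have := rowt 0 N.-1; have := rowt 0 (size (nth [::] t 0)); lia.
have holes : [seq c <- iota 0 (size (nth [::] (delete_ones t) 0)) |
    entry (delete_ones t) 0 c == 0] = iota 0 m.
  rewrite row0 (eq_in_filter (a2 := fun c => c < m)); last first.
    move=> c; rewrite mem_iota /= add0n => cN; rewrite ed /box_entry /slide_stage colseq_cat
      colseq_zip_iota -/m.
    case: (ltnP c m) => cm //=.
    have := zt c; rewrite stP size_iota ls colseq_cat colseq_zip_iota ltnNge cm /= => z.
    apply/negP => /eqP e; have := Vn (pword [::] u) c 0 isT.
    by rewrite -e mem_nth // z; lia.
  rewrite -(subnKC mN) iotaD filter_cat [X in _ ++ X](_ : _ = [::]) ?cats0.
    by apply/all_filterP/allP => c; rewrite mem_iota.
  by apply/eqP; rewrite -(negbK (_ == _)) -has_filter; apply/hasPn => c; rewrite mem_iota; lia.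
(* The first row alone has N-1 boxes, so the number of boxes is enough fuel to reach the outer
   antidiagonal. *)
have KF : N.-1 <= sumn (shape (delete_ones t)).
  rewrite -row0; case: (delete_ones t) => [|row t0] //=.
  exact: leq_addr.
have [||||e1 sh1] := slides_stage (F := sumn (shape (delete_ones t))) (u := u)
    (V := V) (K := N.-1) _ su sV _ KF _ _ ed.
- by rewrite -us.
- by apply: sub_all lV => q; apply: ltnW.
- by move=> j; rewrite -us heights; lia.
- by move=> j jm; rewrite row0; apply: leq_trans jm mN.
have shJ : same_shape (jeu_de_taquin (delete_ones t)) t.
  rewrite /jeu_de_taquin holes; apply: same_shape_trans sh1 (delete_ones_shape t).
split=> [|r c rc]; first exact: same_shape_trans (relabel_shape _ _) shJ.
rewrite /promotion entry_relabel; last by rewrite shJ.2 rowt.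
rewrite /jeu_de_taquin holes !e1 -unzip1_labelled -size_colseq /box_entry.
case: (ltnP r (size (colseq c (labelled [::] V)))) => h; last by rewrite nth_default.
rewrite ifN //; apply/negP => /eqP e; have := Vn [::] c 0 isT.
by rewrite -e mem_nth.
Qed.

(** * Promotion of the recording tableau *)

Definition block_rev n k i := if k < i <= n - k then n.+1 - i else i.

Lemma sw_block_rev n k x i : k < x < n - k ->
  sw x (block_rev n k i) = block_rev n k (sw (n - x) i).
Proof.
move=> h; rewrite /block_rev.
case: (swP (n - x) i) => [[-> ->]|[-> ->]|[h1 h2 ->]].
- rewrite !ifT; try lia.
  by case: (swP x (n.+1 - (n - x))) => [[h1 ->]|[h1 ->]|[h1 h2 _]]; lia.
- rewrite !ifT; try lia.
  by case: (swP x (n.+1 - (n - x).+1)) => [[h1 ->]|[h1 ->]|[h1 h2 _]]; lia.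
- case: ifP => h3.
    by case: (swP x (n.+1 - i)) => [[h4 ->]|[h4 ->]|[h4 h5 ->]]; lia.
  by case: (swP x i) => [[h4 ->]|[h4 ->]|[h4 h5 ->]]; lia.
Qed.

Lemma wact_revK u i : wact (rev u) (wact u i) = i.
Proof.
elim: u i => //= x u IH i; rewrite rev_cons -cats1 wact_cat /=.
by rewrite swK IH.
Qed.

(** With w0 = u v and u' the word u with each x replaced by n - x, one has w0 u' = u w0, hence v u'
    = u^-1 w0 u' = w0. *)
Lemma wact_rotate n k u v : all (fun x => k < x < n - k) u ->
  wact (u ++ v) =1 block_rev n k ->
  wact (v ++ [seq n - x | x <- u]) =1 block_rev n k.
Proof.
move=> uk e i; rewrite wact_cat -[wact v _](wact_revK u) -(wact_cat u v) e.
suff -> : block_rev n k (wact [seq n - x | x <- u] i) = wact u (block_rev n k i).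
  exact: wact_revK.
elim: u uk {e} i => //= x u IH /andP[xk uk] i.
by rewrite -IH // sw_block_rev.
Qed.

Lemma staircase_shape a N s s' : staircase_word a N (unzip2 s) -> staircase_word a N (unzip2 s') ->
  same_shape (recording s) (recording s') /\
  forall r c, (c < size (nth [::] (recording s) r)) = (r + c < N.-1).
Proof.
have H w : staircase_word a N (unzip2 w) -> size (recording w) = N.-1 /\
    forall r c, (c < size (nth [::] (recording w) r)) = (r + c < N.-1).
  case=> r rg z; have [_ _ h ->] := recording_recorded r.
  split=> [|i j]; first by rewrite (staircase_pword r rg z) size_iota subn0.
  by rewrite h (staircase_pword r rg z) size_iota; lia.
move=> /H[z1 h1] /H[z2 h2]; split=> //; split=> [|r]; first by rewrite z1.
have := h1 r (size (nth [::] (recording s) r)).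
have := h2 r (size (nth [::] (recording s) r)).
have := h1 r (size (nth [::] (recording s') r)).
have := h2 r (size (nth [::] (recording s') r)).
lia.
Qed.

Lemma colseq_pred c P V :
  colseq c (labelled P [seq (p.1.-1, p.2) | p <- V]) = map predn (colseq c (labelled P V)).
Proof.
rewrite /labelled /unzip1 /unzip2 -!map_comp /colseq.
elim: V P => //= -[a b] V IH P; case: ifP => _ /=; rewrite ?IH //.
Qed.

Theorem recording_rotate n k u V (A e : nat -> seq (nat * nat)) :
  let s := [seq (1, b) | b <- u] ++ V in
  staircase_word k.+1 (n - 2 * k) (unzip2 s) -> wact (unzip2 s) =1 block_rev n k ->
  sorted gtn u -> sorted biword_lt V -> all (fun q => 1 < q.1) V ->
  (forall r, 0 < r -> all (ltn r) (unzip2 (A r))) ->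
  (forall r, e r = [::] \/ exists l, e r = [:: (l, r)]) ->
  flatten [seq A r | r <- iota 1 n.-1] = [seq (p.1.-1, p.2) | p <- V] ->
  flatten [seq e r | r <- iota 1 n.-1] = [seq (n - b, n - b) | b <- u] ->
  recording (flatten [seq A r ++ e r | r <- iota 1 n.-1]) = promotion k (recording s).
Proof.
move=> s st ws su sV lV hA he fA fe.
set N := n - 2 * k in st *.
have us : unzip2 s = u ++ unzip2 V by rewrite /s /unzip2 map_cat -map_comp map_id.
have [red rng sz] := st.
have uk : all (fun x => k < x < n - k) u.
  move: rng; rewrite us all_cat => /andP[+ _]; apply: sub_all => x; rewrite /N; lia.
set U := [seq (n - b, n - b) | b <- u]; set V' := [seq (p.1.-1, p.2) | p <- V].
have u2 : unzip2 (V' ++ U) = unzip2 V ++ [seq n - x | x <- u].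
  by rewrite /unzip2 map_cat -!map_comp.
have U2 : unzip2 U = [seq n - x | x <- u] by rewrite /unzip2 -map_comp.
have U1 : unzip1 U = [seq n - x | x <- u] by rewrite /unzip1 -map_comp.
have V2 : unzip2 V' = unzip2 V by rewrite /unzip2 -map_comp.
have st' : staircase_word k.+1 N (unzip2 (V' ++ U)).
  have z : size (unzip2 (V' ++ U)) = size (unzip2 s).
    by rewrite u2 us !size_cat size_map addnC.
  split; last by rewrite z.
  - apply: (reduced_eq red) => // i; rewrite ws u2.
    by apply: (wact_rotate uk) => j; rewrite -us.
  - move: rng; rewrite us u2 !all_cat andbC => /andP[-> _] /=; rewrite all_map.
    by apply: sub_all uk => x /=; rewrite /N; lia.
have gather c := @boxes_gather k.+1 N A e n.-1 1 [::] c hA he.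
rewrite /= fA fe -/U -/V' in gather.
set W := flatten [seq A r ++ e r | r <- iota 1 n.-1] in gather *.
have stW : staircase_word k.+1 N (unzip2 W) by have [] := gather 0 st'.
have eW c : colseq c (labelled [::] W) = colseq c (labelled [::] (V' ++ U)).
  by have [] := gather c st'.
have [sh12 rowW] := staircase_shape stW st.
have [shp ep] := promotion_entries k st su sV lV.
have shp' : same_shape (recording W) (promotion k (recording s)).
  by split=> [|r]; rewrite ?shp.1 ?shp.2 ?sh12.1 ?sh12.2.
apply: (tableau_eq shp') => r c; rewrite rowW => rc.
rewrite (ep _ _ rc); have [rW _ _] := stW; have [-> _ _ _] := recording_recorded rW.
rewrite /box_entry eW labelled_cat colseq_cat nth_cat colseq_pred size_map size_colseq.
rewrite unzip1_labelled; case: ltnP => h.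
  by rewrite (nth_map 0) // size_colseq unzip1_labelled.
have [r' rg' z'] := st'.
have full : size (nth [::] (pword [::] (unzip2 (V' ++ U))) c) = N.-1 - c.
  by rewrite (staircase_pword r' rg' z') size_iota.
rewrite size_pword nth_nil add0n u2 cword_cat count_cat in full.
have sU : sorted ltn [seq n - x | x <- u].
  rewrite sorted_map; apply: (sub_in_sorted (P := [pred x | k < x < n - k]) _ uk su).
  by move=> x y; rewrite !inE /=; lia.
rewrite u2 in st'; rewrite /labelled U1 U2 V2.
(* With a = k+1, the box in 0-based row r comes from the letter r+1+k; the pairs of U repeat the
   letter as label. *)
have := boxes_last st' sU (c := c) (i := r - count_mem c (cword [::] (unzip2 V))).
by rewrite size_pword nth_nil add0n => ->; lia.
Qed.

(** * Rank functions and Demazure products *)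

Lemma wact_rcons w b i : wact (rcons w b) i = wact w (sw b i).
Proof. by rewrite -cats1 wact_cat. Qed.

Lemma wact_inj w : injective (wact w).
Proof. by apply: (can_inj (g := wact (rev w))) => i; exact: wact_revK. Qed.

Lemma wact_fix w i : all (fun b => (i != b) && (i != b.+1)) w -> wact w i = i.
Proof.
elim: w => //= b w IH /andP[/andP[h1 h2] /IH->].
by case: (swP b i) => [[h ->]|[h ->]|[h h' ->]] //; move: h1 h2; rewrite h eqxx.
Qed.

Definition rk C (f : nat -> nat) p := count (fun q => f q <= C) (iota 1 p).

Lemma rkS C f p : rk C f p.+1 = rk C f p + (f p.+1 <= C).
Proof.
have e : iota 1 p.+1 = iota 1 p ++ [:: p.+1] by rewrite -[in LHS](addn1 p) iotaD add1n.
by rewrite /rk e count_cat /= addn0.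
Qed.

Lemma eq_rk C f g p : (forall q, 0 < q <= p -> f q = g q) -> rk C f p = rk C g p.
Proof. by move=> e; apply: eq_in_count => q; rewrite mem_iota => h; rewrite e //; lia. Qed.

Lemma rk_sw C f b p : 0 < b ->
  rk C (fun i => f (sw b i)) p = if p == b then rk C f b.-1 + (f b.+1 <= C) else rk C f p.
Proof.
case: b => // b _; rewrite [b.+1.-1]/=.
have low q : q <= b -> rk C (fun i => f (sw b.+1 i)) q = rk C f q.
  by move=> qb; apply: eq_rk => i hi; congr f; case: (swP b.+1 i) => -[]; lia.
have e1 : sw b.+1 b.+1 = b.+2 by case: (swP b.+1 b.+1) => -[]; lia.
have e2 : sw b.+1 b.+2 = b.+1 by case: (swP b.+1 b.+2) => -[]; lia.
case: eqP => [->|ne]; first by rewrite rkS low // e1.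
case: (leqP p b) => h; first exact: low.
have : b.+2 <= p by lia.
elim: p {h ne} => // p IH; rewrite leq_eqVlt => /orP[/eqP[<-]|h].
  by rewrite !rkS low // e1 e2; lia.
rewrite !rkS IH //; congr (_ + (f _ <= C)).
by case: (swP b.+1 p.+1) => -[]; lia.
Qed.

(** For the rank function of a permutation v, the new value at b is the rank at b-1 plus
    [max(v b, v (b+1)) <= C]: the letter multiplies v if it lengthens v and is ignored otherwise. *)
Definition dem_step (rho : nat -> nat) b p :=
  if p == b then maxn (rho b.-1) (rho b.+1).-1 else rho p.

(* [dem_rank C w p] is the rank function of the Demazure product of [w].           *)
Definition dem_rank C w := foldl dem_step (minn^~ C) w.

Lemma dem_rank_rcons C w b : dem_rank C (rcons w b) = dem_step (dem_rank C w) b.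
Proof. by rewrite /dem_rank foldl_rcons. Qed.

Lemma rk_id C p : rk C id p = minn p C.
Proof.
elim: p => [|p IH]; first by rewrite min0n.
by rewrite rkS IH /=; case: (leqP p.+1 C); lia.
Qed.

(** The Demazure product lies above the ordinary product in Bruhat order, and higher permutations
    have smaller ranks. *)
Lemma dem_rank_le_rk C w p : all (leq 1) w -> dem_rank C w p <= rk C (wact w) p.
Proof.
elim/last_ind: w p => [|w b IH] p; first by rewrite /dem_rank /= -rk_id.
rewrite all_rcons => /andP[b0 aw]; rewrite dem_rank_rcons /dem_step.
rewrite (@eq_rk C (wact (rcons w b)) (fun i => wact w (sw b i))); last first.
  by move=> q _; rewrite wact_rcons.
rewrite rk_sw //; case: eqP => _; last exact: IH.
rewrite geq_max; apply/andP; split; first by apply: leq_trans (IH _ aw) (leq_addr _ _).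
have := IH b.+1 aw; case: b b0 => // b _; rewrite !rkS /=; lia.
Qed.

(** Every letter increases the length of the permutation. This form of reducedness can be checked
    letter by letter along rank functions. *)
Fixpoint ascending (f : nat -> nat) (w : seq nat) : Prop :=
  if w is b :: w' then f b < f b.+1 /\ ascending (fun i => f (sw b i)) w' else True.

Lemma ascending_cat f u v : ascending f (u ++ v) <->
  ascending f u /\ ascending (fun i => f (wact u i)) v.
Proof.
elim: u f => [|b u IH] f /=; first by split=> [h|[]].
by rewrite IH; split=> [[h1 [h2 h3]]|[[h1 h2] h3]].
Qed.

Lemma ascending_rcons w b : ascending id (rcons w b) <->
  ascending id w /\ wact w b < wact w b.+1.
Proof.
rewrite -cats1 ascending_cat /=; split=> [[h1 [h2 _]]|[h1 h2]] //.
Qed.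

Lemma dem_rank_ascending C w p : all (leq 1) w -> ascending id w -> dem_rank C w p = rk C (wact w)
  p.
Proof.
elim/last_ind: w p => [|w b IH] p; first by rewrite /dem_rank /= -rk_id.
rewrite all_rcons => /andP[b0 aw] /ascending_rcons[asw lt]; rewrite dem_rank_rcons /dem_step.
rewrite (@eq_rk C (wact (rcons w b)) (fun i => wact w (sw b i))); last first.
  by move=> q _; rewrite wact_rcons.
rewrite rk_sw //; case: eqP => _; last exact: IH.
rewrite !IH //; case: b b0 lt => // b _ lt; rewrite !rkS /=.
by case: (leqP (wact w b.+1) C); case: (leqP (wact w b.+2) C); lia.
Qed.

Lemma dem_rank_idle C p b q : all (leq 1) (p ++ b :: q) -> ascending id p -> wact p b.+1 <= wact p
  b ->
  dem_rank C (p ++ b :: q) =1 dem_rank C (p ++ q).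
Proof.
rewrite all_cat => /and3P[ap b0 aq] asp le.
have e : dem_step (dem_rank C p) b =1 dem_rank C p.
  move=> i; rewrite /dem_step; case: eqP => // ->; rewrite !dem_rank_ascending //.
  case: b b0 le => // b _ le; rewrite !rkS /=.
  by case: (leqP (wact p b.+1) C); case: (leqP (wact p b.+2) C); lia.
rewrite /dem_rank !foldl_cat /= -/(dem_rank C p).
suff H r r' : r =1 r' -> foldl dem_step r q =1 foldl dem_step r' q by exact: H.
elim: q {aq} r r' => //= c q IH r r' e'; apply: IH => i.
by rewrite /dem_step !e'.
Qed.

Lemma ascending_or w : ascending id w \/
  exists p b q, [/\ w = p ++ b :: q, ascending id p & wact p b.+1 <= wact p b].
Proof.
elim/last_ind: w => [|w b [IH|[p [c [q [-> h1 h2]]]]]]; first by left.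
  have [lt|le] := ltnP (wact w b) (wact w b.+1); first by left; apply/ascending_rcons.
  by right; exists w, b, [::]; rewrite cats1.
by right; exists p, c, (rcons q b); rewrite rcons_cat.
Qed.

Lemma sw_lt b x y : x < y -> sw b x < sw b y \/ (x = b /\ y = b.+1).
Proof. by move=> h; case: (swP b x) => [[? ->]|[? ->]|[? ? ->]];
  case: (swP b y) => [[? ->]|[? ->]|[? ? ->]]; lia. Qed.

Lemma inversion_persists p q x y : ascending id (p ++ q) -> x < y -> wact p y < wact p x ->
  exists x' y', [/\ x' < y', wact (p ++ q) x' = wact p x & wact (p ++ q) y' = wact p y].
Proof.
elim: q p x y => [|c q IH] p x y as1 xy inv; first by exists x, y; rewrite cats0.
have [asp ltc] : ascending id p /\ wact p c < wact p c.+1.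
  by move: as1; rewrite ascending_cat /= => -[? []].
case: (sw_lt c xy) => [xy'|[ex ey]]; last by move: inv ltc; rewrite ex ey; lia.
rewrite -cat_rcons in as1 *.
have [|x' [y' [h1 h2 h3]]] := IH _ _ _ as1 xy'; first by rewrite !wact_rcons !swK.
by exists x', y'; rewrite h2 h3 !wact_rcons !swK.
Qed.

(** This is the exchange property: every inversion is created by a letter, whose deletion transposes
    the two values by [wact_delete]. *)
Lemma inversion_source w i j : ascending id w -> i < j -> wact w j < wact w i ->
  exists p b q, [/\ w = p ++ b :: q, wact p b = wact w j & wact p b.+1 = wact w i].
Proof.
elim/last_ind: w i j => [|w b IH] i j; first by move=> /= _; lia.
move=> /ascending_rcons[asw lt] ij; rewrite !wact_rcons => inv.
case: (sw_lt b ij) => [ij'|[ei ej]].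
  have [p [c [q [-> h1 h2]]]] := IH _ _ asw ij' inv.
  by exists p, c, (rcons q b); rewrite rcons_cat.
exists w, b, [::]; rewrite cats1 ei ej; split=> //.
  by case: (swP b b.+1) => -[]; try lia; move=> _ ->.
by case: (swP b b) => -[]; try lia; move=> _ ->.
Qed.

Lemma wact_delete p b q i j x :
  wact p b = wact (p ++ b :: q) j -> wact p b.+1 = wact (p ++ b :: q) i ->
  wact (p ++ q) x = if x == i then wact (p ++ b :: q) j
    else if x == j then wact (p ++ b :: q) i else wact (p ++ b :: q) x.
Proof.
move=> ej ei; set f := wact (p ++ b :: q).
have ef y : f y = wact p (sw b (wact q y)) by rewrite /f wact_cat.
have fi := @wact_inj (p ++ b :: q); rewrite -/f in fi ei ej.
have pi := @wact_inj p; have qi := @wact_inj q.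
rewrite wact_cat; case: (swP b (wact q x)) => [[e1 e2]|[e1 e2]|[h1 h2 e2]].
- have -> : x == i by apply/eqP/fi; rewrite -ei ef e2.
  by rewrite e1 ej.
- have xj : x = j by apply: fi; rewrite -ej ef e2.
  rewrite e1 xj eqxx ei; case: eqP => // e.
  by move: ei; rewrite -e -ej => /pi; lia.
- rewrite (ef x) e2 ifN; last first.
    by apply/eqP => xi; move: ei; rewrite -xi ef e2 => /pi; lia.
  by rewrite ifN //; apply/eqP => xj; move: ej; rewrite -xj ef e2 => /pi; lia.
Qed.

Lemma rk_exchange C f g i j p : 0 < i -> i < j ->
  (forall x, g x = if x == i then f j else if x == j then f i else f x) ->
  ~~ [&& i <= p, p < j, f j <= C & C < f i] -> f j < f i -> rk C g p = rk C f p.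
Proof.
move=> i0 ij gE nc inv.
have low m q : q < i -> (forall x, m < x <= q -> g x = f x).
  by move=> h x hx; rewrite gE !ifN //; lia.
have [pi|le_ip] := ltnP p i; first by apply: eq_rk => x hx; apply: (low 0 p pi); lia.
have below q : q < j -> i <= q -> rk C g q + (f i <= C) = rk C f q + (f j <= C).
  elim: q => [|q IH]; first by lia.
  move=> qj; rewrite leq_eqVlt => /orP[/eqP e|iq].
    rewrite !rkS -e gE eqxx (@eq_rk C g f q); first by lia.
    by move=> x hx; apply: (low 0 q); lia.
  by rewrite !rkS gE !ifN; [have := IH (ltnW qj) iq; lia|lia|lia].
have [pj|jp] := ltnP p j.
  have := below p pj le_ip; move: nc; rewrite le_ip pj /=.
  by case: (leqP (f j) C); case: (leqP (f i) C); lia.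
elim: p jp {le_ip nc} => [|p IH]; first by lia.
rewrite leq_eqVlt => /orP[/eqP e|jp].
  rewrite !rkS -e gE eqxx ifN; last by lia.
  by have := below p; lia.
by rewrite !rkS IH // gE !ifN //; lia.
Qed.

(** * Inversions and length *)

Fixpoint inversions (s : seq nat) : nat :=
  if s is x :: s' then count (fun y => y < x) s' + inversions s' else 0.

Lemma inversions_swap p a b q : a < b ->
  inversions (p ++ [:: b, a & q]) = (inversions (p ++ [:: a, b & q])).+1.
Proof.
move=> ab; elim: p => [|x p IH] /=; last by rewrite IH !count_cat /=; lia.
by rewrite ab (ltnNge b a) (ltnW ab) /=; lia.
Qed.

Lemma inversions_cat s t : (forall x y, x \in s -> y \in t -> x < y) ->
  inversions (s ++ t) = inversions s + inversions t.
Proof.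
elim: s => //= x s IH h; rewrite IH => [|y z ys zt]; last by apply: h; rewrite ?inE ?ys ?orbT.
rewrite count_cat [X in _ + X + _](_ : _ = 0) ?addn0 ?addnA //.
apply/eqP; rewrite -leqn0 leqNgt -has_count; apply/hasPn => y yt.
by have := h x y (mem_head _ _) yt; lia.
Qed.

Lemma inversions_iota a m : inversions (iota a m) = 0.
Proof.
elim: m a => //= m IH a; rewrite IH addn0.
apply/eqP; rewrite -leqn0 leqNgt -has_count; apply/hasPn => y; rewrite mem_iota; lia.
Qed.

Lemma inversions_rev_iota a m : inversions (rev (iota a m)) = 'C(m, 2).
Proof.
elim: m => // m IH; rewrite -addn1 iotaD rev_cat /= IH addn1 binS bin1 addnC.
congr (_ + _); rewrite count_rev; have : all (fun y => y < a + m) (iota a m).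
  by apply/allP => y; rewrite mem_iota; lia.
by rewrite all_count size_iota => /eqP.
Qed.

Definition window M (f : nat -> nat) := [seq f x | x <- iota 0 M].

Lemma window_rcons M w b : b.+1 < M -> exists p q,
  window M (wact w) = p ++ [:: wact w b, wact w b.+1 & q] /\
  window M (wact (rcons w b)) = p ++ [:: wact w b.+1, wact w b & q].
Proof.
move=> bM; have e : iota 0 M = iota 0 b ++ [:: b, b.+1 & iota b.+2 (M - b.+2)].
  rewrite {1}(_ : M = b + (2 + (M - b.+2))); last by lia.
  by rewrite !iotaD add0n /= addn2.
exists (map (wact w) (iota 0 b)), (map (wact w) (iota b.+2 (M - b.+2))).
rewrite /window e !map_cat /=; split=> //; congr (_ ++ [:: _, _ & _]).
- by apply/eq_in_map => x; rewrite mem_iota wact_rcons => h; congr (wact w _);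
  case: (swP b x) => -[]; lia.
- by rewrite wact_rcons; congr (wact w _); case: (swP b b) => -[]; lia.
- by rewrite wact_rcons; congr (wact w _); case: (swP b b.+1) => -[]; lia.
- by apply/eq_in_map => x; rewrite mem_iota wact_rcons => h; congr (wact w _);
  case: (swP b x) => -[]; lia.
Qed.

Lemma inversions_window M w : all (fun b => b.+1 < M) w ->
  inversions (window M (wact w)) <= size w /\
  (ascending id w -> inversions (window M (wact w)) = size w).
Proof.
elim/last_ind: w => [|w b IH].
  by rewrite /window /= map_id inversions_iota.
rewrite all_rcons size_rcons => /andP[bM /IH[le eq]].
have [p [q [e1 e2]]] := window_rcons w bM.
rewrite e2; rewrite e1 in le eq; split=> [|/ascending_rcons[asw lt]].
  have [lt|gt|e] := ltngtP (wact w b) (wact w b.+1).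
  - by rewrite inversions_swap.
  - by rewrite (leq_trans (leqnSn _)) // -inversions_swap // (leq_trans le).
  - by rewrite -e in le *; apply: leq_trans le _.
by rewrite inversions_swap // eq.
Qed.

Lemma ascending_reduced w : ascending id w -> reduced w.
Proof.
move=> asw u e; pose M := (\max_(b <- w ++ u) b).+2.
have : all (fun b => b.+1 < M) (w ++ u).
  by apply/allP => b bw; rewrite /M !ltnS; rewrite (big_rem b bw) leq_maxl.
rewrite all_cat => /andP[/inversions_window[_ /(_ asw) e1] /inversions_window[le _]].
rewrite -e1; have -> : window M (wact w) = window M (wact u) by apply: eq_map.
exact: le.
Qed.

Lemma inversions_block_rev n k : 2 * k < n ->
  inversions (window n.+1 (block_rev n k)) = 'C(n - 2 * k, 2).
Proof.
move=> kn.
have -> : window n.+1 (block_rev n k) =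
    iota 0 k.+1 ++ (rev (iota k.+1 (n - 2 * k)) ++ iota (n - k).+1 k).
  rewrite /window (_ : n.+1 = k.+1 + ((n - 2 * k) + k)); last by lia.
  rewrite !iotaD !map_cat add0n; congr (_ ++ (_ ++ _)).
  - by rewrite -[RHS]map_id; apply/eq_in_map => x; rewrite mem_iota /block_rev => h;
    rewrite ifN //; lia.
  - apply: (@eq_from_nth _ 0) => [|i]; first by rewrite size_map size_rev !size_iota.
    rewrite size_map size_iota => hi.
    rewrite (nth_map 0) ?size_iota // nth_rev ?size_iota // !nth_iota /block_rev; try lia.
    by rewrite ifT; lia.
  - rewrite (_ : k.+1 + (n - 2 * k) = (n - k).+1); last by lia.
    by rewrite -[RHS]map_id; apply/eq_in_map => x; rewrite mem_iota /block_rev => h;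
      rewrite ifN //; lia.
rewrite !inversions_cat ?inversions_iota ?inversions_rev_iota ?addn0 //.
- by move=> x y; rewrite mem_rev !mem_iota; lia.
- by move=> x y; rewrite mem_cat mem_rev !mem_iota; lia.
Qed.

(** * Critical words: ranks bounded by k, but by no deletion of a letter *)

Section Critical.

Variables (n k : nat) (w : seq nat).
Hypothesis k2_lt_n : 2 * k < n.
Hypothesis w_in : all (fun b => 0 < b < n) w.
Hypothesis w_bounded : forall R C, R + C <= n -> dem_rank C w R <= k.
Hypothesis w_critical : forall p b q, w = p ++ b :: q ->
  exists R C, R + C <= n /\ k < dem_rank C (p ++ q) R.

Let w_pos : all (leq 1) w.
Proof. by apply: sub_all w_in => b /andP[]. Qed.

(** A letter that does not lengthen the product is ignored by the Demazure product, so its deletion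
    could not violate the bound. *)
Lemma critical_ascending : ascending id w.
Proof.
case: (ascending_or w) => // -[p [b [q [e asp le]]]].
have [R [C [RC]]] := w_critical e; rewrite -(@dem_rank_idle C p b q) //; last by rewrite -e.
by rewrite -e ltnNge w_bounded.
Qed.

Let f := wact w.

Let rk_bounded R C : R + C <= n -> rk C f R <= k.
Proof. by move=> h; rewrite -dem_rank_ascending //; [apply: w_bounded|exact: critical_ascending].
  Qed.

Let f_out i : i = 0 \/ n < i -> f i = i.
Proof.
by move=> h; apply: wact_fix; apply: sub_all w_in => b; lia.
Qed.

Let fI : injective f := @wact_inj w.

Lemma block_rev_inj : injective (block_rev n k).
Proof.
by move=> x y; rewrite /block_rev; do 2?case: ifP; lia.
Qed.

(* At the smallest i where f i differs from block_rev, take the least j > i    *)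
(* whose value lies between the expected one and f i. Deleting the letter that *)
(* creates it exchanges f i and f j, which keeps the ranks bounded by k and    *)
(* contradicts criticality.                                                    *)
Lemma critical_wact : f =1 block_rev n k.
Proof.
move=> i; apply/eqP; elim/ltn_ind: i => i IH; apply: contraT => ne.
have {}IH x : x < i -> f x = block_rev n k x by move=> h; apply/eqP/IH.
have fne x : x < i -> f i != block_rev n k x.
  by move=> h; apply/eqP => e; rewrite -(IH _ h) in e; move: h; rewrite (fI e) ltnn.
have in_ : 0 < i <= n.
  move: ne; rewrite /block_rev; case: (posnP i) => [->|i0]; first by rewrite f_out ?eqxx //; left.
  case: (leqP i n) => // h; rewrite f_out; last by right.
  by rewrite ifN ?eqxx //; lia.
have gt : block_rev n k i < f i.
  rewrite ltn_neqAle eq_sym ne /=; rewrite {1}/block_rev.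
  case: ifP => h; last first.
    rewrite leqNgt; apply/negP => lt; have := fne _ lt.
    have [ik|ki] := leqP i k; first by rewrite /block_rev ifN ?eqxx //; lia.
    have [fk|kf] := boolP (k < f i <= n - k); last by rewrite /block_rev (negbTE kf) eqxx.
    have := fne (n.+1 - f i); rewrite /block_rev ifT; last by lia.
    by move=> hh _; have := hh _; lia.
  (* Inside the block, a value f i <= n - i would join the values 1, ..., k and give rank k+1 at (i,
     n - i). *)
  rewrite leqNgt; apply/negP => lt.
  have := rk_bounded (R := i) (C := n - i); rewrite subnKC; last by lia.
  move=> /(_ (leqnn _)); rewrite leqNgt => /negP; apply.
  rewrite /rk (_ : iota 1 i = iota 1 k ++ iota k.+1 (i - k.+1) ++ [:: i]); last first.
    by rewrite -[in LHS](_ : k + ((i - k.+1) + 1) = i) ?iotaD; [congr (_ ++ (_ ++ [:: _]))|]; lia.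
  rewrite !count_cat /= (_ : f i <= n - i); last by lia.
  rewrite (_ : count _ (iota 1 k) = k); first by lia.
  rewrite (eq_in_count (a2 := predT)) ?count_predT ?size_iota // => x; rewrite mem_iota => hx /=.
  by rewrite IH /block_rev ?ifN; lia.
have [j0 ej0] : exists j0, f j0 = block_rev n k i.
  exists (wact (rev w) (block_rev n k i)).
  by rewrite /f -{1}(revK w) wact_revK.
have j0i : i < j0.
  rewrite ltnNge; apply/negP; rewrite leq_eqVlt => /orP[/eqP e|h].
    by move: gt; rewrite -ej0 e ltnn.
  by move: ej0; rewrite (IH _ h) => /block_rev_inj; lia.
have exj : exists j, (i < j) && (block_rev n k i <= f j < f i).
  by exists j0; rewrite j0i ej0 leqnn.
case: (ex_minnP exj) => j /andP[ij /andP[lo hi]] jmin {j0 ej0 j0i exj}.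
have [p [b [q [e h1 h2]]]] := inversion_source critical_ascending ij hi.
have [R [C [RC]]] := w_critical e; rewrite ltnNge => /negP[].
have pq : all (leq 1) (p ++ q).
  by move: w_pos; rewrite e !all_cat => /and3P[ap _ aq]; apply/andP; split.
apply: leq_trans (dem_rank_le_rk C R pq) _.
have gE x : wact (p ++ q) x = if x == i then f j else if x == j then f i else f x.
  by rewrite (@wact_delete p b q i j x) -?e.
(* Outside this rectangle the exchange does not affect the rank. Inside it R + C <= n forces i <= k,
   and by the choice of j no position in ]i, R] has a value at most C, so the rank is at most i. *)
have [/and4P[iR Rj jC Ci]|ns] := boolP [&& i <= R, R < j, f j <= C & C < f i]; last first.
  by rewrite (rk_exchange _ ij gE ns hi) ?rk_bounded //; lia.
have [ik|ki] := leqP i k; last by move: lo; rewrite /block_rev; case: ifP; lia.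
have Wi : block_rev n k i = i by rewrite /block_rev ifN //; lia.
rewrite /rk (_ : iota 1 R = iota 1 i ++ iota i.+1 (R - i)); last first.
  by rewrite -[in LHS](subnKC iR) iotaD.
rewrite count_cat [X in _ + X](_ : _ = 0); last first.
  apply/eqP; rewrite -leqn0 leqNgt -has_count; apply/hasPn => y; rewrite mem_iota => hy.
  rewrite gE !ifN; try lia.
  apply/negP => yC; have [fyi|ify] := ltnP (f y) i; last first.
    by have := jmin y; rewrite Wi; lia.
  have : f (f y) = f y by rewrite IH // /block_rev ifN //; lia.
  by move/fI; lia.
rewrite addn0; apply: leq_trans (count_size _ _) _; by rewrite size_iota.
Qed.

(** The first letter outside the interval would act on a point that is still fixed. The inversion it
    creates persists in w, but [block_rev] inverts only pairs inside the block. *)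
Lemma critical_letters : all (fun b => k < b < n - k) w.
Proof.
have asw := critical_ascending; have fW := critical_wact; rewrite /f in fW.
suff H p q : w = p ++ q -> all (fun b => k < b < n - k) p by apply: (H w [::]); rewrite cats0.
elim/last_ind: p q => // p b IH q; rewrite cat_rcons all_rcons => e.
have ap := IH _ e; rewrite ap andbT.
have [asp lt] : ascending id p /\ wact p b < wact p b.+1.
  by move: asw; rewrite e ascending_cat /= => -[? []].
have inv : wact (rcons p b) b.+1 < wact (rcons p b) b.
  by rewrite !wact_rcons swl swr.
have as' : ascending id (rcons p b ++ q) by rewrite cat_rcons -e.
have [x [y [xy ex ey]]] := inversion_persists as' (ltnSn b) inv.
move: ex ey; rewrite cat_rcons -e !fW !wact_rcons swl swr.
move=> ex ey.
have [bk|kb] /= := leqP b k.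
  have eb : wact p b = b by apply: wact_fix; apply: sub_all ap => c; lia.
  by move: ex ey lt; rewrite eb /block_rev; do 2?case: ifP; lia.
rewrite ltnNge; apply/negP => nb.
have eb : wact p b.+1 = b.+1 by apply: wact_fix; apply: sub_all ap => c; lia.
by move: ex ey lt; rewrite eb /block_rev; do 2?case: ifP; lia.
Qed.

Lemma critical_staircase : staircase_word k.+1 (n - 2 * k) w /\ wact w =1 block_rev n k.
Proof.
have asw := critical_ascending; split; last exact: critical_wact.
split; first exact: ascending_reduced.
- by apply: sub_all critical_letters => b; lia.
- have [|_ <- //] := @inversions_window n.+1 w.
    by apply: sub_all w_in => b; lia.
  rewrite -(inversions_block_rev k2_lt_n); congr inversions.
  by apply: eq_map => x; rewrite -/(f x) critical_wact.
Qed.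

End Critical.

(** * Words of k-triangulations *)

Definition boxword n (cr : pred (nat * nat)) : seq nat :=
  [seq (b.1 + b.2).-1 | b <- staircase_boxes n & cr b].

Lemma mem_staircase_boxes n b :
  (b \in staircase_boxes n) = [&& 0 < b.1, 0 < b.2 & b.1 + b.2 <= n].
Proof.
case: b => r c; apply/allpairsPdep/and3P => /= [[r' [c' [+ + [-> ->]]]]|[r0 c0 rc]].
  by rewrite mem_rev !mem_iota; split; lia.
by exists r, c; rewrite mem_rev !mem_iota; split=> //; lia.
Qed.

Lemma uniq_staircase_boxes n : uniq (staircase_boxes n).
Proof.
apply: allpairs_uniq_dep => [|r _|]; first exact: iota_uniq.
  by rewrite rev_uniq iota_uniq.
by move=> [r c] [r' c'] _ _ /= [-> ->].
Qed.

Section Chain.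

Variables (cr : pred (nat * nat)) (C : nat).

(* The longest sequence of boxes outside [cr] going strictly up and to the     *)
(* right, inside the first [r] rows and the last [d] of the first [C] columns. *)
Fixpoint chain (r d : nat) : nat :=
  if r is r'.+1 then
    (fix row d := if d is d'.+1 then
       if cr (r'.+1, C - d') then maxn (chain r' d'.+1) (row d') else (chain r' d').+1
     else 0) d
  else 0.

Lemma chainSS r d : chain r.+1 d.+1 =
  if cr (r.+1, C - d) then maxn (chain r d.+1) (chain r.+1 d) else (chain r d).+1.
Proof. by []. Qed.

Lemma chain0 r : chain r 0 = 0. Proof. by case: r. Qed.

Lemma chain_step r d :
  chain r d <= chain r.+1 d <= (chain r d).+1 /\ chain r d <= chain r d.+1 <= (chain r d).+1.
Proof.
have [m] := ubnP (r + d); elim: m r d => // m IH r d rd.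
have h1 : chain r d <= chain r.+1 d <= (chain r d).+1.
  case: d rd => [|d] rd; first by rewrite !chain0.
  have [a1 a2] : _ /\ _ := IH r d ltac:(lia).
  by rewrite chainSS; case: ifP => _; lia.
split=> //; case: r rd h1 => [|r] rd h1 //.
have [a1 a2] : _ /\ _ := IH r d ltac:(lia).
by rewrite chainSS; case: ifP => _; lia.
Qed.

Definition NE (x y : nat * nat) := (y.1 < x.1) && (x.2 < y.2).

Definition inside r d (b : nat * nat) := [&& 0 < b.1 <= r, C - d < b.2 <= C & ~~ cr b].

Lemma chain_exists r d : d <= C -> exists L,
  [/\ size L = chain r d, all (inside r d) L & pairwise NE L].
Proof.
have [m] := ubnP (r + d); elim: m r d => // m IH [|r] [|d] rd dC; try by exists [::].
have [L1 [s1 a1 p1]] := IH r d.+1 ltac:(lia) dC.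
have [L2 [s2 a2 p2]] := IH r.+1 d ltac:(lia) (ltnW dC).
have [L3 [s3 a3 p3]] := IH r d ltac:(lia) (ltnW dC).
rewrite chainSS; case: ifP => hcr.
  have [h|h] := leqP (chain r d.+1) (chain r.+1 d).
    exists L2; split=> //; apply: sub_all a2 => b; rewrite /inside; lia.
  by exists L1; split=> //; apply: sub_all a1 => b; rewrite /inside; lia.
exists ((r.+1, C - d) :: L3); rewrite /= s3 p3 andbT; split=> //.
  apply/andP; split; first by rewrite /inside /= hcr; lia.
  by apply: sub_all a3 => b; rewrite /inside; lia.
by apply: sub_all a3 => b; rewrite /inside /NE /=; lia.
Qed.

(** Unless L contains the corner (r, C-d+1) of its region, it misses the last row or the first
    column: two other boxes, one in each, are incomparable. *)
Lemma chain_bound r d L : d <= C -> uniq L -> all (inside r d) L ->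
  {in L &, forall x y, x != y -> NE x y || NE y x} -> size L <= chain r d.
Proof.
have [m] := ubnP (r + d); elim: m r d L => // m IH r d L rd dC uL aL cL.
have sub r' d' : r' + d' < m -> d' <= C -> all (inside r' d') L -> size L <= chain r' d'.
  by move=> h1 h2 h3; apply: IH.
case: L uL aL cL sub => // b0 L0; set L := b0 :: L0 => uL aL cL sub.
have := allP aL b0 (mem_head _ _); rewrite /inside => b0in.
case: r d rd dC aL b0in sub => [|r] [|d] rd dC aL b0in sub; try by exfalso; lia.
have [s1 s2] := chain_step r d.+1; have [s3 s4] := chain_step r.+1 d.
have [xL|nx] := boolP ((r.+1, C - d) \in L).
  have hcr : cr (r.+1, C - d) = false.
    by have := allP aL _ xL; rewrite /inside => /and3P[_ _ /negbTE].
  rewrite chainSS hcr; have -> : size L = (size (rem (r.+1, C - d) L)).+1.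
    by rewrite size_rem.
  rewrite ltnS; apply: IH; [lia|lia|exact: rem_uniq| |].
    apply/allP => y; rewrite mem_rem_uniq // inE => /andP[yx yL].
    have := cL _ _ yL xL yx; have := allP aL _ yL; rewrite /inside /NE /=; lia.
  by move=> y z /mem_rem yL /mem_rem zL; apply: cL.
have [/hasP[x xL /eqP xr]|/hasPn nr] := boolP (has (fun b => b.1 == r.+1) L).
  have [/hasP[y yL /eqP yc]|/hasPn nc] := boolP (has (fun b => b.2 == C - d) L).
    exfalso; have ne : x != y.
      apply: contraNneq nx => e; rewrite (_ : (r.+1, C - d) = x) //.
      by case: x e xr {xL} => x1 x2 e /= <-; rewrite -yc -e.
    have := cL _ _ xL yL ne; have := allP aL _ xL; have := allP aL _ yL.
    rewrite /inside /NE xr yc => h1 h2.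
    have : y.1 != r.+1.
      apply: contraNneq nx => e; rewrite (_ : (r.+1, C - d) = y) //.
      by case: y e yc {yL ne h1} => y1 y2 /= -> ->.
    have : x.2 != C - d.
      apply: contraNneq nx => e; rewrite (_ : (r.+1, C - d) = x) //.
      by case: x e xr {xL ne h2} => x1 x2 /= -> ->.
    lia.
  apply: (leq_trans (sub r.+1 d _ _ _)); [lia|lia| |lia].
  apply/allP => y yL; have := allP aL _ yL; have := nc _ yL; rewrite /inside /=; lia.
apply: (leq_trans (sub r d.+1 _ _ _)); [lia|lia| |lia].
apply/allP => y yL; have := allP aL _ yL; have := nr _ yL; rewrite /inside /=; lia.
Qed.

Definition rowword r m := [seq (r + c).-1 | c <- rev (iota 1 m) & cr (r, c)].

(* The rank function after the first [r] rows.                                 *)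
Definition row_rank r p :=
  if p < r then chain p C
  else if p - r <= C then p - r + chain r (C - (p - r)) else C.

(** Row r+1 is read from right to left, so when the columns beyond c are done the letters r+1+c and
    above have had their turn. *)
Definition mid_rank r c p := if r.+1 + c <= p then row_rank r.+1 p else row_rank r p.

(** At a letter of the word, [dem_step] is the recursion of [chain] at the corresponding box. At a
    missing letter the rank must not change, and it does not because the chain gains one box. *)
Lemma rowword_rank r m rho : rho =1 mid_rank r m ->
  foldl dem_step rho (rowword r.+1 m) =1 row_rank r.+1.
Proof.
elim: m rho => [|m IH] rho e p.
  rewrite /= e /mid_rank addn0; case: leqP => // h; rewrite /row_rank ?h [X in _ = if X then _
    else _](_ : _ = true); last by lia.
  case: (ltngtP p r) h => // -> _.
  by rewrite subnn subn0.
have -> : rowword r.+1 m.+1 = [seq (r.+1 + c).-1 | c <- m.+1 :: rev (iota 1 m) & cr (r.+1, c)].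
  by rewrite /rowword -[in LHS](addn1 m) iotaD rev_cat /= add1n.
rewrite /=.
have tail rho' : rho' =1 mid_rank r m ->
    foldl dem_step rho' [seq (r.+1 + c).-1 | c <- rev (iota 1 m) & cr (r.+1, c)] p = row_rank r.+1
      p.
  by move=> e'; apply: IH.
have same q : q != r.+1 + m -> mid_rank r m.+1 q = mid_rank r m q.
  by move=> ne; rewrite /mid_rank; case: (leqP (r.+1 + m.+1)) => h1;
    case: (leqP (r.+1 + m)) => h2 //; exfalso; lia.
have er : row_rank r (r + m).+1 = if m.+1 <= C then m.+1 + chain r (C - m.+1) else C.
  rewrite /row_rank ifN; last by lia.
  by rewrite (_ : (r + m).+1 - r = m.+1) //; lia.
have er1 q : row_rank r.+1 (r + q).+1 = if q <= C then q + chain r.+1 (C - q) else C.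
  rewrite /row_rank ifN; last by lia.
  by rewrite (_ : (r + q).+1 - r.+1 = q) //; lia.
have er2 : row_rank r (r + m) = if m <= C then m + chain r (C - m) else C.
  rewrite /row_rank ifN; last by lia.
  by rewrite (_ : r + m - r = m) //; lia.
have er1S := er1 m.+1; rewrite addnS in er1S.
have col : m < C -> C - (C - m.+1) = m.+1 by lia.
have next : m < C -> C - m = (C - m.+1).+1 by lia.
case: ifP => hcr /=; apply: tail => q.
  rewrite addnS /= /dem_step; case: eqP => [->|ne]; last by rewrite e same //; lia.
  rewrite !e /mid_rank ifN; last by lia.
  rewrite ifT; last by lia.
  rewrite ifT; last by lia.
  rewrite /= er2 er1S er1; case: (ltnP m C) => h; last first.
    case: (leqP m C) => h'; last by lia.
    have -> : C - m = 0 by lia.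
    by rewrite !chain0; lia.
  rewrite (ltnW h) next // chainSS col // hcr; lia.
rewrite e; case: (q =P r.+1 + m) => [->|ne]; last by rewrite same //; lia.
rewrite /mid_rank ifN; last by lia.
rewrite ifT; last by lia.
rewrite addSn er1 er; case: (ltnP m C) => h; last first.
  case: (leqP m C) => h'; last by lia.
  have -> : C - m = 0 by lia.
  by rewrite !chain0; lia.
by rewrite (ltnW h) next // chainSS col // hcr; lia.
Qed.

Lemma boxword_rows n : boxword n cr = flatten [seq rowword r (n - r) | r <- iota 1 n.-1].
Proof.
rewrite /boxword /staircase_boxes filter_flatten map_flatten -!map_comp.
congr flatten; apply: eq_map => r /=.
by rewrite filter_map -map_comp.
Qed.

Lemma rank_rows n r : r + C <= n ->
  foldl dem_step (minn^~ C) (flatten [seq rowword r (n - r) | r <- iota 1 r]) =1 row_rank r.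
Proof.
elim: r => [|r IH] rC p.
  by rewrite /= /row_rank ltn0 subn0 /=; case: leqP; lia.
rewrite -[in iota _ _](addn1 r) iotaD map_cat flatten_cat foldl_cat /= cats0 add1n.
apply: rowword_rank => q; rewrite IH; last by lia.
rewrite /mid_rank subnKC; last by lia.
case: (leqP n q) => // h.
rewrite /row_rank (_ : (q < r.+1) = false); last by lia.
rewrite (_ : (q < r) = false); last by lia.
rewrite (_ : (q - r <= C) = false); last by lia.
case: (leqP (q - r.+1) C) => // h'; have -> : q - r.+1 = C by lia.
by rewrite subnn chain0 addn0.
Qed.

(** The letters of the rows after row R all exceed R, so the value at R is final once R rows are
    read. *)
Lemma dem_rank_boxword n R : R + C <= n -> 0 < n -> dem_rank C (boxword n cr) R = chain R C.
Proof.
move=> RC n0; rewrite /dem_rank boxword_rows.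
have [RN|NR] := leqP R n.-1; last first.
  have C0 : C = 0 by lia.
  rewrite rank_rows; last by lia.
  by rewrite /row_rank ifN; [rewrite C0 chain0; case: ifP; lia|lia].
rewrite -(subnKC RN) iotaD map_cat flatten_cat foldl_cat.
have frozen w rho : all (fun b => b != R) w -> foldl dem_step rho w R = rho R.
  by elim: w rho => //= b w IH rho /andP[bR wR]; rewrite IH // /dem_step eq_sym (negbTE bR).
rewrite frozen ?rank_rows //; first by rewrite /row_rank ltnn subnn subn0.
apply/allP => b /flatten_mapP[r]; rewrite mem_iota => hr /mapP[c].
by rewrite mem_filter mem_rev mem_iota => hc ->; lia.
Qed.

End Chain.

Section Boxes.

Variable n : nat.
Implicit Types (e f : {set 'I_n}) (b x y : nat * nat).

Lemma box_pairE b : b \in staircase_boxes n -> exists u v : 'I_n,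
  [/\ u < v, b.2 = u.+1, b.1 = n - v & box_pair n b = [set u; v]].
Proof.
rewrite mem_staircase_boxes => /and3P[b1 b2 b12].
case: b b1 b2 b12 => r c /= r1 c1 rc.
have un : c.-1 < n by lia.
have vn : n - r < n by lia.
exists (Ordinal un), (Ordinal vn); split=> /=; try lia.
apply/setP => i; rewrite !inE -!val_eqE /=; congr (_ || _); lia.
Qed.

Lemma set2_lt (u v u' v' : 'I_n) : u < v -> u' < v' -> [set u; v] = [set u'; v'] ->
  u = u' /\ v = v'.
Proof.
move=> uv uv' e; have := set21 u v; have := set22 u v; have := set21 u' v'; have := set22 u' v'.
rewrite -e {1 2}e -{}e !inE -!val_eqE /= => h1 h2 h3 h4.
by split; apply: val_inj => /=; lia.
Qed.

Lemma box_pair_inv b (u v : 'I_n) : b \in staircase_boxes n -> u < v ->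
  box_pair n b = [set u; v] -> b.2 = u.+1 /\ b.1 = n - v.
Proof.
move=> bs uv e; have [u' [v' [uv' -> -> e']]] := box_pairE bs.
by rewrite e in e'; have [-> ->] := set2_lt uv uv' e'.
Qed.

Lemma box_pair_inj : {in staircase_boxes n &, injective (box_pair n)}.
Proof.
move=> b b' bs bs' e; have [u [v [uv h1 h2 e']]] := box_pairE bs.
rewrite e in e'; have [h3 h4] := box_pair_inv bs' uv e'.
by case: b b' h1 h2 h3 h4 {bs bs' e e'} => b1 b2 [b1' b2'] /= -> -> -> ->.
Qed.

Lemma diagonal_box e : #|e| = 2 -> exists2 b, b \in staircase_boxes n & box_pair n b = e.
Proof.
move=> /eqP/cards2P[u [v [uv ->]]].
wlog lt : u v uv / u < v.
  move=> H.
  have [lt|gt|ee] := ltngtP u v; first exact: H.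
    by rewrite setUC; apply: H => //; rewrite eq_sym.
  by move: uv; rewrite -val_eqE /= ee eqxx.
exists (n - v, u.+1).
  by rewrite mem_staircase_boxes /=; have := ltn_ord v; lia.
apply/setP => i; rewrite !inE -!val_eqE /=; congr (_ || _); have := ltn_ord v; lia.
Qed.

(** For pairs u < v and u' < v', [NE] says u < u' and v < v'. What crossing requires beyond this, u'
    < v, says that the corner (b.1, b'.2) lies in the staircase. *)
Lemma NE_crossing b b' : b \in staircase_boxes n -> b' \in staircase_boxes n ->
  NE b b' -> b.1 + b'.2 <= n -> crossing (box_pair n b) (box_pair n b').
Proof.
move=> bs bs' /andP[h1 h2] h3.
have [u [v [uv e1 e2 ->]]] := box_pairE bs; have [u' [v' [uv' e1' e2' ->]]] := box_pairE bs'.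
have := ltn_ord v; have := ltn_ord v' => vn' vn.
apply/existsP; exists u; apply/existsP; exists u'; apply/existsP; exists v.
by apply/existsP; exists v'; rewrite !eqxx /=; lia.
Qed.

Lemma crossing_sym e f : crossing e f = crossing f e.
Proof.
rewrite /crossing; apply: eq_existsb => u; apply: eq_existsb => v; apply: eq_existsb => u'.
by apply: eq_existsb => v'; rewrite orbC [(e == _) && _]andbC [(f == _) && _]andbC orbC
  [(e == [set v; v']) && _]andbC [(f == [set v; v']) && _]andbC orbC.
Qed.

Lemma crossing_NE b b' : b \in staircase_boxes n -> b' \in staircase_boxes n ->
  crossing (box_pair n b) (box_pair n b') ->
  NE b b' && (b.1 + b'.2 <= n) || NE b' b && (b'.1 + b.2 <= n).
Proof.
move=> bs bs' /existsP[u /existsP[u' /existsP[v /existsP[v' /and4P[h1 h2 h3]]]]].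
have := ltn_ord v'; have := ltn_ord v => vn vn'.
have uv : u < v by lia.
have uv' : u' < v' by lia.
case/orP => /andP[/eqP e1 /eqP e2].
  have [p1 p2] := box_pair_inv bs uv e1; have [q1 q2] := box_pair_inv bs' uv' e2.
  by rewrite /NE p1 p2 q1 q2; lia.
have [p1 p2] := box_pair_inv bs' uv e1; have [q1 q2] := box_pair_inv bs uv' e2.
by rewrite /NE p1 p2 q1 q2; lia.
Qed.

Lemma side_lt (u v : 'I_n) : u < v -> side [set u; v] ->
  v = u.+1 :> nat \/ u = 0 :> nat /\ v = n.-1 :> nat.
Proof.
move=> uv /existsP[w /eqP e].
have wn : (w : nat) < n := ltn_ord w; have ow : (ordS w : nat) = w.+1 %% n by [].
have [lt|ge] := ltnP w.+1 n.
  rewrite modn_small // in ow.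
  have wlt : w < ordS w by rewrite ow.
  by have [-> ->] := set2_lt uv wlt e; left.
have wE : (w : nat) = n.-1 by move: wn ge; clear; lia.
have {}ow : (ordS w : nat) = 0.
  by rewrite ow wE prednK ?modnn //; apply: leq_ltn_trans wn.
have e' : [set u; v] = [set ordS w; w] by rewrite e setUC.
have [lt|ge'] := ltnP (ordS w) w.
  by have [-> ->] := set2_lt uv lt e'; right.
have := ltn_ord v; move: ge' uv; rewrite ow wE; clear; lia.
Qed.

Lemma crossing_not_side e f : crossing e f -> ~~ side e.
Proof.
move=> /existsP[u /existsP[u' /existsP[v /existsP[v' /and4P[h1 h2 h3]]]]].
have := ltn_ord v' => vn; case/orP => /andP[/eqP e1 /eqP e2].
  by apply/negP; rewrite e1 => /side_lt; lia.
by apply/negP; rewrite e2 => /side_lt; lia.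
Qed.

End Boxes.

Lemma pairwise_total (U : eqType) (r : rel U) s : pairwise r s ->
  {in s &, forall x y, x != y -> r x y || r y x}.
Proof.
elim: s => //= a s IH /andP[/allP ra ps] x y; rewrite !inE.
case/orP => [/eqP->|xs]; case/orP => [/eqP->|ys] //; rewrite ?eqxx // => ne.
- by rewrite ra.
- by rewrite (ra x) ?orbT.
- exact: IH.
Qed.

Lemma map_split (U V : Type) (f : U -> V) s p b q : map f s = p ++ b :: q ->
  exists P x Q, [/\ s = P ++ x :: Q, map f P = p, f x = b & map f Q = q].
Proof.
elim: p s => [|a p IH] [|x s] //= [].
  by move=> fx fs; exists [::], x, s.
move=> fx /IH[P [y [Q [-> h1 h2 h3]]]].
by exists (x :: P), y, Q; rewrite /= fx h1.
Qed.

Lemma seq_max (U : eqType) (f : U -> nat) s : s != [::] ->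
  exists2 x, x \in s & forall y, y \in s -> f y <= f x.
Proof.
elim: s => // a [|b s] IH _; first by exists a => [|y]; rewrite inE ?eqxx // => /eqP->.
have [//|x xs h] := IH; have [le|lt] := leqP (f x) (f a).
  exists a; first exact: mem_head.
  by move=> y; rewrite inE => /orP[/eqP->//|/h hy]; apply: leq_trans le.
exists x; first by rewrite inE xs orbT.
by move=> y; rewrite inE => /orP[/eqP->|/h //]; apply: ltnW.
Qed.

Section Triangulation.

Variables (n k : nat) (T : {set {set 'I_n}}).
Hypotheses (k_gt0 : 0 < k) (k2_lt_n : 2 * k < n) (T_ktri : ktriangulation k T).

Definition cross_box : pred (nat * nat) :=
  fun b => ~~ side (box_pair n b) && (box_pair n b \notin T).

Lemma crossing_set (L : seq (nat * nat)) : {subset L <= staircase_boxes n} -> uniq L ->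
  {in L &, forall x y, x != y -> crossing (box_pair n x) (box_pair n y)} ->
  let S := [set e in map (box_pair n) L] in #|S| = size L /\ mutually_crossing S.
Proof.
move=> sL uL cL S; split.
  rewrite cardsE (card_uniqP _) ?size_map // map_inj_in_uniq // => x y xL yL.
  by apply: box_pair_inj; apply: sL.
apply/forall_inP => e; rewrite inE => /mapP[x xL ->].
apply/forall_inP => f; rewrite inE => /mapP[y yL ->]; apply/implyP => ne.
by apply: cL => //; apply: contraNneq ne => ->.
Qed.

Lemma triangulation_bounded R C : R + C <= n -> chain cross_box C R C <= k.
Proof.
move=> RC; rewrite leqNgt; apply/negP => big.
have [L0 [sz aL0 pL0]] := chain_exists cross_box (R) (leqnn C).
set L := take k.+1 L0.
have szL : size L = k.+1 by rewrite size_take_min sz; lia.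
have aL : all (inside cross_box C R C) L.
  by apply/allP => x /mem_take; apply: (allP aL0).
have pL : pairwise NE L.
  by move: pL0; rewrite -{1}(cat_take_drop k.+1 L0) pairwise_cat => /and3P[].
have sL : {subset L <= staircase_boxes n}.
  move=> x /(allP aL); rewrite /inside mem_staircase_boxes subnn => /and3P[].
  case: x => r c /= /andP[r1 r2] /andP[c1 c2] _; move: RC r1 r2 c1 c2; clear; lia.
have uL : uniq L by apply: pairwise_uniq pL => x; rewrite /NE ltnn.
have cL : {in L &, forall x y, x != y -> crossing (box_pair n x) (box_pair n y)}.
  move=> x y xL yL ne; have := allP aL _ xL; have := allP aL _ yL; rewrite /inside => hy hx.
  have /orP[xy|yx] := pairwise_total pL xL yL ne.
    apply: NE_crossing; rewrite ?sL //; apply: leq_trans RC.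
    by case/and3P: hx => /andP[_ ?] _ _; case/and3P: hy => _ /andP[_ ?] _; apply: leq_add.
  rewrite crossing_sym; apply: NE_crossing; rewrite ?sL //; apply: leq_trans RC.
  by case/and3P: hy => /andP[_ ?] _ _; case/and3P: hx => _ /andP[_ ?] _; apply: leq_add.
have [cS mS] := crossing_set sL uL cL; set S := [set e in _] in cS mS.
have ST : S \subset T.
  apply/subsetP => e; rewrite inE => /mapP[x xL ->].
  have := allP aL _ xL; rewrite /inside => /and3P[_ _]; rewrite negb_and !negbK.
  case/orP => // sx; exfalso.
  (* Since k > 0, the chain has a second box, whose pair crosses that of x; but a side crosses
     nothing. *)
  have [y yL ne] : exists2 y, y \in L & x != y.
    case: (L) szL uL => [|a [|b s]] //=.
      by move=> [k0]; move: k_gt0; rewrite -k0.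
    move=> _ /andP[nab _].
    have [->|ne] := eqVneq x a; last by exists a; rewrite ?mem_head.
    exists b; rewrite ?inE ?eqxx ?orbT //.
    by apply: contraNneq nab => ->; rewrite mem_head.
  by have := crossing_not_side (cL _ _ xL yL ne); rewrite sx.
have /maxsetP[/andP[_ /negP nc] _] := T_ktri; case: nc; apply/existsP; exists S.
by rewrite ST cS szL eqxx mS.
Qed.

Lemma triangulation_critical x : x \in staircase_boxes n -> cross_box x ->
  let cr := [pred y | cross_box y && (y != x)] in
  exists R C, R + C <= n /\ k < chain cr C R C.
Proof.
move=> xs /andP[nside nT] cr; set e := box_pair n x in nside nT.
have [/andP[dT _] maxT] := maxsetP T_ktri.
have de : diagonal e.
  rewrite /diagonal nside andbT /e; have [u [v [uv _ _ ->]]] := box_pairE xs.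
  by rewrite cards2 -val_eqE (ltn_eqF uv).
have : has_crossing k.+1 (e |: T).
  apply: contraT => nc; have := maxT (e |: T); rewrite /= nc andbT => h.
  have eT : e |: T = T.
    apply: h; last exact: subsetU1.
    by apply/subsetP => f; rewrite !inE => /orP[/eqP->//|/(subsetP dT)]; rewrite inE.
  by move: nT; rewrite -eT setU11.
case/existsP => S /and3P[/subsetP ST /eqP cS /forall_inP mS].
set L := [seq y <- staircase_boxes n | box_pair n y \in S].
have sL y : y \in L -> y \in staircase_boxes n by rewrite mem_filter => /andP[].
have uL : uniq L by rewrite filter_uniq // uniq_staircase_boxes.
have szL : size L = k.+1.
  rewrite -cS -(size_map (box_pair n)); apply/esym.
  have /card_uniqP <- : uniq (map (box_pair n) L).
    by rewrite map_inj_in_uniq // => y z yL zL; apply: box_pair_inj; apply: sL.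
  apply: eq_card => f; apply/idP/mapP => [fS|[y]]; last by rewrite mem_filter => /andP[? _] ->.
  have df : #|f| = 2.
    have := ST _ fS; rewrite !inE => /orP[/eqP->|/(subsetP dT)]; last by rewrite inE => /andP[/eqP].
    by move: de => /andP[/eqP].
  by have [y ys ey] := diagonal_box df; exists y; rewrite // mem_filter ey fS.
have nL : L != [::] by rewrite -size_eq0 szL.
have cL y z : y \in L -> z \in L -> y != z ->
    NE y z && (y.1 + z.2 <= n) || NE z y && (z.1 + y.2 <= n).
  move=> yL zL ne; apply: crossing_NE; rewrite ?sL //.
  have yS : box_pair n y \in S by move: yL; rewrite mem_filter => /andP[].
  have zS : box_pair n z \in S by move: zL; rewrite mem_filter => /andP[].
  have := forall_inP (mS _ yS) _ zS => /implyP; apply.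
  by apply: contraNneq ne => h; apply/eqP; apply: box_pair_inj h; apply: sL.
(* The lowest and the rightmost box of L span the rectangle. It lies in the staircase since the two
   pairs cross or coincide. *)
have [y yL hy] := seq_max fst nL; have [z zL hz] := seq_max snd nL.
exists y.1, z.2; split.
  have [eyz|ne] := eqVneq y z.
    by have := sL _ yL; rewrite -eyz mem_staircase_boxes => /and3P[].
  case/orP: (cL _ _ yL zL ne) => /andP[/andP[z1 y2] h] //.
  by have := leq_trans z1 (hy _ zL); rewrite ltnn.
rewrite -szL; apply: chain_bound => //.
  apply/allP => b bL; have := sL _ bL; rewrite mem_staircase_boxes /inside => /and3P[b1 b2 _].
  rewrite b1 hy // hz // subnn b2 /= negb_and negbK.
  have : box_pair n b \in e |: T by apply: ST; move: bL; rewrite mem_filter => /andP[].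
  rewrite !inE => /orP[/eqP eb|bT]; last by rewrite /cross_box bT andbF.
  by apply/orP; right; apply/eqP; apply: box_pair_inj eb => //; apply: sL.
by move=> b c bL cL' ne; case/orP: (cL _ _ bL cL' ne) => /andP[-> _]; rewrite ?orbT.
Qed.

Theorem triangulation_word :
  staircase_word k.+1 (n - 2 * k) (boxword n cross_box) /\
  wact (boxword n cross_box) =1 block_rev n k.
Proof.
have n0 : 0 < n by lia.
apply: critical_staircase => //.
- apply/allP => b /mapP[[r c]]; rewrite mem_filter mem_staircase_boxes /=.
  by case/andP=> _ /and3P[]; clear => r1 c1 rc ->; lia.
- by move=> R C RC; rewrite dem_rank_boxword // triangulation_bounded.
move=> p b q e; have [P [x [Q [e1 e2 e3 e4]]]] := map_split e.
have xin : x \in [seq y <- staircase_boxes n | cross_box y].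
  by rewrite e1 mem_cat mem_head orbT.
move: (xin); rewrite mem_filter => /andP[cx xs].
have [R [C [RC big]]] := triangulation_critical xs cx.
exists R, C; split=> //; rewrite (_ : p ++ q = boxword n [pred y | cross_box y && (y != x)]).
  by rewrite dem_rank_boxword.
rewrite -e2 -e4 -map_cat /boxword; congr map.
have uf : uniq [seq y <- staircase_boxes n | cross_box y].
  by rewrite filter_uniq // uniq_staircase_boxes.
transitivity (filter (predC1 x) [seq y <- staircase_boxes n | cross_box y]); last first.
  by rewrite -filter_predI; apply: eq_filter => y /=; rewrite andbC.
move: uf; rewrite e1 cat_uniq /= negb_or => /and4P[_ /andP[xP _] xQ _].
rewrite filter_cat /= eqxx /=; congr (_ ++ _); apply/esym/all_filterP/allP => y yP /=.
  by apply: contraNneq xP => <-.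
by apply: contraNneq xQ => <-.
Qed.

End Triangulation.

(** * Rotation *)

Definition biword_row n (cr : pred (nat * nat)) r :=
  [seq (r, (r + c).-1) | c <- rev (iota 1 (n - r)) & cr (r, c)].

Lemma biword_rows n (T : {set {set 'I_n}}) :
  biword T = flatten [seq biword_row n (cross_box T) r | r <- iota 1 n.-1].
Proof.
rewrite /biword /complement_boxes /staircase_boxes filter_flatten map_flatten -!map_comp.
congr flatten; apply: eq_map => r /=; rewrite filter_map -map_comp; exact: eq_map.
Qed.

Lemma unzip2_biword n (T : {set {set 'I_n}}) :
  unzip2 (biword T) = boxword n (cross_box T).
Proof. by rewrite /unzip2 /biword -map_comp; apply: eq_map. Qed.

Lemma rev_iota_pairwise m l : pairwise gtn (rev (iota m l)).
Proof.
rewrite -sorted_pairwise ?rev_sorted ?iota_ltn_sorted // => x y z /=.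
by move=> xy zx; apply: ltn_trans xy.
Qed.

Lemma biword_row_pairwise n cr r : 0 < r -> pairwise biword_lt (biword_row n cr r).
Proof.
move=> r0; rewrite pairwise_map; apply: pairwise_filter.
apply: sub_pairwise (rev_iota_pairwise _ _) => c d /=; rewrite /biword_lt /= eqxx; lia.
Qed.

Lemma biword_row_fst n cr r : all (fun p => p.1 == r) (biword_row n cr r).
Proof. by rewrite all_map; apply/allP => c _ /=. Qed.

Lemma biword_rows_fst n cr m l :
  all (fun p => m <= p.1) (flatten [seq biword_row n cr r | r <- iota m l]).
Proof.
apply/allP => p /flatten_mapP[r]; rewrite mem_iota => /andP[mr _].
by move/(allP (biword_row_fst n cr r))/eqP => ->.
Qed.

Lemma biword_rows_pairwise n cr m l : 0 < m ->
  pairwise biword_lt (flatten [seq biword_row n cr r | r <- iota m l]).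
Proof.
elim: l m => //= l IH m m0; rewrite pairwise_cat biword_row_pairwise // IH // !andbT.
apply/allrelP => p q /(allP (biword_row_fst n cr m))/eqP pm.
by move/(allP (biword_rows_fst n cr _ _)) => mq; rewrite /biword_lt pm mq.
Qed.

Lemma flatten_if (U V : Type) (a : pred U) (f : U -> V) s :
  flatten [seq if a x then [:: f x] else [::] | x <- s] = [seq f x | x <- s & a x].
Proof. by elim: s => //= x s ->; case: (a x). Qed.

Lemma rev_iota_sub n : rev (iota 1 n.-1) = [seq n - r | r <- iota 1 n.-1].
Proof.
apply: (@eq_from_nth _ 0) => [|i]; rewrite size_rev ?size_map // size_iota => lt.
rewrite nth_rev ?size_iota // (nth_map 0) ?size_iota // !nth_iota; lia.
Qed.

Section Rotation.

Variable n : nat.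
Implicit Types (e : {set 'I_n}) (T : {set {set 'I_n}}).

Lemma side_ordS e : side [set ordS v | v in e] = side e.
Proof.
have ordS2 (v : 'I_n) : [set ordS v; ordS (ordS v)] = [set ordS w | w in [set v; ordS v]].
  by rewrite imsetU1 imset_set1.
apply/existsP/existsP => [[v /eqP ev]|[v /eqP ->]]; last by exists (ordS v); rewrite ordS2.
exists (ord_pred v); apply/eqP/(imset_inj (@ordS_inj n)).
by rewrite -ordS2 ord_predK.
Qed.

Lemma cross_box_rotate T b b' :
  box_pair n b' = [set ordS v | v in box_pair n b] ->
  cross_box (rotate T) b' = cross_box T b.
Proof.
move=> eb; rewrite /cross_box eb side_ordS; congr (_ && ~~ _).
by rewrite /rotate mem_imset //; exact: (imset_inj (@ordS_inj n)).
Qed.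

Lemma box_pair_set2 b (u v : 'I_n) : b.2 = u.+1 -> b.1 = n - v ->
  box_pair n b = [set u; v].
Proof.
move=> e1 e2; apply/setP => i; rewrite !inE e1 e2 -!val_eqE /=; congr (_ || _).
have := ltn_ord v; lia.
Qed.

(** Rotation moves these boxes along their antidiagonal, so they keep the letter r + c while their
    row label drops by one. *)
Lemma cross_box_rotateS T r c : 0 < r -> 0 < c -> r + c < n ->
  cross_box (rotate T) (r, c.+1) = cross_box T (r.+1, c).
Proof.
move=> r0 c0 rc; apply: cross_box_rotate.
have un : c.-1 < n by lia.
have vn : n - r.+1 < n by lia.
rewrite (@box_pair_set2 (r.+1, c) (Ordinal un) (Ordinal vn)) /=; try lia.
rewrite imsetU1 imset_set1; apply: box_pair_set2; rewrite /= modn_small; lia.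
Qed.

(** The first row consists of the pairs containing the vertex n, which becomes vertex 1; so the
    letter n - r turns into r at the end of row r. *)
Lemma cross_box_rotate1 T r : 0 < r < n ->
  cross_box (rotate T) (r, 1) = cross_box T (1, n - r).
Proof.
move=> rn; apply: cross_box_rotate.
have un : n - r.+1 < n by lia.
have vn : n.-1 < n by lia.
rewrite (@box_pair_set2 (1, n - r) (Ordinal un) (Ordinal vn)) /=; try lia.
rewrite setUC imsetU1 imset_set1; apply: box_pair_set2 => /=.
  by rewrite prednK ?modnn //; lia.
rewrite modn_small; lia.
Qed.

Lemma biword_row_rotate T r : 0 < r < n ->
  biword_row n (cross_box (rotate T)) r =
    [seq (r, p.2) | p <- biword_row n (cross_box T) r.+1] ++
    (if cross_box T (1, n - r) then [:: (r, r)] else [::]).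
Proof.
move=> rn; have nr : n - r = (n - r.+1).+1 by lia.
have -> : biword_row n (cross_box (rotate T)) r =
    [seq (r, (r + c).-1) | c <- rev (iota 2 (n - r.+1)) & cross_box (rotate T) (r, c)] ++
    (if cross_box T (1, n - r) then [:: (r, r)] else [::]).
  rewrite /biword_row {1}nr [iota _ _]/= rev_cons -cats1 filter_cat map_cat [filter _ [:: 1]]/=.
  by rewrite cross_box_rotate1 //; case: ifP => //= _; rewrite addn1.
congr (_ ++ _).
rewrite /biword_row -map_comp -[2]add1n iotaDl -map_rev filter_map -map_comp.
have -> : [seq c <- rev (iota 1 (n - r.+1)) | cross_box T (r.+1, c)] =
          [seq c <- rev (iota 1 (n - r.+1)) | preim (addn 1) [eta cross_box (rotate T) \o pair r]
            c].
  apply/eq_in_filter => c; rewrite mem_rev mem_iota => h.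
  by rewrite /= add1n cross_box_rotateS //; lia.
by apply: eq_map => c /=; congr (_, _); lia.
Qed.

End Rotation.

Theorem theorem4p7 (n k : nat) (k_gt0 : 0 < k) (k2_lt_n : 2 * k < n)
    (T : {set {set 'I_n}}) (T_ktri : ktriangulation k T) :
  Qtab (rotate T) = promotion k (Qtab T).
Proof.
have [word act] := triangulation_word k_gt0 k2_lt_n T_ktri.
rewrite -unzip2_biword in word act.
set cr := cross_box T.
pose u := unzip2 (biword_row n cr 1); pose V := flatten [seq biword_row n cr r | r <- iota 2 n.-2].
have sE : biword T = [seq (1, b) | b <- u] ++ V.
  rewrite biword_rows (_ : n.-1 = n.-2.+1) /=; last by lia.
  by congr (_ ++ _); rewrite /u /unzip2 -map_comp -[LHS]map_id; apply/eq_in_map => p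
    /(allP (biword_row_fst n cr 1))/eqP; case: p => a b /= ->.
pose A r := [seq (r, p.2) | p <- biword_row n cr r.+1].
pose e r := if cr (1, n - r) then [:: (r, r)] else [::].
have rot : biword (rotate T) = flatten [seq A r ++ e r | r <- iota 1 n.-1].
  rewrite biword_rows; congr flatten; apply/eq_in_map => r.
  by rewrite mem_iota => h; apply: biword_row_rotate; lia.
rewrite /Qtab rot sE; apply: recording_rotate; rewrite -?sE //.
- have := biword_row_pairwise n cr (ltn0Sn 0) => pw; apply: pairwise_sorted.
  rewrite /u /unzip2 pairwise_map; move: pw; rewrite /biword_row !pairwise_map.
  by apply: sub_pairwise => c d; rewrite /biword_lt /=.
- exact/pairwise_sorted/biword_rows_pairwise.
- by apply: sub_all (biword_rows_fst n cr 2 _).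
- move=> r r0; apply/allP => b /mapP[p /mapP[q qr ->] ->] /=.
  move: qr => /mapP[c]; rewrite mem_filter mem_rev mem_iota => /andP[_ h] -> /=; lia.
- by move=> r; rewrite /e; case: ifP; [right; exists r | left].
- have -> : V = flatten [seq biword_row n cr r.+1 | r <- iota 1 n.-1].
    (* The extra row n of the staircase is empty, so adding it makes both index ranges equally
       long. *)
    rewrite (_ : n.-1 = n.-2 + 1); last by lia.
    rewrite iotaD map_cat flatten_cat /= (_ : biword_row n cr _ = [::]) ?cats0; last first.
      by rewrite /biword_row (_ : n - _ = 0) //; lia.
    by rewrite /V -[2]add1n iotaDl -map_comp; congr flatten; apply: eq_map => r /=; rewrite add1n.
  rewrite map_flatten -map_comp; congr flatten; apply: eq_map => r /=.
  by apply/eq_in_map => p /(allP (biword_row_fst n cr r.+1))/eqP ->.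
rewrite flatten_if /u /unzip2 -!map_comp subn1 rev_iota_sub filter_map -map_comp.
have -> : [seq r <- iota 1 n.-1 | preim [eta subn n] [pred c | cr (1, c)] r] =
  [seq r <- iota 1 n.-1 | cr (1, n - r)] by [].
apply/eq_in_map => r; rewrite mem_filter mem_iota => /andP[_ h] /=; congr (_, _); lia.
Qed.
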